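(* Let $m>0$ and $\mu>0$ satisfy $\mu<m<2\mu$, let $\rho\in\mathbb R$ be a constant, and let $q\in L^2(\mathbb R)\cap L^1(\mathbb R)$. Then, for both choices of sign, $$\Big\|\int_t^\infty W_0(-\tau)\begin{pmatrix}0\\ q\end{pmatrix}\frac{e^{\pm2i\mu\tau}}{(1+\tau)^{1\mp2i\rho}}\,d\tau\Big\|_E=O(t^{-1/3}),\qquad t\to\infty .$$
   Context: $W_0(t)=e^{A_0t}$ is the dynamical group of the free Klein-Gordon equation, with $A_0=\begin{pmatrix}0&1\\ \frac{d^2}{dx^2}-m^2&0\end{pmatrix}$ on $\mathbb R$. The norm is $\|(\psi,\pi)\|_E=\|\psi\|_{H^1(\mathbb R)}+\|\pi\|_{L^2(\mathbb R)}$. The integral is understood as $\lim_{T\to\infty}\int_t^T$ in this norm. *)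

(* Defs.v *)
From HB Require Import structures.
From mathcomp Require Import all_boot all_order all_algebra.
From mathcomp Require Import complex.
From mathcomp Require Import all_classical all_reals all_analysis.
Set Implicit Arguments.
Unset Strict Implicit.
Unset Printing Implicit Defensive.
Import Order.TTheory GRing.Theory Num.Theory.
Import numFieldNormedType.Exports.
Local Open Scope classical_set_scope.
Local Open Scope ring_scope.

(* Complex-valued functions on the line.  The regular-module alias [R[i]^o]
   makes them, and pairs of them, left modules over [R[i]]. *)
Definition cfun (R : realType) : Type := R -> R[i]^o.

Definition cexp (R : realType) (z : R[i]) : R[i] :=
  Complex (expR (complex.Re z) * cos (complex.Im z))
          (expR (complex.Re z) * sin (complex.Im z)).

(* The power x ^ z, for a real base x > 0. *)
Definition rcpow (R : realType) (x : R) (z : R[i]) : R[i] :=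
  cexp (z * Complex (ln x) 0).

Definition cintegral (R : realType) (f : R -> R[i]) : R[i] :=
  Complex (\int[@lebesgue_measure R]_x complex.Re (f x))
          (\int[@lebesgue_measure R]_x complex.Im (f x)).

Definition inLp (R : realType) (p : \bar R) (f : cfun R) : Prop :=
  ((fun x => complex.Re (f x)) \in Lfun (@lebesgue_measure R) p) /\
  ((fun x => complex.Im (f x)) \in Lfun (@lebesgue_measure R) p).

Definition normL2 (R : realType) (f : cfun R) : R :=
  fine (Lnorm (@lebesgue_measure R) 2%:E (fun x => (Normc.normc (f x))%:E)).

Definition test_function (R : realType) (phi : R -> R^o) : Prop :=
  (forall (n : nat) (x : R), derivable (derive1n n phi) x 1) /\
  (exists M : R, forall x, M < `|x| -> phi x = 0).

Definition weak_derivative (R : realType) (f g : cfun R) : Prop :=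
  forall phi : R -> R^o, test_function phi ->
    cintegral (fun x => f x * Complex (derive1 phi x) 0) =
    - cintegral (fun x => g x * Complex (phi x) 0).

Definition inH1 (R : realType) (f : cfun R) : Prop :=
  inLp 2%:E f /\ exists g : cfun R, inLp 2%:E g /\ weak_derivative f g.

(* A representative of the L^2 weak derivative, which is unique almost
   everywhere; it is meaningful only when [inH1 f]. *)
Definition wderiv (R : realType) (f : cfun R) : cfun R :=
  xget 0 [set g : cfun R | inLp 2%:E g /\ weak_derivative f g].

Definition inH2 (R : realType) (f : cfun R) : Prop :=
  inH1 f /\ inH1 (wderiv f).

Definition normH1 (R : realType) (f : cfun R) : R :=
  Num.sqrt (normL2 f ^+ 2 + normL2 (wderiv f) ^+ 2).

(* Elements of E = H^1 (+) L^2 are represented by pairs (psi, pi) of functions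
   satisfying [in_energy], identified up to [eq_energy]. *)
Definition state (R : realType) : Type := (cfun R * cfun R)%type.

Definition in_energy (R : realType) (u : state R) : Prop :=
  inH1 u.1 /\ inLp 2%:E u.2.

Definition eq_energy (R : realType) (u v : state R) : Prop :=
  (u.1 = v.1 %[ae @lebesgue_measure R]) /\
  (u.2 = v.2 %[ae @lebesgue_measure R]).

Definition norm_energy (R : realType) (u : state R) : R :=
  normH1 u.1 + normL2 u.2.

(* Strongly continuous one-parameter groups of bounded operators on E; only
   the values of [W t] on [in_energy] matter. *)
Record C0_group (R : realType) (W : R -> state R -> state R) : Prop := {
  C0_group_stable : forall t u, in_energy u -> in_energy (W t u);
  C0_group_linear : forall t (a : R[i]) u v, in_energy u -> in_energy v ->
    eq_energy (W t (a *: u + v)) (a *: W t u + W t v);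
  C0_group_bounded : forall t, exists C : R, forall u, in_energy u ->
    norm_energy (W t u) <= C * norm_energy u;
  C0_group_0 : forall u, in_energy u -> eq_energy (W 0 u) u;
  C0_group_D : forall s t u, in_energy u -> eq_energy (W (s + t) u) (W s (W t u));
  C0_group_continuous : forall u, in_energy u ->
    norm_energy (W h u - u) @[h --> (0 : R)] --> (0 : R) }.

(* The unbounded operator A on E with domain D is the infinitesimal generator
   of W: D is exactly the set of u at which t |-> W t u is differentiable at 0
   in E, and A u is the derivative. *)
Definition generator (R : realType) (W : R -> state R -> state R)
    (D : set (state R)) (A : state R -> state R) : Prop :=
  forall u v, in_energy u -> in_energy v ->
    (norm_energy (Complex h^-1 0 *: (W h u - u) - v) @[h --> (0 : R)^'] --> (0 : R))
    <-> (D u /\ eq_energy v (A u)).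

Definition KG_domain (R : realType) : set (state R) :=
  [set u | inH2 u.1 /\ inH1 u.2].

Definition KG_operator (R : realType) (m : R) (u : state R) : state R :=
  (u.2, wderiv (wderiv u.1) - Complex (m ^+ 2) 0 *: u.1).

(* W is the group e^{A_0 t} on E. *)
Definition KG_group (R : realType) (m : R) (W : R -> state R -> state R) :
    Prop :=
  C0_group W /\ generator W (@KG_domain R) (KG_operator m).

(* [I] is the Riemann integral over [a, b], a <= b, of the E-valued function
   [F], as a limit in E of tagged Riemann sums; for the continuous integrands
   considered here it coincides with the Bochner integral. *)
Definition is_RInt_energy (R : realType) (F : R -> state R) (a b : R)
    (I : state R) : Prop :=
  in_energy I /\
  forall e : R, 0 < e -> exists2 d : R, 0 < d &
    forall (n : nat) (x xi : nat -> R),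
      x 0%N = a -> x n = b ->
      (forall i, (i < n)%N ->
         [/\ x i <= xi i, xi i <= x i.+1 & x i.+1 - x i < d]) ->
      norm_energy (\sum_(i < n) Complex (x i.+1 - x i) 0 *: F (xi i) - I) < e.

(* [L] is the limit in E, as T -> +oo, of the integrals over [t, T]. *)
Definition is_improper_RInt_energy (R : realType) (F : R -> state R) (t : R)
    (L : state R) : Prop :=
  in_energy L /\ exists J : R -> state R,
    (forall T, t <= T -> is_RInt_energy F t T (J T)) /\
    (norm_energy (J T - L) @[T --> +oo] --> (0 : R)).

(* e^{2 s i mu tau} / (1 + tau)^{1 - 2 s i rho}, for the sign s = 1 or -1. *)
Definition oscillating_weight (R : realType) (mu rho s tau : R) : R[i] :=
  cexp (Complex 0 (2 * s * mu * tau)) /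
  rcpow (1 + tau) (Complex 1 (- (2 * s * rho))).

(* Main.v *)
Require Import Defs.
From HB Require Import structures.
From mathcomp Require Import all_boot all_order all_algebra.
From mathcomp Require Import complex ring lra.
From mathcomp Require Import all_classical all_reals all_analysis.
From mathcomp Require Import measurable_realfun.
Set Implicit Arguments.
Unset Strict Implicit.
Unset Printing Implicit Defensive.
Import Order.TTheory GRing.Theory Num.Theory.
Import numFieldNormedType.Exports.
Local Open Scope classical_set_scope.
Local Open Scope ring_scope.

(* Put al = 2 s mu, so that |al| > m, and Q = (0, q). The weight w satisfies
   w' = i al w + O(tau^-2) with |w| <= 1 / (1 + tau), so the integral would be
   O(1 / t) if Q were (i al - A_0) P. As i al lies in the continuous spectrum, one
   moves to lambda = d + i al, d > 0: the resolvent P_d = (lambda - A_0)^-1 Q has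
   first component (v - u) / (2 kappa), kappa^2 = m^2 + lambda^2, where
   v' = kappa v - q and u' = - kappa u - q. Both solutions are bounded by the L^1
   norm of q, and by that norm over sqrt (Re kappa) in L^2; as Re kappa is at least
   a multiple of d, P_d is O(d^(-1/2)) in the energy space. Integrating by parts
   over [t, 2 t] with d = 1 / t gives O(t^(-1/2)), because the group is uniformly
   bounded by conservation of energy; a dyadic sum then bounds the whole tail by
   O(t^(-1/2)), which is better than O(t^(-1/3)). *)

(** States are functions, so identities in the energy space hold only up to null sets. The argument
    therefore runs in a complete seminormed space, where [N (u - v) = 0] replaces equality.
    Vector-valued integrals are handled through primitives whose difference quotients converge
    uniformly: their increments are limits of Riemann sums, and they obey a mean value inequality
    and a Leibniz rule, which is all that integration by parts needs.

    The choice d = 1 / t balances two errors. Over [t, 2 t] the boundary terms have size d^(-1/2) /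
    t, while the damping leaves d w P_d under the integral, which contributes d^(1/2). For q merely
    in L^1 and L^2, P_d need not stay bounded in the energy space as d tends to 0. The condition m <
    2 mu gives al^2 > m^2, which keeps kappa, and hence the factor 1 / (2 kappa), under control for
    small d.

    The group is known only through its generator, so conservation of energy is derived from there:
    it amounts to an integration by parts for weak derivatives, obtained by passing to absolutely
    continuous representatives. *)

Local Notation "x %:c" := (real_complex _ x) (at level 1, format "x %:c").

(* The square-zero extension of a commutative ring by a module turns module
   identities into ring identities, which [ring] can prove. *)
Section SquareZeroExtension.
Context (K : comNzRingType) (V : lmodType K).

Definition sqz : Type := (K * V)%type.
HB.instance Definition _ := GRing.Zmodule.on sqz.

Definition sqz_mul (x y : sqz) : sqz := (x.1 * y.1, x.1 *: y.2 + y.1 *: x.2).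

Lemma sqz_mulA : associative sqz_mul.
Proof.
move=> x y z; rewrite /sqz_mul /= mulrA !scalerDr !scalerA addrA.
by rewrite (mulrC z.1 x.1) (mulrC z.1 y.1).
Qed.

Lemma sqz_mulC : commutative sqz_mul.
Proof. by move=> x y; rewrite /sqz_mul mulrC addrC. Qed.

Lemma sqz_mul1 : left_id ((1, 0) : sqz) sqz_mul.
Proof. by case=> a u; rewrite /sqz_mul /= mul1r scale1r scaler0 addr0. Qed.

Lemma sqz_mulDl : left_distributive sqz_mul +%R.
Proof.
move=> x y z; rewrite /sqz_mul /= mulrDl scalerDl scalerDr.
by congr pair; rewrite addrACA.
Qed.

Lemma sqz_oner_neq0 : ((1, 0) : sqz) != 0.
Proof. by apply/eqP => -[/eqP]; rewrite oner_eq0. Qed.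

HB.instance Definition _ := GRing.Zmodule_isComNzRing.Build sqz
  sqz_mulA sqz_mulC sqz_mul1 sqz_mulDl sqz_oner_neq0.

Definition sqz_vec (v : V) : sqz := (0, v).
Definition sqz_scal (a : K) : sqz := (a, 0).

Lemma sqz_vec_inj : injective sqz_vec. Proof. by move=> u v []. Qed.
Lemma sqz_vec0 : sqz_vec 0 = 0. Proof. by []. Qed.
Lemma sqz_vecD u v : sqz_vec (u + v) = sqz_vec u + sqz_vec v.
Proof. by congr pair; rewrite /= addr0. Qed.
Lemma sqz_vecN u : sqz_vec (- u) = - sqz_vec u.
Proof. by congr pair; rewrite /= oppr0. Qed.
Lemma sqz_vecZ a u : sqz_vec (a *: u) = sqz_scal a * sqz_vec u.
Proof. by congr pair; rewrite /= ?mulr0 ?scale0r ?addr0. Qed.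

Lemma sqz_scal_additive : zmod_morphism sqz_scal.
Proof. by move=> a b; congr pair; rewrite /= subr0. Qed.
Lemma sqz_scal_multiplicative : monoid_morphism sqz_scal.
Proof. by split=> // a b; congr pair; rewrite /= !scaler0 addr0. Qed.
HB.instance Definition _ := GRing.isZmodMorphism.Build K sqz sqz_scal sqz_scal_additive.
HB.instance Definition _ := GRing.isMonoidMorphism.Build K sqz sqz_scal sqz_scal_multiplicative.
End SquareZeroExtension.

Ltac module :=
  apply: sqz_vec_inj;
  rewrite ?(sqz_vecD, sqz_vecN, sqz_vecZ, sqz_vec0); ring.

(** * Seminormed spaces and primitives *)

Section NormC.
Context {R : realType}.
Implicit Types z : R[i].

Lemma normc_ge0 z : 0 <= Normc.normc z.
Proof. by case: z => a b; rewrite sqrtr_ge0. Qed.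

Lemma normc_real (x : R) : Normc.normc x%:c = `|x|.
Proof. by rewrite /= expr0n addr0 sqrtr_sqr. Qed.
End NormC.

Section Seminorm.
Context (R : realType) (V : lmodType R[i]).

(** A seminorm and not a norm, because the energy norm vanishes on differences of almost everywhere
    equal states. Nonnegativity and [N 0 = 0] follow from the two fields. *)
Record seminorm (N : V -> R) : Prop := Seminorm {
  seminormD : forall u v, N (u + v) <= N u + N v;
  seminormZ : forall a u, N (a *: u) = Normc.normc a * N u }.

Definition seminorm_complete (N : V -> R) : Prop :=
  forall u : nat -> V,
    (forall e, 0 < e -> exists n0, forall n m, (n0 <= n)%N -> (n0 <= m)%N ->
       N (u n - u m) <= e) ->
    exists l, forall e, 0 < e -> exists n0, forall n, (n0 <= n)%N ->
      N (u n - l) <= e.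

Context (N : V -> R) (hN : seminorm N).

Lemma seminorm0 : N 0 = 0.
Proof. by rewrite -(scale0r 0) (seminormZ hN) Normc.normc0 mul0r. Qed.

Lemma seminormN u : N (- u) = N u.
Proof.
by rewrite -scaleN1r (seminormZ hN) normcN Normc.normc1 mul1r.
Qed.

Lemma seminorm_distC u v : N (u - v) = N (v - u).
Proof. by rewrite -seminormN opprB. Qed.

Lemma seminorm_ge0 u : 0 <= N u.
Proof.
have := seminormD hN u (- u).
by rewrite subrr seminorm0 seminormN; lra.
Qed.

Lemma seminormZr (r : R) u : N (r%:c *: u) = `|r| * N u.
Proof. by rewrite (seminormZ hN) normc_real. Qed.

Lemma seminormB u v : N (u - v) <= N u + N v.
Proof. by rewrite -(seminormN v); exact: seminormD. Qed.

Lemma seminorm_dist_trans v u w : N (u - w) <= N (u - v) + N (v - w).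
Proof. by apply: le_trans (seminormD hN _ _); rewrite subrKA. Qed.

Lemma seminorm_le_dist u v : N u <= N v + N (u - v).
Proof. by rewrite addrC; apply: le_trans (seminormD hN _ _); rewrite subrK. Qed.

Lemma seminorm_sum (I : Type) (r : seq I) (P : pred I) (f : I -> V) :
  N (\sum_(i <- r | P i) f i) <= \sum_(i <- r | P i) N (f i).
Proof.
apply: (big_ind2 (fun u x => N u <= x)) => //; first by rewrite seminorm0.
by move=> u x v y ux vy; apply: le_trans (seminormD hN _ _) _; exact: lerD.
Qed.

Lemma seminorm_eq u v : N (u - v) = 0 -> N u = N v.
Proof.
move=> uv; apply/eqP; rewrite eq_le; apply/andP; split.
  by have := seminorm_le_dist u v; rewrite uv addr0.
by have := seminorm_le_dist v u; rewrite seminorm_distC uv addr0.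
Qed.

(** Cut [a, b] into equal pieces shorter than [d] and sum the local estimates along the telescoping
    increments of [G]. *)
Lemma lipschitz_of_local (G : R -> V) (K d a b : R) : 0 < d -> a <= b ->
  (forall x y, a <= x -> x <= y -> y <= b -> y - x < d ->
     N (G y - G x) <= K * (y - x)) ->
  N (G b - G a) <= K * (b - a).
Proof.
move=> d0 ab hG.
(* [n.+1] exceeds (b - a) / d, so each piece is shorter than [d]. *)
pose n := Num.truncn ((b - a) / d).
pose h := (b - a) / n.+1%:R.
have n0 : 0 < n.+1%:R :> R by rewrite ltr0n.
have h0 : 0 <= h by rewrite divr_ge0 ?subr_ge0 // ltW.
have hd : h < d.
  rewrite /h ltr_pdivrMr // mulrC -ltr_pdivrMr //.
  by rewrite truncnS_gt.
have hn : h * n.+1%:R = b - a by rewrite /h divfK // gt_eqF.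
pose x (i : nat) := a + i%:R * h.
have xS i : x i.+1 - x i = h by rewrite /x -natr1; ring.
have xb : x n.+1 = b by rewrite /x mulrC hn; ring.
have x0 : x 0%N = a by rewrite /x mul0r addr0.
have xmono i j : (i <= j)%N -> x i <= x j.
  by move=> ij; rewrite /x lerD2l ler_wpM2r // ler_nat.
have -> : G b - G a = \sum_(0 <= i < n.+1) (G (x i.+1) - G (x i)).
  by rewrite (telescope_sumr (fun i => G (x i))) // xb x0.
apply: le_trans (seminorm_sum _ _ _) _.
have -> : K * (b - a) = \sum_(0 <= i < n.+1) (K * h).
  by rewrite sumr_const_nat subn0 -mulr_natr -hn; ring.
apply: ler_sum_nat => i /andP[_ ni].
rewrite -(xS i); apply: hG; rewrite ?xS //.
- by rewrite -x0 xmono.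
- exact: xmono.
- by rewrite -xb xmono.
Qed.

(* [P] is a primitive of [F] on [a, b], with a difference quotient converging
   uniformly; this is what makes its increments limits of Riemann sums. *)
Definition primitive (F P : R -> V) (a b : R) : Prop :=
  forall e, 0 < e -> exists2 d, 0 < d & forall x xi y,
    a <= x -> x <= xi -> xi <= y -> y <= b -> y - x < d ->
    N (P y - P x - (y - x)%:c *: F xi) <= e * (y - x).

Lemma primitive_sub F P a b a' b' : a <= a' -> b' <= b ->
  primitive F P a b -> primitive F P a' b'.
Proof.
move=> aa bb hF e e0; have [d d0 hd] := hF e e0; exists d => // x xi y *.
by apply: hd => //; [exact: (le_trans aa)|exact: (le_trans _ bb)].
Qed.

(** At a small scale the increments of [P] are bounded by c + e / (b - a) times the length, whence
    the global bound up to [e]. The case [c = 0] serves as uniqueness of primitives up to null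
    vectors. *)
Lemma primitive_mean_value F P a b c : a <= b -> primitive F P a b ->
  (forall x, a <= x -> x <= b -> N (F x) <= c) ->
  N (P b - P a) <= c * (b - a).
Proof.
move=> ab hP hF.
have [->|ba] := eqVneq a b; first by rewrite !subrr seminorm0 mulr0.
have ba0 : 0 < b - a by rewrite subr_gt0 lt_neqAle ba.
apply/ler_addgt0Pr => e e0.
have e'0 : 0 < e / (b - a) by rewrite divr_gt0.
have [d d0 hd] := hP _ e'0.
have -> : c * (b - a) + e = (c + e / (b - a)) * (b - a).
  by rewrite mulrDl divfK // gt_eqF.
apply: (lipschitz_of_local d0 ab) => x y ax xy yb yx.
have := hd x x y ax (lexx x) xy yb yx.
have h1 := seminorm_le_dist (P y - P x) ((y - x)%:c *: F x).
rewrite seminormZr ger0_norm ?subr_ge0 // in h1.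
have h2 : (y - x) * N (F x) <= (y - x) * c.
  by rewrite ler_wpM2l ?subr_ge0 // hF // (le_trans xy).
lra.
Qed.

Lemma primitiveD F P F' P' a b (c : R[i]) :
  primitive F P a b -> primitive F' P' a b ->
  primitive (fun x => c *: F x + F' x) (fun x => c *: P x + P' x) a b.
Proof.
move=> h h' e e0.
pose k := Normc.normc c + 1.
have k0 : 0 < k by rewrite ltr_wpDl ?normc_ge0.
have [d d0 hd] := h (e / (2 * k)) (divr_gt0 e0 (mulr_gt0 (ltr0Sn _ 1) k0)).
have [d' d'0 hd'] := h' (e / 2) (divr_gt0 e0 (ltr0Sn _ 1)).
exists (Num.min d d'); first by rewrite lt_min d0.
move=> x xi y ax xxi xiy yb; rewrite lt_min => /andP[yxd yxd'].
have -> : c *: P y + P' y - (c *: P x + P' x)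
    - (y - x)%:c *: (c *: F xi + F' xi) =
  c *: (P y - P x - (y - x)%:c *: F xi)
    + (P' y - P' x - (y - x)%:c *: F' xi) by module.
apply: le_trans (seminormD hN _ _) _; rewrite (seminormZ hN).
have := hd' x xi y ax xxi xiy yb yxd'.
have h1 := hd x xi y ax xxi xiy yb yxd.
have yx0 : 0 <= y - x by rewrite subr_ge0 (le_trans xxi).
have h2 : Normc.normc c * N (P y - P x - (y - x)%:c *: F xi)
    <= e / 2 * (y - x).
  have -> : e / 2 * (y - x) = k * (e / (2 * k) * (y - x)).
    by field; rewrite gt_eqF.
  apply: ler_pM; rewrite ?normc_ge0 ?seminorm_ge0 //.
  by rewrite /k lerDl ler01.
lra.
Qed.

Lemma primitive_shift F P a b (c : R) :
  primitive F P (a + c) (b + c) ->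
  primitive (fun x => F (x + c)) (fun x => P (x + c)) a b.
Proof.
move=> h e e0; have [d d0 hd] := h e e0; exists d => //.
move=> x xi y ax xxi xiy yb yxd.
have := hd (x + c) (xi + c) (y + c).
rewrite (_ : y + c - (x + c) = y - x); last by ring.
by apply; rewrite ?lerD2r.
Qed.

(** Leibniz rule for a scalar weight. The error splits into four parts: the Taylor error of [w]
    against [P y], [w'] against an increment of [P], [w x] against the error of the primitive [P],
    and an increment of [w] against [F xi]. Three of them are quadratic in the step. *)
Lemma primitive_scale (w w' : R -> R[i]) (F P : R -> V) (a b L K : R) :
  0 <= L -> 0 <= K ->
  (forall x, a <= x -> x <= b -> Normc.normc (w x) <= L) ->
  (forall x, a <= x -> x <= b -> Normc.normc (w' x) <= L) ->
  (forall x xi y, a <= x -> x <= xi -> xi <= y -> y <= b ->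
     Normc.normc (w y - w x - (y - x)%:c * w' xi) <= L * (y - x) ^+ 2) ->
  (forall x, a <= x -> x <= b -> N (F x) <= K) ->
  (forall x, a <= x -> x <= b -> N (P x) <= K) ->
  primitive F P a b ->
  primitive (fun x => w' x *: P x + w x *: F x) (fun x => w x *: P x) a b.
Proof.
move=> L0 K0 hw hw' hd hF hP prim e e0.
(* The quadratic errors contribute L K, L K and 2 L K times the square of the step; the summand 1
   makes [A] positive. *)
pose A := 4 * L * K + 1.
have A0 : 0 < A by rewrite ltr_wpDl // !mulr_ge0.
have L1 : 0 < L + 1 by lra.
have [d d0 hd'] := prim (e / (2 * (L + 1)))
  (divr_gt0 e0 (mulr_gt0 (ltr0Sn _ 1) L1)).
exists (Num.min (Num.min d 1) (e / (2 * A))).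
  by rewrite !lt_min d0 ltr01 divr_gt0 // mulr_gt0.
move=> x xi y ax xxi xiy yb; rewrite !lt_min => /andP[/andP[yxd yx1] yxe].
set h := y - x.
have h0 : 0 <= h by rewrite subr_ge0 (le_trans xxi).
have -> : w y *: P y - w x *: P x - h%:c *: (w' xi *: P xi + w xi *: F xi) =
  ((w y - w x - h%:c * w' xi) *: P y + (h%:c * w' xi) *: (P y - P xi)) +
  (w x *: (P y - P x - h%:c *: F xi) + (h%:c * (w x - w xi)) *: F xi)
  by module.
have b1 : N ((w y - w x - h%:c * w' xi) *: P y) <= L * h ^+ 2 * K.
  rewrite (seminormZ hN) ler_pM ?normc_ge0 ?seminorm_ge0 //; first exact: hd.
  by apply: hP => //; lra.
have b2 : N ((h%:c * w' xi) *: (P y - P xi)) <= h * L * (K * h).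
  rewrite (seminormZ hN) Normc.normcM normc_real ger0_norm //.
  rewrite ler_pM ?mulr_ge0 ?normc_ge0 ?seminorm_ge0 //.
    by rewrite ler_wpM2l // hw' //; lra.
  apply: (@le_trans _ _ (K * (y - xi))).
    apply: (primitive_mean_value xiy).
      by apply: primitive_sub prim => //; lra.
    by move=> z z1 z2; apply: hF; lra.
  by rewrite ler_wpM2l // /h; lra.
have b3 : N (w x *: (P y - P x - h%:c *: F xi)) <= (L + 1) * (e / (2 * (L + 1)) * h).
  rewrite (seminormZ hN) ler_pM ?normc_ge0 ?seminorm_ge0 //.
    by apply: (@le_trans _ _ L); [apply: hw; lra|lra].
  exact: hd'.
have b4 : N ((h%:c * (w x - w xi)) *: F xi) <= h * (2 * L * h) * K.
  rewrite (seminormZ hN) Normc.normcM normc_real ger0_norm //.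
  rewrite ler_pM ?mulr_ge0 ?normc_ge0 ?seminorm_ge0 //; last by apply: hF; lra.
  rewrite ler_wpM2l //.
  have -> : w x - w xi = - ((w xi - w x - (xi - x)%:c * w' xi)
                             + (xi - x)%:c * w' xi) by ring.
  rewrite normcN; apply: le_trans (le_normcD _ _) _.
  rewrite Normc.normcM normc_real ger0_norm ?subr_ge0 //.
  have c1 := hd x xi xi ax xxi (lexx _) (le_trans xiy yb).
  have c2 : (xi - x) * Normc.normc (w' xi) <= h * L.
    by rewrite ler_pM ?normc_ge0 ?subr_ge0 ?hw' //; rewrite /h; lra.
  have c3 : L * (xi - x) ^+ 2 <= L * h.
    rewrite ler_wpM2l //.
    have k0 : 0 <= xi - x by lra.
    have k1 : xi - x <= h by rewrite /h; lra.
    have k2 : xi - x <= 1 by lra.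
    by rewrite expr2; apply: le_trans (ler_wpM2l k0 k2) _; rewrite mulr1.
  apply: le_trans (lerD c1 c2) _; lra.
apply: le_trans (seminormD hN _ _) _.
apply: le_trans (lerD (seminormD hN _ _) (seminormD hN _ _)) _.
apply: le_trans (lerD (lerD b1 b2) (lerD b3 b4)) _.
have -> : L * h ^+ 2 * K + h * L * (K * h)
   + ((L + 1) * (e / (2 * (L + 1)) * h) + h * (2 * L * h) * K)
  = (4 * L * K) * h * h + e / 2 * h by field; rewrite gt_eqF.
rewrite -mulrDl ler_wpM2r //.
have : (4 * L * K) * h <= A * (e / (2 * A)).
  by rewrite ler_pM // ?mulr_ge0 // ?ltW // /A; lra.
have -> : A * (e / (2 * A)) = e / 2 by field; rewrite gt_eqF.
lra.
Qed.

(** Since the tag [xi] is arbitrary in the definition of a primitive, the estimate can be summed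
    over any tagged partition. The denominator b - a + 1 gives a strict inequality even when a =
    b. *)
Lemma primitive_riemann_sum F P a b : a <= b -> primitive F P a b ->
  forall e, 0 < e -> exists2 d, 0 < d &
    forall (n : nat) (x xi : nat -> R), x 0%N = a -> x n = b ->
      (forall i, (i < n)%N ->
         [/\ x i <= xi i, xi i <= x i.+1 & x i.+1 - x i < d]) ->
      N (\sum_(i < n) (x i.+1 - x i)%:c *: F (xi i) - (P b - P a)) < e.
Proof.
move=> ab hP e e0.
have k0 : 0 < b - a + 1 by lra.
have [d d0 hd] := hP _ (divr_gt0 e0 k0); exists d => // n x xi xa xb hx.
have mono j i : (i <= j)%N -> (j <= n)%N -> x i <= x j.
  elim: j => [|j ih]; first by rewrite leqn0 => /eqP ->.
  rewrite leq_eqVlt => /predU1P[->//|]; rewrite ltnS => ij jn.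
  by apply: le_trans (ih ij (ltnW jn)) _; have [] := hx j jn => *; lra.
have -> : P b - P a = \sum_(i < n) (P (x i.+1) - P (x i)).
  by rewrite -(big_mkord xpredT (fun i => P (x i.+1) - P (x i)))
             (telescope_sumr (fun i => P (x i))) // xa xb.
rewrite -sumrB; apply: le_lt_trans (seminorm_sum _ _ _) _.
apply: (@le_lt_trans _ _ (\sum_(i < n) (e / (b - a + 1) * (x i.+1 - x i)))).
  apply: ler_sum => i _; rewrite seminorm_distC.
  have [h1 h2 h3] := hx i (ltn_ord i).
  apply: hd => //; first by rewrite -xa mono // ltnW.
  by rewrite -xb mono.
rewrite -mulr_sumr.
rewrite -(big_mkord xpredT (fun i => x i.+1 - x i)).
rewrite (telescope_sumr x) // xa xb.
rewrite mulrAC ltr_pdivrMr // ltr_pM2l //; lra.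
Qed.
End Seminorm.

(** * Uniform continuity on compact segments *)

Section UniformContinuity.
Context (R : realType) (X : Type) (D : X -> X -> R).
Hypothesis symD : forall u v, D u v = D v u.
Hypothesis trD : forall v u w, D u w <= D u v + D v w.

(** Heine's argument through near-coverings of a compact set. An abstract distance [D] lets it serve
    both vector-valued maps with a seminorm and real functions. *)
Lemma segment_uniformly_continuous (F : R -> X) (a b : R) :
  (forall x, a <= x -> x <= b -> forall e : R, 0 < e -> exists2 d, 0 < d &
     forall y, a <= y -> y <= b -> `|y - x| < d -> D (F y) (F x) <= e) ->
  forall e, 0 < e -> exists2 d, 0 < d & forall x y : R,
    a <= x -> x <= b -> a <= y -> y <= b -> `|y - x| < d -> D (F y) (F x) <= e.
Proof.
move=> hF e e0.
have /compact_near_coveringP cov := @segment_compact R a b.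
have : \forall d \near 0^'+, 0 < d /\ `[a, b] `<=`
    (fun x => forall y, a <= x -> x <= b -> a <= y -> y <= b -> `|y - x| < d ->
      D (F y) (F x) <= e).
  near=> d; split; first by near: d; exact: nbhs_right_gt.
  near: d; apply: (cov R (0^'+) (fun d x => forall y, a <= x -> x <= b ->
    a <= y -> y <= b -> `|y - x| < d -> D (F y) (F x) <= e)).
  move=> x /=; rewrite in_itv /= => /andP[ax xb].
  have [d d0 hd] := hF x ax xb _ (divr_gt0 e0 (ltr0Sn _ 1)).
  have d20 : 0 < d / 2 by rewrite divr_gt0.
  exists ([set z | `|z - x| < d / 2], [set r | 0 < r < d / 2]).
    split => /=.
      by exists (d / 2) => // z /=; rewrite distrC.
    exists (d / 2) => // r /=; rewrite sub0r normrN => rd r0.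
    by rewrite r0 (le_lt_trans (ler_norm _)).
  move=> [z r] /= [zx /andP[r0 rd]] y az zb ay yb yz.
  have yx : `|y - x| < d.
    rewrite (_ : y - x = (y - z) + (z - x)); last by ring.
    by apply: le_lt_trans (ler_normD _ _) _; lra.
  have h1 := hd y ay yb yx.
  have zxd : `|z - x| < d by lra.
  have h2 := hd z az zb zxd.
  apply: le_trans (trD (F x) _ _) _.
  have := h2; rewrite symD; lra.
case/filter_ex => d [d0 hd]; exists d => // x y ax xb ay yb yx.
by apply: (hd x) => //; rewrite /= in_itv /= ax.
Unshelve. all: by end_near.
Qed.

End UniformContinuity.

(** * Primitives of continuous vector-valued maps *)

Section Existence.
Context (R : realType) (V : lmodType R[i]) (N : V -> R).
Context (hN : seminorm N) (hC : seminorm_complete N).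
Local Notation primitive := (primitive N).

Lemma continuous_on_segment_uniform (F : R -> V) (a b : R) :
  (forall x, a <= x -> x <= b -> forall e : R, 0 < e -> exists2 d, 0 < d &
     forall y, a <= y -> y <= b -> `|y - x| < d -> N (F y - F x) <= e) ->
  forall e, 0 < e -> exists2 d, 0 < d & forall x y : R,
    a <= x -> x <= b -> a <= y -> y <= b -> `|y - x| < d -> N (F y - F x) <= e.
Proof.
apply: (@segment_uniformly_continuous _ _ (fun u v => N (u - v))).
  exact: seminorm_distC.
exact: seminorm_dist_trans.
Qed.

(** [Num.min x s' - Num.min x s] is the length of the part of [s, s'] to the left of x, which can
    only grow with x. *)
Lemma min_increment_le (x y s s' : R) : x <= y -> s <= s' ->
  Num.min x s' - Num.min x s <= Num.min y s' - Num.min y s.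
Proof.
move=> xy ss; case: (leP x s') => h1; case: (leP x s) => h2;
  case: (leP y s') => h3; case: (leP y s) => h4; lra.
Qed.

(* The left Riemann sum of [F] on [0, x] for the step 1 / (n + 1), the last
   subinterval being truncated at [x]. *)
Let riemann (F : R -> V) (n : nat) (x : R) : V :=
  \sum_(k < n.+1 ^ 2)
    (Num.min x (k.+1%:R / n.+1%:R) - Num.min x (k%:R / n.+1%:R))%:c
      *: F (k%:R / n.+1%:R).

(** The increment over [x, y] is a combination of values [F (t k)] whose weights are the lengths of
    the pieces of cells inside [x, y]. These are nonnegative, sum to y - x, and vanish unless the
    cell meets [x, y], so that [t k] is within [d] of [xi]. The condition [B <= n.+1] ensures that
    the (n + 1)^2 cells cover [0, B]. *)
Lemma riemann_near_primitive (F : R -> V) (B e d : R) (n : nat) :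
  0 < d -> B <= n.+1%:R -> n.+1%:R^-1 < d / 2 ->
  (forall x y : R, 0 <= x -> x <= B -> 0 <= y -> y <= B -> `|y - x| < d ->
     N (F y - F x) <= e) ->
  forall x xi y : R, 0 <= x -> x <= xi -> xi <= y -> y <= B -> y - x < d / 2 ->
    N (riemann F n y - riemann F n x - (y - x)%:c *: F xi) <= e * (y - x).
Proof.
move=> d0 Bn nd hF x xi y x0 xxi xiy yB yxd.
pose t (k : nat) : R := k%:R / n.+1%:R.
have n0 : 0 < n.+1%:R :> R by rewrite ltr0n.
have [r [rd r0 tS]] : exists r, [/\ r < d / 2, 0 < r & forall k, t k.+1 = t k + r].
  exists n.+1%:R^-1; rewrite invr_gt0; split=> // k.
  by rewrite /t -natr1 mulrDl mul1r.
have t0 k : 0 <= t k by rewrite divr_ge0.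
pose w k := (Num.min y (t k.+1) - Num.min y (t k))
  - (Num.min x (t k.+1) - Num.min x (t k)).
have sw : \sum_(k < n.+1 ^ 2) w k = y - x.
  have tel z : 0 <= z -> z <= B ->
      \sum_(k < n.+1 ^ 2) (Num.min z (t k.+1) - Num.min z (t k)) = z.
    move=> z0 zB; rewrite -(big_mkord xpredT
      (fun k => Num.min z (t k.+1) - Num.min z (t k))).
    rewrite (telescope_sumr (fun k => Num.min z (t k))) //.
    rewrite /t mul0r (min_r z0) subr0 min_l //.
    rewrite natrX expr2 mulfK ?gt_eqF //; exact: le_trans Bn.
  by rewrite /w sumrB !tel //; lra.
have -> : riemann F n y - riemann F n x - (y - x)%:c *: F xi =
  \sum_(k < n.+1 ^ 2) (w k)%:c *: (F (t k) - F xi).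
  rewrite /riemann -sumrB -sw.
  rewrite (_ : (\sum_(k < n.+1 ^ 2) w k)%:c = \sum_(k < n.+1 ^ 2) (w k)%:c);
    last exact: rmorph_sum.
  rewrite scaler_suml -sumrB; apply: eq_bigr => k _.
  by rewrite /w /t; module.
apply: le_trans (seminorm_sum hN _ _ _) _.
rewrite -sw mulr_sumr; apply: ler_sum => k _.
rewrite (seminormZr hN).
have e0 : 0 <= e.
  apply: le_trans (hF x x x0 _ x0 _ _); rewrite ?(seminorm_ge0 hN) //; try lra.
  by rewrite subrr normr0.
have [yk|ky] := leP y (t k).
  have -> : w k = 0.
    by rewrite /w tS !min_l ?subrr //; lra.
  by rewrite normr0 mul0r mulr0.
have [kx|xk] := leP (t k.+1) x.
  have -> : w k = 0.
    rewrite /w !min_r ?subrr //; rewrite ?tS in kx *; lra.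
  by rewrite normr0 mul0r mulr0.
rewrite tS in xk.
have w0 : 0 <= w k.
  by rewrite subr_ge0 min_increment_le ?(le_trans xxi) // tS lerDl ltW.
rewrite ger0_norm // mulrC ler_wpM2r // hF //; try lra.
by rewrite ltr_norml; lra.
Qed.

(** Riemann sums converge pointwise by completeness, and the uniform near-primitive estimate passes
    to the limit. The construction is independent of [B], so one primitive serves all segments
    [0, B]. *)
Lemma primitive_exists (F : R -> V) :
  (forall B e : R, 0 < e -> exists2 d, 0 < d & forall x y : R,
    0 <= x -> x <= B -> 0 <= y -> y <= B -> `|y - x| < d ->
    N (F y - F x) <= e) ->
  exists P : R -> V, forall B, primitive F P 0 B.
Proof.
move=> hF.
have large (B r : R) : 0 < r -> exists n0 : nat, forall n, (n0 <= n)%N ->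
    B <= n.+1%:R /\ n.+1%:R^-1 < r.
  move=> r0; exists (Num.truncn (Num.max B r^-1)) => n hn.
  have h : Num.max B r^-1 < n.+1%:R.
    by apply: lt_le_trans (truncnS_gt _) _; rewrite ler_nat.
  move: h; rewrite gt_max => /andP[/ltW -> h]; split=> //.
  by rewrite -[ltRHS]invrK ltf_pV2 ?posrE ?invr_gt0 ?ltr0n.
have r0 n : riemann F n 0 = 0.
  apply: big1 => k _; rewrite !min_l ?divr_ge0 // subrr.
  by rewrite (_ : 0%:c = 0) // scale0r.
have [P hP] : exists P : R -> V, forall x, 0 <= x -> forall e, 0 < e ->
    exists n0, forall n, (n0 <= n)%N -> N (riemann F n x - P x) <= e.
  suff h x : exists l, 0 <= x -> forall e, 0 < e ->
    exists n0, forall n, (n0 <= n)%N -> N (riemann F n x - l) <= e.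
    by exists (fun x => projT1 (cid (h x))) => x; case: (cid (h x)).
  have [x0|x0] := leP 0 x; last by exists 0.
  have [|l hl] := hC (u := riemann F ^~ x); last by exists l.
  move=> e e0.
  have k0 : 0 < 2 * (x + 1) by lra.
  have [d d0 hd] := hF x _ (divr_gt0 e0 k0).
  have [n0 hn0] := large x (d / 2) (divr_gt0 d0 (ltr0Sn _ 1)).
  exists n0 => n m /hn0[xn nd] /hn0[xm md].
  (* Both sums nearly satisfy the same local estimate, so their difference has small increments on
     short intervals, hence on [0, x]. *)
  have := @lipschitz_of_local _ _ _ hN
    (fun x => riemann F n x - riemann F m x) (2 * (e / (2 * (x + 1)))) (d / 2) 0 x
    (divr_gt0 d0 (ltr0Sn _ 1)) x0.
  rewrite !r0 !subr0 => h.
  apply: le_trans (h _) _; last first.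
    have -> : 2 * (e / (2 * (x + 1))) * x = e * (x / (x + 1)).
      by field; rewrite gt_eqF; lra.
    rewrite ler_piMr // ?ltW // ltr_pdivrMr //; lra.
  move=> y z y0 yz zx zyd.
  rewrite (_ : _ - _ = (riemann F n z - riemann F n y - (z - y)%:c *: F y)
    - (riemann F m z - riemann F m y - (z - y)%:c *: F y)); last by module.
  apply: le_trans (seminormB hN _ _) _.
  have := riemann_near_primitive d0 xn nd hd y0 (lexx y) yz zx zyd.
  have := riemann_near_primitive d0 xm md hd y0 (lexx y) yz zx zyd.
  lra.
exists P => B e e0; have [d d0 hd] := hF B e e0.
exists (d / 2); first by rewrite divr_gt0.
move=> x xi y x0 xxi xiy yB yxd.
apply/ler_addgt0Pr => r r1.
have r2 : 0 < r / 2 by rewrite divr_gt0.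
have [n0 hn0] := large B (d / 2) (divr_gt0 d0 (ltr0Sn _ 1)).
have [n1 hn1] := hP x x0 _ r2.
have y0 : 0 <= y by lra.
have [n2 hn2] := hP y y0 _ r2.
pose n := (n0 + n1 + n2)%N.
have [Bn nd] := hn0 n (leq_trans (leq_addr _ _) (leq_addr _ _)).
have h1 := hn1 n (leq_trans (leq_addl _ _) (leq_addr _ _)).
have h2 := hn2 n (leq_addl _ _).
have h3 := riemann_near_primitive d0 Bn nd hd x0 xxi xiy yB yxd.
rewrite (_ : _ - _ = (riemann F n y - riemann F n x - (y - x)%:c *: F xi)
  - ((riemann F n y - P y) - (riemann F n x - P x))); last by module.
apply: le_trans (seminormB hN _ _) _.
apply: le_trans (lerD (lexx _) (seminormB hN _ _)) _.
lra.
Qed.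
End Existence.

(** * One-parameter groups *)

Section Group.
Context (R : realType) (V : lmodType R[i]) (N : V -> R).
Context (hN : seminorm N) (hC : seminorm_complete N).

(** All laws hold up to null vectors, as the operators act on representatives. Boundedness is
    required for each [t] separately; uniformity in [t] is proved below for groups conserving an
    equivalent seminorm. *)
Record seminormed_group (W : R -> V -> V) : Prop := SeminormedGroup {
  group_lin : forall t a u v, N (W t (a *: u + v) - (a *: W t u + W t v)) = 0;
  group_bounded : forall t, exists C, forall u, N (W t u) <= C * N u;
  group_0 : forall u, N (W 0 u - u) = 0;
  group_D : forall s t u, N (W (s + t) u - W s (W t u)) = 0;
  group_continuous : forall u e, 0 < e -> exists2 d, 0 < d &
    forall h, `|h| < d -> N (W h u - u) <= e }.

(** The graph of the generator. Writing the error as e |h| avoids dividing by h and includes h =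
    0. *)
Definition generates (W : R -> V -> V) (u v : V) : Prop :=
  forall e : R, 0 < e -> exists2 d, 0 < d & forall h : R, `|h| < d ->
    N (W h u - u - h%:c *: v) <= e * `|h|.

Local Notation "u ~~ v" := (N (u - v) = 0) (at level 70).

Lemma null_sym u v : u ~~ v -> v ~~ u.
Proof. by rewrite seminorm_distC. Qed.

Lemma null_le u : N u <= 0 -> N u = 0.
Proof. by move=> h; apply/eqP; rewrite eq_le h seminorm_ge0. Qed.

Lemma null_trans v u w : u ~~ v -> v ~~ w -> u ~~ w.
Proof.
move=> h h'; apply: null_le; apply: le_trans (seminorm_dist_trans hN v _ _) _.
by rewrite h h' addr0.
Qed.

Lemma nullD u v u' v' : u ~~ v -> u' ~~ v' -> (u + u') ~~ (v + v').
Proof.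
move=> h h'; apply: null_le; rewrite opprD addrACA.
by apply: le_trans (seminormD hN _ _) _; rewrite h h' addr0.
Qed.

Lemma nullZ a u v : u ~~ v -> (a *: u) ~~ (a *: v).
Proof. by move=> h; rewrite -scalerBr (seminormZ hN) h mulr0. Qed.

Lemma nullN u v : u ~~ v -> (- u) ~~ (- v).
Proof. by move=> h; rewrite -opprD seminormN. Qed.

Lemma nullB u v u' v' : u ~~ v -> u' ~~ v' -> (u - u') ~~ (v - v').
Proof. by move=> h h'; apply: nullD => //; exact: nullN. Qed.

Lemma null_refl u : u ~~ u. Proof. by rewrite subrr seminorm0. Qed.

Context (W : R -> V -> V) (hW : seminormed_group W).

Lemma group_null0 t : N (W t 0) = 0.
Proof.
have [C hC'] := group_bounded hW t; apply: null_le.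
by apply: le_trans (hC' _) _; rewrite (seminorm0 hN) mulr0.
Qed.

Lemma group_scale t a u : W t (a *: u) ~~ a *: W t u.
Proof.
have := group_lin hW t a u 0; rewrite addr0 => /null_trans; apply.
by rewrite addrAC subrr add0r group_null0.
Qed.

Lemma group_add t u v : W t (u + v) ~~ W t u + W t v.
Proof. by have := group_lin hW t 1 u v; rewrite !scale1r. Qed.

Lemma group_sub t u v : W t (u - v) ~~ W t u - W t v.
Proof.
apply: (null_trans (group_add t u (- v))).
apply: nullD; first exact: null_refl.
by rewrite -[- v]scaleN1r -[- W t v]scaleN1r; exact: group_scale.
Qed.

Lemma group_lipschitz t : exists2 C, 0 <= C &
  forall u v, N (W t u - W t v) <= C * N (u - v).
Proof.
have [C hC'] := group_bounded hW t; exists `|C| => // u v.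
rewrite -(seminorm_eq hN (group_sub t u v)).
by apply: le_trans (hC' _) _; rewrite ler_wpM2r ?(seminorm_ge0 hN) ?ler_norm.
Qed.

Lemma group_commute s t u : W s (W t u) ~~ W t (W s u).
Proof.
apply: (null_trans (null_sym (group_D hW s t u))); rewrite (addrC s t).
exact: group_D.
Qed.

(** [W t] is bounded and commutes with [W h], so it can be applied to the difference quotient of
    [u]. *)
Lemma generates_orbit u v t : generates W u v -> generates W (W t u) (W t v).
Proof.
move=> huv e e0; have [C C0 hC'] := group_lipschitz t.
have k0 : 0 < C + 1 by lra.
have [d d0 hd] := huv _ (divr_gt0 e0 k0); exists d => // h hh.
have -> : N (W h (W t u) - W t u - h%:c *: W t v) =
    N (W t (W h u - u - h%:c *: v)).
  apply/esym/(seminorm_eq hN)/(null_trans (group_sub _ _ _)).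
  apply: nullB; last exact: group_scale.
  apply: (null_trans (group_sub _ _ _)).
  by apply: nullB; [exact: group_commute|exact: null_refl].
have := hC' (W h u - u - h%:c *: v) 0.
rewrite -(seminorm_eq hN (group_sub _ _ _)) !subr0 => /le_trans; apply.
have -> : e * `|h| = (C + 1) * (e / (C + 1) * `|h|).
  by field; rewrite gt_eqF.
by rewrite ler_pM ?(seminorm_ge0 hN) ?hd //; lra.
Qed.

Lemma group_orbit_continuous u (s : R) (e : R) : 0 < e -> exists2 d, 0 < d &
  forall t, `|t - s| < d -> N (W t u - W s u) <= e.
Proof.
move=> e0; have [C C0 hC'] := group_lipschitz s.
have k0 : 0 < C + 1 by lra.
have [d d0 hd] := group_continuous hW u (divr_gt0 e0 k0).
exists d => // t ts.
have h1 : W t u ~~ W s (W (t - s) u).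
  by have := group_D hW s (t - s) u; rewrite (addrC s) subrK.
rewrite (seminorm_eq hN (nullB h1 (null_refl (W s u)))).
apply: le_trans (hC' _ _) _.
have -> : e = (C + 1) * (e / (C + 1)) by field; rewrite gt_eqF.
by rewrite ler_pM ?(seminorm_ge0 hN) ?hd //; lra.
Qed.

(* The averages of the orbit of [u] over [0, h] lie in the domain of the
   generator; the parameter is shifted by 1 so that all intervals of
   integration are contained in [0, 3]. *)
Lemma generates_dense u e : 0 < e -> exists w v, generates W w v /\ N (w - u) <= e.
Proof.
move=> e0.
pose F s := W (s - 1) u.
have [P hP] : exists P : R -> V, forall B, primitive N F P 0 B.
  apply: (primitive_exists hN hC) => B.
  apply: (continuous_on_segment_uniform hN) => x _ _ r r0.
  have [d d0 hd] := group_orbit_continuous u (x - 1) r0.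
  exists d => // y _ _ yx; apply: hd.
  by rewrite (_ : y - 1 - (x - 1) = y - x) //; ring.
have [d d0 hd] := hP 3 _ e0.
pose h := Num.min (d / 2) 1.
have h0 : 0 < h by rewrite /h lt_min divr_gt0 ?ltr01.
have hdl : h < d by rewrite /h gt_min; apply/orP; left; lra.
have h1 : h <= 1 by rewrite /h ge_min lexx orbT.
clearbody h.
(* [D r] is the integral of the orbit over [r, h + r]. The approximant is its average [D 0] / h,
   with derivative (W_h u - u) / h, since the boundary values of the translated integral are those
   of [F]. *)
pose D r := P (1 + h + r) - P (1 + r).
exists (h^-1%:c *: D 0), (h^-1%:c *: (F (1 + h) - F 1)); split; last first.
  have -> : h^-1%:c *: D 0 - u = h^-1%:c *: (P (1 + h) - P 1 - h%:c *: u).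
    rewrite [RHS]scalerBr scalerA -rmorphM mulVf ?gt_eqF // scale1r.
    by rewrite /D !addr0.
  rewrite (seminormZr hN) ger0_norm ?invr_ge0 ?(ltW h0) // ler_pdivrMl // (mulrC h).
  have hh : (1 + h) - 1 = h by ring.
  have := hd 1 1 (1 + h); rewrite hh => hd'.
  apply: le_trans (hd' _ _ _ _ _) => //; try lra.
  rewrite (seminorm_eq hN (v := P (1 + h) - P 1 - h%:c *: u)) //.
  apply: nullB; first exact: null_refl.
  by apply: nullZ; rewrite /F subrr; exact: (group_0 hW).
(* Applying [W r] to a primitive of [F] and translating it by [r] give primitives of maps that
   differ by null vectors, so the mean value inequality with constant 0 identifies their
   increments. *)
have key r : `|r| < 1 -> W r (D 0) ~~ D r.
  rewrite ltr_norml => /andP[r1 r2].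
  have [C C0 hC'] := group_lipschitz r.
  have pW : primitive N (fun s => W r (F s)) (fun s => W r (P s)) 1 (1 + h).
    move=> z z0; have k0 : 0 < C + 1 by lra.
    have [d' d'0 hd'] := hP 2 _ (divr_gt0 z0 k0); exists d' => // x xi y *.
    have h2 : W r (P y - P x - (y - x)%:c *: F xi) ~~
        W r (P y) - W r (P x) - (y - x)%:c *: W r (F xi).
      apply: (null_trans (group_sub _ _ _)).
      by apply: nullB; [exact: group_sub|exact: group_scale].
    rewrite -(seminorm_eq hN h2).
    have := hC' (P y - P x - (y - x)%:c *: F xi) 0.
    rewrite -(seminorm_eq hN (group_sub _ _ _)) !subr0 => /le_trans; apply.
    have -> : z * (y - x) = (C + 1) * (z / (C + 1) * (y - x)).
      by field; rewrite gt_eqF.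
    by rewrite ler_pM ?(seminorm_ge0 hN) ?hd' //; lra.
  have pS : primitive N (fun s => F (s + r)) (fun s => P (s + r)) 1 (1 + h).
    apply: primitive_shift; apply: primitive_sub (hP 3); lra.
  have h2 := primitiveD hN (- 1) pW pS.
  have h3 : 1 <= 1 + h by lra.
  have h4 := primitive_mean_value hN (c := 0) h3 h2.
  apply: (null_trans (group_sub _ _ _)); apply: null_le.
  rewrite mul0r in h4.
  have -> : W r (P (1 + h + 0)) - W r (P (1 + 0)) - D r =
    - ((-1 *: W r (P (1 + h)) + P (1 + h + r)) - (-1 *: W r (P 1) + P (1 + r))).
    by rewrite /D !addr0; module.
  rewrite (seminormN hN); apply: h4 => s _ _.
  have -> : -1 *: W r (F s) + F (s + r) = W (s + r - 1) u - W r (W (s - 1) u).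
    by rewrite /F scaleN1r addrC.
  have := group_D hW r (s - 1) u.
  have -> : r + (s - 1) = s + r - 1 by ring.
  by move=> ->.
move=> z z0.
have z1 : 0 < z * h / 2 by rewrite divr_gt0 // mulr_gt0.
have [d1 d10 hd1] := hP 3 _ z1.
exists (Num.min d1 1); first by rewrite lt_min d10 ltr01.
move=> r; rewrite lt_min => /andP[rd r1].
have incr a : 1 <= a -> a <= 2 ->
    N (P (a + r) - P a - r%:c *: F a) <= z * h / 2 * `|r|.
  move=> a1 a2; move: (r1); rewrite ltr_norml => /andP[r2 r3].
  have [r0|r0] := leP 0 r.
    have := hd1 a a (a + r).
    rewrite (_ : a + r - a = r); last by ring.
    rewrite ger0_norm //; rewrite ger0_norm // in rd.
    by apply=> //; lra.
  have := hd1 (a + r) a a.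
  rewrite (_ : a - (a + r) = - r); last by ring.
  rewrite ltr0_norm //; rewrite ltr0_norm // in rd.
  move=> hh; rewrite seminorm_distC //.
  rewrite (_ : _ - _ = P a - P (a + r) - (- r)%:c *: F a); last by module.
  by apply: hh => //; lra.
have -> : N (W r (h^-1%:c *: D 0) - h^-1%:c *: D 0
     - r%:c *: (h^-1%:c *: (F (1 + h) - F 1))) =
   N (h^-1%:c *: ((P (1 + h + r) - P (1 + h) - r%:c *: F (1 + h)) -
                   (P (1 + r) - P 1 - r%:c *: F 1))).
  apply: (seminorm_eq hN).
  rewrite (_ : _ - _ = W r (h^-1%:c *: D 0) - h^-1%:c *: D r); last first.
    by rewrite /D !addr0; module.
  apply: (null_trans (group_scale _ _ _)).
  by rewrite -scalerBr (seminormZ hN) key // mulr0.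
rewrite (seminormZr hN) ger0_norm ?invr_ge0 ?(ltW h0) // ler_pdivrMl // (mulrC h).
apply: le_trans (seminormB hN _ _) _.
have h2 : 1 + h <= 2 by lra.
have h3 : 1 <= 1 + h by lra.
have h4 : 1 <= 2 :> R by lra.
have := incr _ h3 h2; have := incr _ (lexx 1) h4; lra.
Qed.

(* A second seminorm [n], equivalent to [N], whose square is conserved by the
   flow because the generator is skew-adjoint for it. *)
Lemma group_uniformly_bounded (n : V -> R) (C1 C2 : R) :
  seminorm n -> 0 <= C1 -> 0 <= C2 ->
  (forall u, n u <= C1 * N u) -> (forall u, N u <= C2 * n u) ->
  (forall w v (h : R), generates W w v ->
     n (w + h%:c *: v) ^+ 2 = n w ^+ 2 + h ^+ 2 * n v ^+ 2) ->
  forall t u, N (W t u) <= C2 * C1 * N u.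
Proof.
move=> hn C10 C20 nN Nn skew.
(* The squared seminorm along the orbit has derivative 0: [W (h + s) w] differs by o(h) from
   [W s w + h%:c *: W s v], whose squared seminorm has no term linear in h by [skew]. *)
have conserved w v t : generates W w v -> n (W t w) ^+ 2 = n w ^+ 2.
  move=> wv; pose f (s : R) : R := n (W s w) ^+ 2.
  have df (s : R) : is_derive s (1 : R) (f : R -> R) (0 : R).
    have lim : (fun h : R => h^-1 *: (f (h + s) - f s)) @ 0^' --> (0 : R).
      apply/cvgrPdist_le => e e0 /=.
      have gs := generates_orbit s wv.
      set a := n (W s w); set b := n (W s v).
      have a0 : 0 <= a by exact: (seminorm_ge0 hn).
      have b0 : 0 <= b by exact: (seminorm_ge0 hn).
      (* An upper bound for [n x + n y], the second factor in the difference of the squares of [n x]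
         and [n y]. *)
      pose K := 2 * (a + b + 1) + 1.
      have K0 : 0 < K by rewrite /K; lra.
      pose c := Num.min 1 (e / (2 * K)).
      have c0 : 0 < c by rewrite /c lt_min ltr01 divr_gt0 // mulr_gt0.
      have c1 : c <= 1 by rewrite /c ge_min lexx.
      have ce : c <= e / (2 * K) by rewrite /c ge_min lexx orbT.
      clearbody c.
      have k0 : 0 < C1 + 1 by lra.
      have [d d0 hd] := gs _ (divr_gt0 c0 k0).
      near=> h.
      have h0 : h != 0 by near: h; exact: nbhs_dnbhs_neq.
      have hd1 : `|h| < d.
        near: h; apply: dnbhs0_lt; exact: d0.
      have hd2 : `|h| < 1 by near: h; exact: dnbhs0_lt.
      have hd3 : `|h| < e / (2 * (b ^+ 2 + 1)).
        near: h; apply: dnbhs0_lt; rewrite divr_gt0 // mulr_gt0 //.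
        by rewrite ltr_wpDl // sqr_ge0.
      have hn0 : 0 < `|h| by rewrite normr_gt0.
      rewrite sub0r normrN normrM normfV mulrC ler_pdivrMr //.
      pose y := W s w + h%:c *: W s v.
      have ny : n y ^+ 2 = a ^+ 2 + h ^+ 2 * b ^+ 2 by exact: skew.
      pose x := W (h + s) w.
      have xy : n (x - y) <= c * `|h|.
        have e1 : N (x - y) = N (W h (W s w) - W s w - h%:c *: W s v).
          apply: (seminorm_eq hN).
          rewrite (_ : _ - _ = x - W h (W s w)); last by rewrite /y; module.
          exact: (group_D hW).
        apply: le_trans (nN _) _; rewrite e1.
        apply: le_trans (ler_wpM2l C10 (hd h hd1)) _.
        rewrite mulrA ler_wpM2r // mulrCA ler_piMr ?(ltW c0) //.
        by rewrite ler_pdivrMr // mul1r; lra.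
      have y1 : n y <= a + b.
        apply: le_trans (seminormD hn _ _) _; rewrite (seminormZr hn) lerD2l.
        by rewrite ler_piMl // ltW.
      have x1 : n x <= a + b + 1.
        apply: le_trans (seminorm_le_dist hn x y) _; apply: lerD => //.
        apply: le_trans xy _; rewrite -[leRHS]mulr1 ler_pM // ltW //.
      have dxy : `|n x - n y| <= c * `|h|.
        have i1 := seminorm_le_dist hn x y.
        have i2 := seminorm_le_dist hn y x.
        rewrite (seminorm_distC hn y x) in i2.
        by rewrite ler_norml; lra.
      have -> : f (h + s) - f s = (n x - n y) * (n x + n y) + h ^+ 2 * b ^+ 2.
        rewrite /f -/x -/a.
        have -> : (n x - n y) * (n x + n y) = n x ^+ 2 - n y ^+ 2 by ring.
        rewrite ny; ring.
      apply: le_trans (ler_normD _ _) _; rewrite normrM.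
      have x0 := seminorm_ge0 hn x; have y0 := seminorm_ge0 hn y.
      have t1 : `|n x - n y| * `|n x + n y| <= e / 2 * `|h|.
        rewrite (ger0_norm (addr_ge0 x0 y0)).
        have -> : e / 2 * `|h| = e / (2 * K) * `|h| * K by field; rewrite gt_eqF.
        rewrite ler_pM ?addr_ge0 //; last by rewrite /K; lra.
        by apply: le_trans dxy _; rewrite ler_wpM2r.
      have t2 : `|h ^+ 2 * b ^+ 2| <= e / 2 * `|h|.
        have -> : `|h ^+ 2 * b ^+ 2| = `|h| * b ^+ 2 * `|h|.
          by rewrite normrM !normrX (ger0_norm b0); ring.
        rewrite ler_wpM2r //.
        have b1 : 0 < b ^+ 2 + 1 by rewrite ltr_wpDl // sqr_ge0.
        apply: (@le_trans _ _ (e / (2 * (b ^+ 2 + 1)) * (b ^+ 2 + 1))).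
          by rewrite ler_pM ?sqr_ge0 ?(ltW hd3) // lerDl ler01.
        by rewrite (_ : _ * _ = e / 2) //; field; rewrite gt_eqF.
      lra.
    apply: DeriveDef.
      by apply/cvg_ex; exists 0; apply: cvg_trans lim; apply: near_eq_cvg;
        apply: nearW => h /=; rewrite scaler1.
    apply: cvg_lim => //; apply: cvg_trans lim; apply: near_eq_cvg.
    by apply: nearW => h /=; rewrite scaler1.
  have fc := is_derive_0_is_cst t 0 df.
  rewrite -/(f t) fc /f.
  rewrite (_ : n (W 0 w) = n w) //; apply: (seminorm_eq hn).
  apply/eqP; rewrite eq_le (seminorm_ge0 hn) andbT.
  by apply: le_trans (nN _) _; rewrite (group_0 hW) mulr0.
have domain w v t : generates W w v -> N (W t w) <= C2 * C1 * N w.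
  move=> wv; apply: le_trans (Nn _) _; rewrite -mulrA ler_wpM2l //.
  apply: le_trans (nN _).
  by rewrite -(ler_pXn2r (n := 2)) ?nnegrE ?(seminorm_ge0 hn) // (conserved w v).
(* Density: the Lipschitz constant [C] depends on [t], but it only multiplies the distance from [u]
   to an element of the domain, which is arbitrarily small. *)
move=> t u; have [C C0 hC'] := group_lipschitz t.
apply/ler_addgt0Pr => e e0.
have k0 : 0 < C + C2 * C1 + 1.
  by have := mulr_ge0 C20 C10; lra.
have [w [v [wv wu]]] := generates_dense u (divr_gt0 e0 k0).
have h1 := hC' u w; rewrite (seminorm_distC hN u w) in h1.
have h2 := seminorm_le_dist hN (W t u) (W t w).
have h3 := domain w v t wv.
have h4 := ler_wpM2l (mulr_ge0 C20 C10) (seminorm_le_dist hN w u).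
have h5 : (C + C2 * C1) * N (w - u) <= e.
  apply: (@le_trans _ _ ((C + C2 * C1 + 1) * (e / (C + C2 * C1 + 1)))).
    rewrite ler_pM ?(seminorm_ge0 hN) //; last by lra.
    by rewrite addr_ge0 // mulr_ge0.
  by rewrite mulrC divfK // gt_eqF.
lra.
Unshelve. all: by end_near.
Qed.
End Group.

(** * Decay of weighted orbit integrals from resolvent bounds *)

Section Decay.
Context (R : realType) (V : lmodType R[i]) (N : V -> R).
Context (hN : seminorm N) (hC : seminorm_complete N).
Context (W : R -> V -> V) (hW : seminormed_group N W).
Context (M : R) (M_ge0 : 0 <= M) (hM : forall t u, N (W t u) <= M * N u).

(** Both endpoints are expanded at the tag: [W (- y) u] and [W (- x) u] are [W (- xi)] applied to
    [W (xi - y) u] and [W (xi - x) u]. The bound [M], uniform in time, makes the error uniform in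
    [xi]. *)
Lemma orbit_primitive (u v : V) (a b : R) : generates N W u v ->
  primitive N (fun x => - W (- x) v) (fun x => W (- x) u) a b.
Proof.
move=> uv e e0.
have M0 := M_ge0.
have k0 : 0 < M + 1 by lra.
have [d d0 hd] := uv _ (divr_gt0 e0 k0); exists d => // x xi y _ xxi xiy _ yx.
pose z h := W h u - u - h%:c *: v.
have Wz s h : N (W s (z h) - (W (s + h) u - W s u - h%:c *: W s v)) = 0.
  apply: (null_trans hN (group_sub hN hW _ _ _)).
  apply: (nullB hN); last exact: (group_scale hN hW).
  apply: (null_trans hN (group_sub hN hW _ _ _)).
  apply: (nullB hN); last exact: (null_refl hN).
  by apply: (null_sym hN); exact: (group_D hW).
pose h1 := xi - y; pose h2 := xi - x.
have e1 : - xi + h1 = - y by rewrite /h1; ring.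
have e2 : - xi + h2 = - x by rewrite /h2; ring.
have := nullB hN (Wz (- xi) h1) (Wz (- xi) h2); rewrite e1 e2 => hh.
rewrite (_ : N _ = N (W (- xi) (z h1) - W (- xi) (z h2))); last first.
  rewrite (seminorm_eq hN hh); congr N.
  by rewrite /h1 /h2; module.
apply: le_trans (seminormB hN _ _) _.
apply: le_trans (lerD (hM _ _) (hM _ _)) _.
have b1 : N (z h1) <= e / (M + 1) * (y - xi).
  have -> : y - xi = `|h1| by rewrite /h1 distrC ger0_norm // subr_ge0.
  by apply: hd; rewrite /h1 distrC ger0_norm; lra.
have b2 : N (z h2) <= e / (M + 1) * (xi - x).
  have -> : xi - x = `|h2| by rewrite /h2 ger0_norm // subr_ge0.
  by apply: hd; rewrite /h2 ger0_norm; lra.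
rewrite -mulrDr.
have b3 : N (z h1) + N (z h2) <= e / (M + 1) * (y - x) by lra.
rewrite (_ : e * (y - x) = (M + 1) * (e / (M + 1) * (y - x))); last first.
  by field; rewrite gt_eqF.
by rewrite ler_pM ?addr_ge0 ?(seminorm_ge0 hN) //; lra.
Qed.

Context (Q : V) (w w' : R -> R[i]) (al c L : R) (c_ge0 : 0 <= c) (L_ge0 : 0 <= L).
Hypothesis w_le : forall x, 0 <= x -> Normc.normc (w x) <= (1 + x)^-1.
Hypothesis w'_le : forall x, 0 <= x ->
  Normc.normc (w' x - Complex 0 al * w x) <= c / (1 + x) ^+ 2.
Hypothesis w_diff : forall x xi y, 0 <= x -> x <= xi -> xi <= y ->
  Normc.normc (w y - w x - (y - x)%:c * w' xi) <= L * (y - x) ^+ 2.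
Context (d0 C0 : R) (d0_gt0 : 0 < d0).
(** With A the generator, [P] solves (d + i al - A) P = Q; the growth d^(-1/2) is the price of
    approaching the imaginary axis. *)
Hypothesis resolvent : forall d, 0 < d -> d <= d0 -> exists2 P,
  generates N W P (Complex d al *: P - Q) & N P <= C0 / Num.sqrt d.

Let w_le1 x : 0 <= x -> Normc.normc (w x) <= 1.
Proof. by move=> x0; apply: le_trans (w_le x0) _; rewrite invf_le1; lra. Qed.

Let w'_le1 x : 0 <= x -> Normc.normc (w' x) <= c + `|al|.
Proof.
have [M0 c0 L0 d00] := And4 M_ge0 c_ge0 L_ge0 d0_gt0.
move=> x0.
rewrite -(subrK (Complex 0 al * w x) (w' x)).
apply: le_trans (le_normcD _ _) _; apply: lerD.
  apply: le_trans (w'_le x0) _; rewrite ler_piMr // invf_le1 ?exprn_gt0; try lra.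
  by rewrite exprn_ege1 //; lra.
rewrite Normc.normcM /= expr0n add0r sqrtr_sqr.
by rewrite ler_piMr // w_le1.
Qed.

(** The integrand is continuous, being the product of a locally Lipschitz weight and a strongly
    continuous orbit. *)
Lemma weighted_orbit_primitive : exists P : R -> V,
  forall B, primitive N (fun x => w x *: W (- x) Q) P 0 B.
Proof.
have [M0 c0 L0 d00] := And4 M_ge0 c_ge0 L_ge0 d0_gt0.
apply: (primitive_exists hN hC) => B.
apply: (continuous_on_segment_uniform hN) => x x0 _ e e0.
have e2 : 0 < e / 2 by rewrite divr_gt0.
have [d dgt0 hd] := group_orbit_continuous hN hW Q (- x) e2.
pose K := L + c + `|al| + 1.
have K0 : 0 < K by have := normr_ge0 al; rewrite /K; lra.
pose A := K * (M * N Q + 1).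
have MQ : 0 <= M * N Q by rewrite mulr_ge0 ?(seminorm_ge0 hN).
have A0 : 0 < A by rewrite mulr_gt0 //; lra.
exists (Num.min (Num.min d 1) (e / (2 * A))).
  by rewrite !lt_min dgt0 ltr01 divr_gt0 // mulr_gt0.
move=> y y0 _; rewrite !lt_min => /andP[/andP[yd y1] ye].
have wd : Normc.normc (w y - w x) <= K * `|y - x|.
  have wlog_ a b : 0 <= a -> a <= b -> b - a < 1 ->
      Normc.normc (w b - w a) <= K * (b - a).
    move=> a0 ab ab1.
    rewrite -(subrK ((b - a)%:c * w' a) (w b - w a)).
    apply: le_trans (le_normcD _ _) _.
    rewrite Normc.normcM normc_real ger0_norm ?subr_ge0 //.
    have h1 := w_diff a0 (lexx a) ab.
    have h2 : L * (b - a) ^+ 2 <= L * (b - a).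
      by rewrite ler_wpM2l // expr2 ler_piMr ?subr_ge0 // ltW.
    have ba : 0 <= b - a by rewrite subr_ge0.
    have h3 := ler_wpM2l ba (w'_le1 a0).
    by rewrite /K; lra.
  have [xy|yx] := leP x y.
    rewrite ger0_norm ?subr_ge0 //; apply: wlog_ => //.
    by rewrite ger0_norm ?subr_ge0 // in y1.
  rewrite ltr0_norm ?subr_lt0 // opprB -normcN opprB; apply: wlog_ => //.
    exact: ltW.
  by rewrite ltr0_norm ?subr_lt0 // opprB in y1.
have -> : w y *: W (- y) Q - w x *: W (- x) Q =
  w y *: (W (- y) Q - W (- x) Q) + (w y - w x) *: W (- x) Q by module.
apply: le_trans (seminormD hN _ _) _; rewrite !(seminormZ hN).
have h1 : Normc.normc (w y) * N (W (- y) Q - W (- x) Q) <= 1 * (e / 2).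
  rewrite ler_pM ?normc_ge0 ?(seminorm_ge0 hN) ?w_le1 // hd //.
  by rewrite opprK addrC distrC.
have h2 : Normc.normc (w y - w x) * N (W (- x) Q) <=
    (K * (e / (2 * A))) * (M * N Q + 1).
  rewrite ler_pM ?normc_ge0 ?(seminorm_ge0 hN) //.
    by apply: le_trans wd _; rewrite ler_wpM2l // ltW.
  by apply: le_trans (hM _ _) _; lra.
have : (K * (e / (2 * A))) * (M * N Q + 1) = e / 2.
  by rewrite /A; field; rewrite !gt_eqF //; lra.
lra.
Qed.

Context (P : R -> V).
Hypothesis hP : forall B, primitive N (fun x => w x *: W (- x) Q) P 0 B.

(* Integration by parts against [Q = (K + d) u] with [K] the generator of
   [x |-> e^{i al x} W (- x)] and [d = 1 / t]. *)
Lemma decay_step t T : 1 <= t -> d0^-1 <= t -> t <= T -> T <= 2 * t ->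
  N (P T - P t) <= (c + 3) * M * C0 / Num.sqrt t.
Proof.
have [M0 c0 L0 d00] := And4 M_ge0 c_ge0 L_ge0 d0_gt0.
move=> t1 td tT T2.
have tp : 0 < t by lra.
have d1 : 0 < t^-1 by rewrite invr_gt0.
have d2 : t^-1 <= d0 by rewrite -[leRHS]invrK lef_pV2 ?posrE ?invr_gt0.
have [u hu Nu] := resolvent d1 d2.
set v := _ - Q in hu.
have tn0 : t != 0 by rewrite gt_eqF.
have sq0 : 0 < Num.sqrt t by rewrite sqrtr_gt0.
have st : Num.sqrt t ^+ 2 = t by rewrite sqr_sqrtr // ltW.
rewrite (sqrtrV (ltW tp)) invrK in Nu.
have Nu0 := seminorm_ge0 hN u.
have k1 : 0 <= L + 1 + c + `|al| by rewrite !addr_ge0.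
have k2 : 0 <= M * N u + M * N v by rewrite addr_ge0 // mulr_ge0 // (seminorm_ge0 hN).
have pw : primitive N (fun x => w' x *: W (- x) u + w x *: - W (- x) v)
    (fun x => w x *: W (- x) u) t T.
  apply: (primitive_scale hN k1 k2).
  - move=> x tx _; apply: (@le_trans _ _ 1); first by apply: w_le1; lra.
    by have := normr_ge0 al; lra.
  - move=> x tx _; apply: le_trans (w'_le1 _) _; first by lra.
    by lra.
  - move=> x xi y tx xxi xiy yT; apply: le_trans (w_diff _ xxi xiy) _; first lra.
    by rewrite ler_wpM2r ?sqr_ge0 //; have := normr_ge0 al; lra.
  - move=> x _ _; rewrite (seminormN hN); apply: le_trans (hM _ _) _.
    by rewrite lerDr mulr_ge0 // (seminorm_ge0 hN).
  - move=> x _ _; apply: le_trans (hM _ _) _.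
    by rewrite lerDl mulr_ge0 // (seminorm_ge0 hN).
  - exact: orbit_primitive.
have pP : primitive N (fun x => w x *: W (- x) Q) P t T.
  by apply: primitive_sub (hP T) => //; exact: ltW.
have pD := primitiveD hN (- 1) pw pP.
(* The part c comes from [w'_le]; the part 1 comes from the damping d = 1 / t times |w| <= 1 / t. *)
pose b := (c + 1) / t ^+ 2 * (M * N u).
have hF x : t <= x -> x <= T ->
    N (-1 *: (w' x *: W (- x) u + w x *: - W (- x) v) + w x *: W (- x) Q) <= b.
  move=> tx xT.
  have x0 : 0 <= x by lra.
  set Wu := W (- x) u.
  have Wv : N (W (- x) v - (Complex (t^-1) al *: Wu - W (- x) Q)) = 0.
    apply: (null_trans hN (group_sub hN hW _ _ _)).
    apply: (nullB hN); last exact: (null_refl hN).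
    exact: (group_scale hN hW).
  (* Substituting the resolvent equation cancels [Q] and the oscillation i al w, leaving w' - i al w
     and the damping term as the coefficient of [W (- x) u]. *)
  have e1 : N (-1 *: (w' x *: Wu + w x *: - W (- x) v) + w x *: W (- x) Q) =
      N ((- (w' x - Complex 0 al * w x) + t^-1%:c * w x) *: Wu).
    apply: (seminorm_eq hN).
    have ce : Complex (t^-1) al = t^-1%:c + Complex 0 al.
      by apply/eqP; rewrite eq_complex /= addr0 add0r !eqxx.
    rewrite ce in Wv; have := congr1 ( *%R (Normc.normc (w x))) Wv.
    by rewrite mulr0 -(seminormZ hN) => e2; apply: etrans e2; congr N; module.
  rewrite e1 (seminormZ hN) /b ler_pM ?normc_ge0 ?(seminorm_ge0 hN) ?hM //.
  apply: le_trans (le_normcD _ _) _.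
  rewrite normcN Normc.normcM normc_real ger0_norm ?invr_ge0 ?(ltW tp) //.
  rewrite mulrDl; apply: lerD.
    apply: le_trans (w'_le x0) _; rewrite ler_wpM2l //.
    have tx2 : t ^+ 2 <= (1 + x) ^+ 2 by rewrite ler_pXn2r ?nnegrE //; lra.
    have x10 : 0 < 1 + x by lra.
    by rewrite lef_pV2 ?posrE ?exprn_gt0.
  rewrite mul1r expr2 invfM ler_wpM2l ?invr_ge0 ?(ltW tp) //.
  apply: le_trans (w_le x0) _; rewrite lef_pV2 ?posrE; lra.
have hh := primitive_mean_value hN tT pD hF; rewrite !scaleN1r in hh.
have -> : P T - P t =
  (- (w T *: W (- T) u) + P T - (- (w t *: W (- t) u) + P t))
  + (w T *: W (- T) u - w t *: W (- t) u) by module.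
apply: le_trans (seminormD hN _ _) _.
apply: le_trans (lerD hh (seminormB hN _ _)) _.
rewrite !(seminormZ hN).
have bd x : t <= x -> Normc.normc (w x) * N (W (- x) u) <= t^-1 * (M * N u).
  move=> tx; rewrite ler_pM ?normc_ge0 ?(seminorm_ge0 hN) ?hM //.
  by apply: le_trans (w_le _) _; [lra|rewrite lef_pV2 ?posrE; lra].
apply: le_trans (lerD (lexx _) (lerD (bd _ tT) (bd _ (lexx t)))) _.
have b0 : 0 <= b.
  by rewrite /b mulr_ge0 ?divr_ge0 ?sqr_ge0 ?mulr_ge0 //; lra.
have hb : b * (T - t) <= (c + 1) * (t^-1 * (M * N u)).
  rewrite (_ : (c + 1) * _ = b * t); last by rewrite /b; field.
  by rewrite ler_wpM2l //; lra.
(* For d = 1 / t the resolvent bound reads N u <= C0 sqrt t. The integral contributes c + 1 such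
   terms and the two endpoints one each, hence c + 3. *)
have fin : t^-1 * (M * N u) <= M * C0 / Num.sqrt t.
  rewrite (_ : M * C0 / Num.sqrt t = t^-1 * (M * (C0 * Num.sqrt t))).
    by rewrite ler_wpM2l ?invr_ge0 ?(ltW tp) // ler_wpM2l.
  by rewrite -{2}st; field; rewrite gt_eqF.
have := ler_wpM2l (_ : 0 <= c + 3) fin; rewrite !mulrA => h3.
by have := h3 ltac:(lra); lra.
Qed.

(** Induction on the number of dyadic blocks between t and T. *)
Lemma decay t T : 1 <= t -> d0^-1 <= t -> t <= T ->
  N (P T - P t) <= 4 * ((c + 3) * M * C0) / Num.sqrt t.
Proof.
have [M0 c0 L0 d00] := And4 M_ge0 c_ge0 L_ge0 d0_gt0.
move=> t1 td tT.
have [n hn] : exists n, T <= 2 ^+ n * t.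
  exists (Num.truncn T).+1.
  apply: (@le_trans _ _ (Num.truncn T).+1%:R); first exact/ltW/truncnS_gt.
  rewrite -[leLHS]mulr1; apply: ler_pM => //.
  by rewrite -natrX ler_nat ltnW // ltn_expl.
set A := (c + 3) * M * C0.
elim: n t t1 td tT hn => [|n ih] t t1 td tT hn.
  have -> : T = t by apply/eqP; rewrite eq_le tT andbT -[leRHS]mul1r.
  rewrite subrr (seminorm0 hN).
  have := decay_step t1 td (lexx t); rewrite subrr (seminorm0 hN) -/A.
  move=> /(_ ltac:(lra)) h; rewrite -mulrA; lra.
have A0 : 0 <= A / Num.sqrt t.
  have := decay_step t1 td (lexx t); rewrite subrr (seminorm0 hN) -/A.
  by apply; lra.
have [T2|T2] := leP T (2 * t).
  apply: le_trans (decay_step t1 td tT T2) _; rewrite -/A -mulrA; lra.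
have h1 : N (P T - P (2 * t)) <= 4 * A / Num.sqrt (2 * t).
  by apply: ih; [lra|lra|lra|rewrite mulrA -exprSr].
have h2 : N (P (2 * t) - P t) <= A / Num.sqrt t by apply: decay_step; lra.
apply: le_trans (seminorm_dist_trans hN (P (2 * t)) _ _) _.
(* The constant 4 closes the induction: the tail from 2 t costs 4 / sqrt 2 <= 3 units, and the block
   [t, 2 t] costs one. *)
have s2 : 4 / 3 <= Num.sqrt 2 :> R.
  rewrite -(ler_pXn2r (n := 2)) ?nnegrE ?sqrtr_ge0 ?sqr_sqrtr //; lra.
have h3 : 4 * A / Num.sqrt (2 * t) <= 3 * (A / Num.sqrt t).
  rewrite sqrtrM // invfM.
  have -> : 4 * A * ((Num.sqrt 2)^-1 * (Num.sqrt t)^-1)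
    = (4 / Num.sqrt 2) * (A / Num.sqrt t) by ring.
  by rewrite ler_wpM2r // ler_pdivrMr; lra.
rewrite -mulrA; lra.
Qed.

Lemma decay_limit : exists l : V,
  (forall e, 0 < e -> exists T0, forall T, T0 <= T -> N (P T - l) <= e) /\
  (forall t, 1 <= t -> d0^-1 <= t ->
    N (l - P t) <= 4 * ((c + 3) * M * C0) / Num.sqrt t).
Proof.
have [M0 c0 L0 d00] := And4 M_ge0 c_ge0 L_ge0 d0_gt0.
set A := 4 * ((c + 3) * M * C0).
pose t0 := Num.max 1 d0^-1.
have t01 : 1 <= t0 by rewrite le_max lexx.
have t0d : d0^-1 <= t0 by rewrite le_max lexx orbT.
have small e : 0 < e -> exists2 T0, t0 <= T0 &
    forall t T, T0 <= t -> t <= T -> N (P T - P t) <= e.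
  (* Beyond (A / e)^2 the bound A / sqrt t is at most [e]. *)
  move=> e0; exists (Num.max t0 ((A / e) ^+ 2)); first by rewrite le_max lexx.
  move=> t T; rewrite ge_max => /andP[tt te] tT.
  apply: le_trans (decay _ _ tT) _; [lra|lra|].
  rewrite -/A ler_pdivrMr ?sqrtr_gt0; last lra.
  rewrite -ler_pdivrMl // mulrC; apply: le_trans (ler_norm _) _.
  by rewrite -(sqrtr_sqr (A / e)) ler_wsqrtr.
have [|l hl] := hC (u := fun n => P n%:R).
  move=> e e0; have [T0 _ hT] := small e e0.
  exists (Num.truncn T0).+1 => n m hn hm.
  have big k : ((Num.truncn T0).+1 <= k)%N -> T0 <= k%:R.
    by move=> hk; apply: le_trans (ltW (truncnS_gt _)) _; rewrite ler_nat.
  have [nm|mn] := leqP n m.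
    by rewrite (seminorm_distC hN); apply: hT; rewrite ?big ?ler_nat.
  by apply: hT; rewrite ?big ?ler_nat // ltnW.
exists l; split.
  move=> e e0; have e2 : 0 < e / 2 by rewrite divr_gt0.
  have [T0 _ hT] := small _ e2; have [n0 hn0] := hl _ e2.
  exists T0 => T TT.
  pose n := (n0 + (Num.truncn T).+1)%N.
  have h1 := hn0 n (leq_addr _ _).
  have h2 := hT T n%:R TT.
  apply: le_trans (seminorm_dist_trans hN (P n%:R) _ _) _.
  rewrite (seminorm_distC hN) in h2.
  have : T <= n%:R.
    by apply: le_trans (ltW (truncnS_gt _)) _; rewrite ler_nat leq_addl.
  by move=> /h2; lra.
move=> t t1 td; apply/ler_addgt0Pr => e e0.
have [n0 hn0] := hl _ e0.
pose n := (n0 + (Num.truncn t).+1)%N.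
have tn : t <= n%:R.
  by apply: le_trans (ltW (truncnS_gt _)) _; rewrite ler_nat leq_addl.
apply: le_trans (seminorm_dist_trans hN (P n%:R) _ _) _.
rewrite addrC; apply: lerD; first exact: decay.
by rewrite (seminorm_distC hN) hn0 // leq_addr.
Qed.
End Decay.

(** * Square-integrable functions *)

Section SquareIntegrable.
Context d (T : measurableType d) (R : realType) (mu : {measure set T -> \bar R}).
Implicit Types f g h : T -> R.

Definition intbl f : Prop := mu.-integrable setT (EFin \o f).

Definition sqint f : Prop :=
  measurable_fun setT f /\ intbl (fun x => f x ^+ 2).

Definition nrm2 f : R := Num.sqrt (\int[mu]_x (f x ^+ 2)).

Lemma intblD f g : intbl f -> intbl g -> intbl (fun x => f x + g x).
Proof. by move=> hf hg; have := integrableD measurableT hf hg. Qed.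

Lemma intblZ (c : R) f : intbl f -> intbl (fun x => c * f x).
Proof. by move=> hf; have := integrableZl measurableT c hf. Qed.

Lemma intblN f : intbl f -> intbl (fun x => - f x).
Proof. by move=> hf; have := integrableN hf. Qed.

Lemma intblB f g : intbl f -> intbl g -> intbl (fun x => f x - g x).
Proof. by move=> hf hg; apply: intblD => //; exact: intblN. Qed.

Lemma intbl_le f g : measurable_fun setT f -> (forall x, `|f x| <= g x) ->
  intbl g -> intbl f.
Proof.
move=> mf fg; apply: le_integrable => //; first exact/measurable_EFinP.
move=> x _ /=; rewrite lee_fin; apply: le_trans (fg x) _; exact: ler_norm.
Qed.

Lemma intbl_measurable f : intbl f -> measurable_fun setT f.
Proof. by move=> /measurable_int/measurable_EFinP. Qed.

Lemma intbl_norm f : intbl f -> intbl (fun x => `|f x|).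
Proof. exact: integrable_norm. Qed.

Lemma intbl0 : intbl (fun=> 0).
Proof. exact: integrable0. Qed.

Lemma RintD f g : intbl f -> intbl g ->
  \int[mu]_x (f x + g x) = \int[mu]_x f x + \int[mu]_x g x.
Proof. by move=> hf hg; exact: RintegralD. Qed.

Lemma RintB f g : intbl f -> intbl g ->
  \int[mu]_x (f x - g x) = \int[mu]_x f x - \int[mu]_x g x.
Proof. by move=> hf hg; exact: RintegralB. Qed.

Lemma RintZ (c : R) f : intbl f -> \int[mu]_x (c * f x) = c * \int[mu]_x f x.
Proof. by move=> hf; exact: RintegralZl. Qed.

Lemma Rint_le f g : intbl f -> intbl g -> (forall x, f x <= g x) ->
  \int[mu]_x f x <= \int[mu]_x g x.
Proof. by move=> hf hg fg; apply: le_Rintegral => // x _; exact: fg. Qed.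

Lemma Rint_norm_le f g : intbl f -> intbl g -> (forall x, `|f x| <= g x) ->
  `|\int[mu]_x f x| <= \int[mu]_x g x.
Proof.
move=> hf hg fg; apply: le_trans (le_normr_Rintegral _ _) _ => //.
by apply: Rint_le => //; exact: intbl_norm.
Qed.

Lemma Lfun2P f : (f \in Lfun mu 2%:E) <-> sqint f.
Proof.
split.
  move=> h; split; last exact: Lfun2_integrable_sqr.
  by move: h; rewrite inE => /andP[/[!inE]].
move=> [mf hf]; rewrite inE; apply/andP; split; rewrite inE //=.
rewrite /finite_norm unlock; apply: poweR_lty.
have /integrableP[_] := hf; apply: le_lt_trans.
rewrite le_eqVlt; apply/orP; left; apply/eqP; apply: eq_integral => x _ /=.
by rewrite normrX powR_mulrn.
Qed.

Lemma sqint_mul f g : sqint f -> sqint g -> intbl (fun x => f x * g x).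
Proof.
move=> [mf hf] [mg hg]; apply: (intbl_le _ _ (intblD hf hg)).
  exact: measurable_funM.
move=> x; rewrite ler_norml; have := sqr_ge0 (f x); have := sqr_ge0 (g x).
have := sqr_ge0 (f x - g x); have := sqr_ge0 (f x + g x).
by rewrite sqrrD sqrrB; lra.
Qed.

Lemma sqintD f g : sqint f -> sqint g -> sqint (fun x => f x + g x).
Proof.
move=> hf hg; split; first by apply: measurable_funD; [case: hf|case: hg].
rewrite (_ : (fun x => _) = fun x => f x ^+ 2 + g x ^+ 2 + 2 * (f x * g x)).
  apply: intblD; last by apply: intblZ; exact: sqint_mul.
  by apply: intblD; [case: hf|case: hg].
by apply/funext => x; ring.
Qed.

Lemma sqintZ (c : R) f : sqint f -> sqint (fun x => c * f x).
Proof.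
move=> [mf hf]; split; first exact: measurable_funM.
rewrite (_ : (fun x => _) = fun x => c ^+ 2 * f x ^+ 2); first exact: intblZ.
by apply/funext => x; rewrite exprMn.
Qed.

Lemma sqintN f : sqint f -> sqint (fun x => - f x).
Proof.
by move=> /(sqintZ (-1)); under eq_fun do rewrite mulN1r.
Qed.

Lemma sqintB f g : sqint f -> sqint g -> sqint (fun x => f x - g x).
Proof. by move=> hf hg; apply: sqintD => //; exact: sqintN. Qed.

Lemma sqint0 : sqint (fun=> 0).
Proof.
split; first exact: measurable_cst.
by under eq_fun do rewrite expr0n; exact: intbl0.
Qed.

Lemma nrm2_ge0 f : 0 <= nrm2 f.
Proof. exact: sqrtr_ge0. Qed.

Lemma nrm2_sqr f : nrm2 f ^+ 2 = \int[mu]_x (f x ^+ 2).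
Proof. by rewrite sqr_sqrtr // Rintegral_ge0 // => x _; exact: sqr_ge0. Qed.

(** The integral of (f + s g)^2 is a quadratic polynomial in [s] that is never negative. *)
Lemma cauchy_schwarz f g : sqint f -> sqint g ->
  `|\int[mu]_x (f x * g x)| <= nrm2 f * nrm2 g.
Proof.
move=> hf hg.
set C := \int[mu]_x _; set A := nrm2 f; set B := nrm2 g.
have quad s : 0 <= A ^+ 2 + 2 * s * C + s ^+ 2 * B ^+ 2.
  have e : \int[mu]_x ((f x + s * g x) ^+ 2) = A ^+ 2 + 2 * s * C + s ^+ 2 * B ^+ 2.
    have h1 := proj2 hf; have h2 := intblZ (2 * s) (sqint_mul hf hg).
    have h3 := intblZ (s ^+ 2) (proj2 hg).
    rewrite /A /B !nrm2_sqr -(RintZ _ (proj2 hg)) -(RintZ _ (sqint_mul hf hg)).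
    rewrite -(RintD h1 h2) -(RintD (intblD h1 h2) h3).
    by apply: eq_Rintegral => x _; ring.
  rewrite -e.
  by apply: Rintegral_ge0 => x _; exact: sqr_ge0.
have A0 : 0 <= A := nrm2_ge0 f; have B0 : 0 <= B := nrm2_ge0 g.
have [B1|B1] := eqVneq B 0.
  rewrite B1 mulr0 normr_le0; apply/negPn/negP => C0.
  (* When [B = 0] the polynomial is affine, and at this point it would equal -1. *)
  have := quad (- (A ^+ 2 + 1) / (2 * C)); rewrite B1 expr0n mulr0 addr0.
  rewrite (_ : 2 * _ * C = - (A ^+ 2 + 1)); last by field.
  lra.
have Bp : 0 < B by rewrite lt_neqAle eq_sym B1.
(* The minimum of the polynomial. *)
have := quad (- C / B ^+ 2).
rewrite (_ : _ + _ = A ^+ 2 - C ^+ 2 / B ^+ 2); last by field.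
rewrite subr_ge0 ler_pdivrMr ?exprn_gt0 // -exprMn => h.
rewrite -(ler_pXn2r (n := 2)) ?nnegrE ?mulr_ge0 //.
by rewrite real_normK ?num_real.
Qed.

Lemma nrm2D f g : sqint f -> sqint g ->
  nrm2 (fun x => f x + g x) <= nrm2 f + nrm2 g.
Proof.
move=> hf hg.
rewrite -(ler_pXn2r (n := 2)) ?nnegrE ?addr_ge0 ?nrm2_ge0 //.
have -> : nrm2 (fun x => f x + g x) ^+ 2 =
    nrm2 f ^+ 2 + 2 * \int[mu]_x (f x * g x) + nrm2 g ^+ 2.
  have h1 := proj2 hf; have h2 := intblZ 2 (sqint_mul hf hg).
  have h3 := proj2 hg.
  rewrite !nrm2_sqr -(RintZ _ (sqint_mul hf hg)).
  rewrite -(RintD h1 h2) -(RintD (intblD h1 h2) h3).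
  by apply: eq_Rintegral => x _; ring.
have := le_trans (ler_norm _) (cauchy_schwarz hf hg).
by rewrite (sqrrD (nrm2 f)); lra.
Qed.

Lemma Rintegral_ae f g : measurable_fun setT f -> measurable_fun setT g ->
  f = g %[ae mu] -> \int[mu]_x f x = \int[mu]_x g x.
Proof.
move=> mf mg fg; congr fine; apply: ae_eq_integral => //.
- exact/measurable_EFinP.
- exact/measurable_EFinP.
- exact: (ae_eq_comp EFin fg).
Qed.

Lemma nrm2_ae f g : measurable_fun setT f -> measurable_fun setT g ->
  f = g %[ae mu] -> nrm2 f = nrm2 g.
Proof.
move=> mf mg fg; congr Num.sqrt; apply: Rintegral_ae.
- exact: measurable_funX.
- exact: measurable_funX.
- exact: (ae_eq_comp (fun x => x ^+ 2) fg).
Qed.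

End SquareIntegrable.

(** * Completeness of the space of square-integrable functions *)

Section Completeness.
Context d (T : measurableType d) (R : realType) (mu : {measure set T -> \bar R}).
Local Notation sqint := (sqint mu).
Local Notation nrm2 := (nrm2 mu).

(* Along a subsequence with [nrm2 (g_(j+1) - g_j) <= 4^-j], the weighted sum
   of the squared increments is integrable, so the increments are almost
   everywhere dominated by a geometric sequence. *)
Lemma sqint_fast_cvg (g : nat -> T -> R) : (forall j, sqint (g j)) ->
  (forall j, nrm2 (fun x => g j.+1 x - g j x) <= 4^-1 ^+ j) ->
  exists2 h, sqint h & exists K : R, forall j,
    nrm2 (fun x => g j x - h x) <= K * 2^-1 ^+ j.
Proof.
move=> hg gD.
pose D j x := g j.+1 x - g j x.
have hD j : sqint (D j) by exact: sqintB.
(* The weight 4^j leaves integrals at most 4^j 16^(-j) = 4^(-j), still summable, while a finite sum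
   forces |D_j| <= sqrt s 2^(-j) pointwise. *)
pose u j x : \bar R := (4 ^+ j * D j x ^+ 2)%:E.
have u0 j x : (0 <= u j x)%E by rewrite lee_fin mulr_ge0 ?sqr_ge0 ?exprn_ge0.
have mu_ j : measurable_fun setT (u j).
  apply/measurable_EFinP; apply: measurable_funM => //.
  by apply: measurable_funX; case: (hD j).
pose S x : \bar R := (\sum_(j <oo) u j x)%E.
have S0 x : (0 <= S x)%E by apply: nneseries_ge0.
have mS : measurable_fun setT S.
  rewrite (_ : S = fun x => (\sum_(j <oo | j \in xpredT) u j x)%E) //.
  exact: ge0_emeasurable_sum.
have iS : mu.-integrable setT S.
  apply/integrableP; split=> //.
  under eq_integral do rewrite gee0_abs //.
  rewrite integral_nneseries //.
  have hu j : (\int[mu]_x u j x <= (4^-1 ^+ j)%:E)%E.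
    have hj : intbl mu (fun x => 4 ^+ j * D j x ^+ 2).
      by apply: intblZ; exact: (proj2 (hD j)).
    have -> : (\int[mu]_x u j x = (4 ^+ j * nrm2 (D j) ^+ 2)%:E)%E.
      rewrite nrm2_sqr -(RintZ _ (proj2 (hD j))) /Rintegral fineK //.
      exact: integrable_fin_num.
    rewrite lee_fin.
    have -> : 4^-1 ^+ j = 4 ^+ j * (4^-1 ^+ j) ^+ 2 :> R.
      by rewrite expr2 mulrA -exprMn mulfV // expr1n mul1r.
    rewrite ler_wpM2l ?exprn_ge0 // ler_pXn2r ?nnegrE ?nrm2_ge0 ?exprn_ge0 //.
    exact: gD.
  apply: (@le_lt_trans _ _ 2%:E); last exact: ltry.
  apply: lime_le; first by apply: is_cvg_nneseries => j _ _; exact: integral_ge0.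
  apply: nearW => n.
  apply: (@le_trans _ _ (\sum_(0 <= j < n) (4^-1 ^+ j)%:E)%E).
    by apply: lee_sum.
  rewrite sumEFin lee_fin.
  apply: (@le_trans _ _ (2 * (1 - 4^-1 ^+ n))); last first.
    have : 0 <= 4^-1 ^+ n :> R by rewrite exprn_ge0 ?invr_ge0.
    by lra.
  elim: n => [|n ih]; first by rewrite big_nil expr0; lra.
  rewrite big_nat_recr //= exprS.
  have : 0 <= 4^-1 ^+ n :> R by rewrite exprn_ge0 ?invr_ge0.
  by move: ih; set q := 4^-1 ^+ n; lra.
pose A := [set x | S x \is a fin_num].
have mA : measurable A.
  by have := emeasurable_fin_num measurableT mS; rewrite setTI.
have aeA : {ae mu, forall x, A x}.
  have := integrable_ae measurableT iS.
  by apply: filterS => x; apply.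
pose s x := fine (S x).
have s0 x : 0 <= s x by exact: fine_ge0.
have is_ : intbl mu s.
  apply: (intbl_le (g := s)) => //.
  - exact: measurableT_comp.
  - by move=> x; rewrite ger0_norm.
  - apply/integrableP; split; first by apply/measurable_EFinP; exact: measurableT_comp.
    have /integrableP[_] := iS; apply: le_lt_trans.
    apply: ge0_le_integral => //.
    + by apply: measurableT_comp => //; apply/measurable_EFinP; exact: measurableT_comp.
    + by apply: measurableT_comp.
    + move=> x _ /=; rewrite gee0_abs // ger0_norm // /s.
      by have := S0 x; case: (S x) => //= _; rewrite leey.
have Dle j x : A x -> `|D j x| <= Num.sqrt (s x) * 2^-1 ^+ j.
  move=> Ax.
  rewrite -(ler_pXn2r (n := 2)) ?nnegrE ?mulr_ge0 ?sqrtr_ge0 ?exprn_ge0 ?invr_ge0 //.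
  rewrite exprMn sqr_sqrtr // real_normK ?num_real //.
  rewrite -exprM mulnC exprM.
  have -> : 2^-1 ^+ 2 = 4^-1 :> R by rewrite expr2; field.
  have -> : D j x ^+ 2 = (4 ^+ j * D j x ^+ 2) * 4^-1 ^+ j.
    by rewrite mulrAC -exprMn mulfV // expr1n mul1r.
  rewrite ler_wpM2r ?exprn_ge0 ?invr_ge0 // -lee_fin /s fineK //.
  have /(le_trans _) := nneseries_lim_ge (u_ := fun j => u j x) (P := xpredT) (m := 0) j.+1
    (fun n _ _ => u0 n x); apply.
  rewrite big_nat_recr //= leeDr //.
  by apply: sume_ge0.
have tail x j k : A x ->
    `|g (j + k)%N x - g j x| <= Num.sqrt (s x) * (2 * (2^-1 ^+ j - 2^-1 ^+ (j + k))).
  move=> Ax; elim: k => [|k ih]; first by rewrite addn0 !subrr normr0 mulr0 mulr0.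
  rewrite addnS.
  have -> : g (j + k).+1 x - g j x = D (j + k)%N x + (g (j + k)%N x - g j x).
    by rewrite /D; ring.
  apply: le_trans (ler_normD _ _) _.
  have := Dle (j + k)%N x Ax; rewrite exprS.
  by move: ih; set q := 2^-1 ^+ (j + k); lra.
have tail2 x j i : A x -> (j <= i)%N ->
    `|g i x - g j x| <= Num.sqrt (s x) * (2 * 2^-1 ^+ j).
  move=> Ax ji; rewrite -(subnKC ji); apply: le_trans (tail x j _ Ax) _.
  rewrite ler_wpM2l ?sqrtr_ge0 // ler_wpM2l // lerBlDr lerDl.
  by rewrite exprn_ge0 ?invr_ge0.
have small (r e : R) : 0 < e -> exists j, r * (2 * 2^-1 ^+ j) < e.
  move=> e0.
  have : (fun j => r * (2 * 2^-1 ^+ j)) @ \oo --> (0 : R).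
    have -> : (fun j => r * (2 * 2^-1 ^+ j)) = geometric (r * 2) (2^-1).
      by apply/funext => j; rewrite /geometric /=; ring.
    by apply: cvg_geometric; rewrite ger0_norm ?invr_ge0 // invf_lt1; lra.
  move=> /cvgrPdist_lt /(_ e e0); rewrite nearE => -[j _ /(_ j (leqnn j))] /=.
  by rewrite sub0r normrN => /(le_lt_trans (ler_norm _)); exists j.
(* Cutting off to the set where the sum is finite makes the sequence converge at every point, so the
   limit is measurable. *)
pose hj j x := g j x * \1_A x.
have hj0 x : ~ A x -> hj ^~ x = fun=> 0.
  by move=> nAx; apply/funext => j; rewrite /hj indicE memNset // mulr0.
have hj1 x : A x -> hj ^~ x = g ^~ x.
  by move=> Ax; apply/funext => j; rewrite /hj indicE mem_set // mulr1.
have cv x : cvgn (hj ^~ x).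
  have [Ax|nAx] := pselect (A x); last by rewrite hj0 //; exact: is_cvg_cst.
  rewrite hj1 //.
  apply/cauchy_cvgP/cauchy_exP => e e0.
  have [j hj'] := small (Num.sqrt (s x)) e e0.
  exists (g j x); exists j => // i /= ji.
  rewrite /ball /= distrC; apply: le_lt_trans hj'; exact: tail2.
pose h x := limn (hj ^~ x).
have mhj j : measurable_fun setT (hj j).
  by apply: measurable_funM; [case: (hg j)|].
have mh : measurable_fun setT h.
  by apply: (measurable_fun_cvg mhj) => x _; exact: cv.
have bound j x : (hj j x - h x) ^+ 2 <= (4 * (2^-1 ^+ j) ^+ 2) * s x.
  have q0 : 0 <= 2^-1 ^+ j :> R by rewrite exprn_ge0 ?invr_ge0.
  have [Ax|nAx] := pselect (A x); last first.
    have -> : hj j x - h x = 0.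
      by rewrite /h hj0 // lim_cst // subr0 /hj indicE memNset // mulr0.
    by rewrite expr0n mulr_ge0 // mulr_ge0 // sqr_ge0.
  have b : `|hj j x - h x| <= Num.sqrt (s x) * (2 * 2^-1 ^+ j).
    rewrite distrC.
    have cn : (fun i => `|hj i x - hj j x|) @ \oo --> `|h x - hj j x|.
      by apply: cvg_norm; apply: cvgB; [exact: cv|exact: cvg_cst].
    rewrite -(cvg_lim _ cn) //; apply: limr_le; first by apply/cvg_ex; eexists; exact: cn.
    exists j => // i /= ji; rewrite /hj indicE mem_set // !mulr1.
    exact: tail2.
  rewrite -real_normK ?num_real //.
  have -> : 4 * (2^-1 ^+ j) ^+ 2 * s x = (Num.sqrt (s x) * (2 * 2^-1 ^+ j)) ^+ 2.
    by rewrite !exprMn sqr_sqrtr //; ring.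
  by rewrite ler_pXn2r ?nnegrE ?mulr_ge0 ?sqrtr_ge0.
have sD j : sqint (fun x => hj j x - h x).
  split; first exact: measurable_funB.
  apply: (intbl_le (g := fun x => (4 * (2^-1 ^+ j) ^+ 2) * s x)).
  - by apply: measurable_funX; exact: measurable_funB.
  - by move=> x; rewrite ger0_norm ?sqr_ge0.
  - exact: intblZ.
have aej j : g j = hj j %[ae mu].
  move: aeA; apply: filterS => x Ax _ /=.
  by rewrite /hj indicE mem_set // mulr1.
have shj j : sqint (hj j).
  split=> //; apply: (intbl_le (g := fun x => g j x ^+ 2)).
  - exact: measurable_funX.
  - move=> x; rewrite ger0_norm ?sqr_ge0 // /hj exprMn indicE.
    by case: (_ \in _); rewrite ?expr1n ?mulr1 // expr0n mulr0 sqr_ge0.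
  - exact: (proj2 (hg j)).
exists h.
  have := sqintB (shj 0%N) (sD 0%N).
  by rewrite (_ : (fun x => _) = h) //; apply/funext => x; ring.
exists (2 * Num.sqrt (\int[mu]_x s x)) => j.
rewrite (nrm2_ae (g := fun x => hj j x - h x)) //.
- rewrite -(ler_pXn2r (n := 2)) ?nnegrE ?nrm2_ge0 ?mulr_ge0 ?sqrtr_ge0 ?exprn_ge0 ?invr_ge0 //.
  rewrite nrm2_sqr !exprMn sqr_sqrtr ?Rintegral_ge0 //.
  have -> : 2 ^+ 2 * \int[mu]_x s x * (2^-1 ^+ j) ^+ 2 =
      \int[mu]_x ((4 * (2^-1 ^+ j) ^+ 2) * s x).
    by rewrite RintZ //; ring.
  apply: le_Rintegral => //; first exact: (proj2 (sD j)).
  exact: intblZ.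
- by apply: measurable_funB => //; case: (hg j).
- exact: measurable_funB.
- exact: (ae_eq_comp2 (fun x y => y - h x) (aej j)).
Qed.

Lemma sqint_complete (f : nat -> T -> R) : (forall n, sqint (f n)) ->
  (forall e : R, 0 < e -> exists n0, forall n m, (n0 <= n)%N -> (n0 <= m)%N ->
     nrm2 (fun x => f n x - f m x) <= e) ->
  exists2 h, sqint h & forall e : R, 0 < e -> exists n0, forall n, (n0 <= n)%N ->
     nrm2 (fun x => f n x - h x) <= e.
Proof.
move=> hf fC.
have q0 j : 0 < 4^-1 ^+ j :> R by rewrite exprn_gt0 ?invr_gt0.
pose n0 j := projT1 (cid (fC _ (q0 j))).
have hn0 j n m : (n0 j <= n)%N -> (n0 j <= m)%N ->
    nrm2 (fun x => f n x - f m x) <= 4^-1 ^+ j.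
  exact: (projT2 (cid (fC _ (q0 j)))).
(* Summing the thresholds gives a nondecreasing sequence of indices with [k j] at least [n0 j]. *)
pose k j := \sum_(i < j.+1) n0 i.
have kn j : (n0 j <= k j)%N by rewrite /k big_ord_recr /= leq_addl.
have kS j : (k j <= k j.+1)%N by rewrite /k [X in (_ <= X)%N]big_ord_recr /= leq_addr.
have [|j|h hh [K hK]] := @sqint_fast_cvg (fun j => f (k j)).
- by move=> j.
- by apply: hn0; rewrite ?(leq_trans (kn j)).
exists h => // e e0.
have [j [h1 h2]] : exists j, 4^-1 ^+ j <= e / 2 /\ K * 2^-1 ^+ j <= e / 2.
  have e2 : 0 < e / 2 by rewrite divr_gt0.
  have c1 : geometric 1 (4^-1) @ \oo --> (0 : R).
    by apply: cvg_geometric; rewrite ger0_norm ?invr_ge0 // invf_lt1; lra.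
  have c2 : geometric K (2^-1) @ \oo --> (0 : R).
    by apply: cvg_geometric; rewrite ger0_norm ?invr_ge0 // invf_lt1; lra.
  move/cvgrPdist_le: c1 => /(_ _ e2) c1; move/cvgrPdist_le: c2 => /(_ _ e2) c2.
  near \oo => j; exists j; split.
    have : `|0 - geometric 1 4^-1 j| <= e / 2 by near: j.
    by rewrite sub0r normrN /geometric /= mul1r => /(le_trans (ler_norm _)).
  have : `|0 - geometric K 2^-1 j| <= e / 2 by near: j.
  by rewrite sub0r normrN /geometric /= => /(le_trans (ler_norm _)).
exists (n0 j) => n nj.
have -> : (fun x => f n x - h x) = fun x => (f n x - f (k j) x) + (f (k j) x - h x).
  by apply/funext => x; rewrite subrKA.
apply: le_trans (nrm2D _ _) _; [exact: sqintB|exact: sqintB|].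
have := hn0 j n (k j) nj (kn j); have := hK j; lra.
Unshelve. all: by end_near.
Qed.
End Completeness.

(** * Differentiation rules in pointwise form *)

Section Derivatives.
Context {R : realType}.
Implicit Types (f g : R -> R) (x a b : R).

Lemma is_derive_const (c x : R) : is_derive x (1 : R) (fun _ : R => c) 0.
Proof. exact: (is_derive_cst c x (1 : R)). Qed.

Lemma is_derive_add f g x a b : is_derive x (1 : R) f a ->
  is_derive x (1 : R) g b -> is_derive x (1 : R) (fun y => f y + g y) (a + b).
Proof. by move=> hf hg; exact: (is_deriveD hf hg). Qed.

Lemma is_derive_opp f x a : is_derive x (1 : R) f a ->
  is_derive x (1 : R) (fun y => - f y) (- a).
Proof. by move=> hf; exact: (is_deriveN hf). Qed.

Lemma is_derive_mul f g x a b : is_derive x (1 : R) f a ->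
  is_derive x (1 : R) g b ->
  is_derive x (1 : R) (fun y => f y * g y) (a * g x + f x * b).
Proof.
move=> hf hg; apply: (is_derive_eq (is_deriveM hf hg)).
by rewrite /GRing.scale /= addrC mulrC.
Qed.

Lemma is_derive_scale (c : R) f x a : is_derive x (1 : R) f a ->
  is_derive x (1 : R) (fun y => c * f y) (c * a).
Proof. by move=> hf; exact: (is_deriveZ c hf). Qed.

Lemma is_derive_comp f g x a b : is_derive (g x) (1 : R) f a ->
  is_derive x (1 : R) g b -> is_derive x (1 : R) (fun y => f (g y)) (a * b).
Proof. by move=> hf hg; exact: (is_derive1_comp hf hg). Qed.

Lemma is_derive_inv f x a : f x != 0 -> is_derive x (1 : R) f a ->
  is_derive x (1 : R) (fun y => (f y)^-1) (- a / f x ^+ 2).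
Proof.
move=> fx hf; apply: (is_derive_eq (is_deriveV fx hf)).
by rewrite /GRing.scale /= mulNr mulrC mulNr.
Qed.

Lemma is_derive_exprn f n x a : is_derive x (1 : R) f a ->
  is_derive x (1 : R) (fun y => f y ^+ n) (n%:R * f x ^+ n.-1 * a).
Proof.
by move=> hf; have := is_deriveX n hf; rewrite exprfctE.
Qed.
End Derivatives.

(** * Smooth functions of compact support *)

Section TestFunctions.
Context {R : realType}.
Implicit Types (phi f g : R -> R) (t x y : R).

Definition smooth (phi : R -> R^o) : Prop :=
  forall n x, derivable (derive1n n phi) x 1.

Lemma smooth_derivable phi x : smooth phi -> derivable (phi : R -> R^o) x 1.
Proof. by move=> /(_ 0%N x). Qed.

Lemma smooth_derive phi : smooth phi -> smooth (derive1 (phi : R -> R^o)).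
Proof. by move=> h n x; have := h n.+1 x; rewrite /derive1n iterSr. Qed.

Lemma smooth_is_derive phi x : smooth phi ->
  is_derive x (1 : R) (phi : R -> R^o) (derive1 (phi : R -> R^o) x).
Proof. by move=> h; rewrite derive1E; exact/derivableP/smooth_derivable. Qed.

(** A coinduction principle: in a class stable under differentiation, every iterated derivative
    exists and stays in the class. *)
Lemma smooth_closed (C : (R -> R) -> Prop) :
  (forall f, C f -> exists2 g, C g & forall x, is_derive x (1 : R) f (g x)) ->
  forall f, C f -> smooth f.
Proof.
move=> hC f Cf n.
suff [g Cg ->] : exists2 g, C g & derive1n n f = g.
  by move=> x; have [h _ hd] := hC g Cg; have [] := hd x.
elim: n => [|n [g Cg hn]]; first by exists f.
have [h Ch hd] := hC g Cg; exists h => //.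
rewrite /derive1n iterS -/(derive1n n f) hn.
by apply/funext => x; rewrite derive1E; have [] := hd x.
Qed.

Lemma smooth_lin (c : R) f g : smooth f -> smooth g ->
  smooth (fun x => f x + c * g x).
Proof.
move=> hf hg; apply: (smooth_closed
  (C := fun u => exists f g, [/\ smooth f, smooth g & u = fun x => f x + c * g x])).
  move=> _ [f1 [g1 [h1 h2 ->]]].
  exists (fun x => derive1 (f1 : R -> R^o) x + c * derive1 (g1 : R -> R^o) x).
    by do 2 eexists; split; [exact: smooth_derive h1|exact: smooth_derive h2|].
  move=> x; apply: is_derive_add; first exact: smooth_is_derive.
  exact/is_derive_scale/smooth_is_derive.
by exists f, g.
Qed.

Lemma smooth_antiderivative f F : smooth f ->
  (forall x, is_derive x (1 : R) (F : R -> R^o) (f x)) -> smooth F.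
Proof.
move=> hf hF; apply: (smooth_closed (C := fun u => u = F \/ smooth u)); last by left.
move=> u [->|hu]; first by exists f => //; right.
exists (derive1 (u : R -> R^o)); first by right; exact: smooth_derive.
by move=> x; exact: smooth_is_derive.
Qed.

(** [theta 0] is the flat function e^(-1/t). The powers of 1 / t make the family stable under
    differentiation, up to linear combinations. *)
Definition theta (k : nat) t : R :=
  if 0 < t then expR (- t^-1) * t^-1 ^+ k else 0.

Lemma theta_ge0 k t : 0 <= theta k t.
Proof.
rewrite /theta; case: ifP => // t0.
by rewrite mulr_ge0 ?expR_ge0 ?exprn_ge0 // invr_ge0 ltW.
Qed.

(** The exponential series bounds e^(1/t) from below by t^-(k + n + 1) / (k + n + 1)!. *)
Lemma theta_le k n t : 0 < t -> theta k t <= (k + n).+1`!%:R * t ^+ n.+1.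
Proof.
move=> t0; rewrite /theta t0 expRN mulrC ler_pdivrMr ?expR_gt0 //.
have s0 : 0 <= t^-1 by rewrite invr_ge0 ltW.
have h := expR_ge1Dxn (k + n) s0.
have f0 : 0 < (k + n).+1`!%:R :> R by rewrite ltr0n fact_gt0.
have h2 : t^-1 ^+ (k + n).+1 <= (k + n).+1`!%:R * expR t^-1.
  by rewrite -ler_pdivrMl // mulrC; lra.
apply: (@le_trans _ _ (t ^+ n.+1 * t^-1 ^+ (k + n).+1)).
  by rewrite -addnS exprD mulrCA -exprMn mulfV ?gt_eqF // expr1n mulr1.
by rewrite mulrC [leRHS]mulrAC ler_wpM2r // exprn_ge0 // ltW.
Qed.

Lemma theta0_le1 t : theta 0 t <= 1.
Proof.
rewrite /theta; case: ifP => // t0; rewrite expr0 mulr1 -expR0 ler_expR.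
by rewrite oppr_le0 invr_ge0 ltW.
Qed.

Lemma is_derive_theta k t : is_derive t (1 : R) (theta k)
  (theta k.+2 t - k%:R * theta k.+1 t).
Proof.
have [t0|t0|->] := ltgtP t 0.
- have -> : theta k.+2 t - k%:R * theta k.+1 t = 0.
    by rewrite /theta ltNge (ltW t0) /= mulr0 subr0.
  apply: (@near_eq_is_derive _ _ _ (cst 0)).
  near=> y; rewrite /theta ifF //; apply/negbTE; rewrite -leNgt ltW //.
  by near: y; exact: lt_nbhsl.
- apply: (@near_eq_is_derive _ _ _ (fun y : R => expR (- y^-1) * y^-1 ^+ k)).
    near=> y; rewrite /theta ifT //.
    by near: y; exact: lt_nbhsr.
  have t1 : t != 0 by rewrite gt_eqF.
  have dV := is_derive_inv t1 (is_derive_id t (1 : R)).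
  have dE := is_derive_comp (g := fun y => - y^-1)
    (is_derive_expR (- t^-1)) (is_derive_opp dV).
  apply: (is_derive_eq (is_derive_mul dE (is_derive_exprn k dV))).
  rewrite /theta t0 /=.
  case: k => [|k] /=; first by rewrite !expr0; field.
  by rewrite !exprS; field.
(* At 0 the quadratic bound [theta_le] with n = 1 forces the difference quotient to 0. *)
- have -> : theta k.+2 0 - k%:R * theta k.+1 0 = 0.
    by rewrite /theta ltxx mulr0 subr0.
  have lim : (fun h : R => h^-1 *: (theta k (h + 0) - theta k 0)) @ 0^' --> (0 : R).
    pose M : R := (k + 1).+1`!%:R.
    have M0 : 0 < M by rewrite ltr0n fact_gt0.
    apply/cvgrPdist_le => e e0; near=> h.
    have h0 : h != 0 by near: h; exact: nbhs_dnbhs_neq.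
    have he : `|h| < e / M by near: h; apply: dnbhs0_lt; rewrite divr_gt0.
    have hn0 : 0 < `|h| by rewrite normr_gt0.
    rewrite sub0r normrN addr0 /GRing.scale /= normrM normfV.
    rewrite ler_pdivrMl // mulrC.
    rewrite {2}/theta ltxx subr0 ger0_norm ?theta_ge0 //.
    have [hp|hn] := ltP 0 h; last by rewrite /theta ltNge hn /= mulr_ge0 // ltW.
    apply: le_trans (theta_le k 1 hp) _; rewrite -/M.
    rewrite gtr0_norm // in he *.
    rewrite expr2 mulrA ler_wpM2r ?(ltW hp) //.
    by rewrite mulrC -ler_pdivlMr // ltW.
  apply: DeriveDef.
    apply/cvg_ex; exists 0; apply: cvg_trans lim; apply: near_eq_cvg.
    by apply: nearW => h /=; rewrite scaler1.
  apply: cvg_lim => //; apply: cvg_trans lim; apply: near_eq_cvg.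
  by apply: nearW => h /=; rewrite scaler1.
Unshelve. all: by end_near.
Qed.

(** Polynomial coefficients absorb the chain rule factor D', so this span is stable under
    differentiation and [smooth_closed] applies to it. *)
Inductive theta_span (D : {poly R}) : (R -> R) -> Prop :=
| theta_span_base p k : theta_span D (fun x => p.[x] * theta k D.[x])
| theta_span_add f g : theta_span D f -> theta_span D g ->
    theta_span D (fun x => f x + g x).

Lemma smooth_theta (D : {poly R}) : smooth (fun x => theta 0 D.[x]).
Proof.
have -> : (fun x => theta 0 D.[x]) = fun x => (1%:P : {poly R}).[x] * theta 0 D.[x].
  by apply/funext => x; rewrite hornerC mul1r.
apply: (smooth_closed (C := theta_span D)); last exact: theta_span_base.
move=> h; elim=> [p k|f g _ [f' Cf' df] _ [g' Cg' dg]]; last first.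
  exists (fun x => f' x + g' x); first exact: theta_span_add.
  by move=> x; exact: is_derive_add.
exists (fun x => (p^`()).[x] * theta k D.[x] +
    ((p * D^`()).[x] * theta k.+2 D.[x] +
     ((- k%:R) *: (p * D^`())).[x] * theta k.+1 D.[x])).
    by do 2 ?apply: theta_span_add; exact: theta_span_base.
  move=> x.
  have dt := is_derive_comp (g := horner D) (is_derive_theta k D.[x]) (is_derive_poly D x).
  apply: (is_derive_eq (is_derive_mul (is_derive_poly p x) dt)).
  by rewrite hornerZ !hornerM; ring.
Qed.

(** The exponential of -1 / ((n + 1) (x - a) (b - x)) on ]a, b[; the factor n + 1 makes the bumps
    tend pointwise to the indicator of ]a, b[. *)
Definition smooth_bump (a b : R) (n : nat) x : R := theta 0 (n.+1%:R * ((x - a) * (b - x))).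

Lemma smooth_bumpE a b n : smooth_bump a b n =
  fun x => theta 0 ((n.+1%:R *: (('X - a%:P) * (b%:P - 'X)))%R : {poly R}).[x].
Proof. by apply/funext => x; rewrite /smooth_bump !hornerE. Qed.

Lemma smooth_bump_ge0 a b n x : 0 <= smooth_bump a b n x. Proof. exact: theta_ge0. Qed.
Lemma smooth_bump_le1 a b n x : smooth_bump a b n x <= 1. Proof. exact: theta0_le1. Qed.

Lemma smooth_bump_out a b n x : a <= b -> ~~ (a < x < b) -> smooth_bump a b n x = 0.
Proof.
move=> ab; rewrite negb_and -!leNgt => h; rewrite /smooth_bump /theta ifF //.
apply/negbTE; rewrite -leNgt mulr_ge0_le0 //.
by case/orP: h => h; [rewrite mulr_le0_ge0|rewrite mulr_ge0_le0]; lra.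
Qed.

Lemma smooth_bump_gt0 a b n x : a < x -> x < b -> 0 < smooth_bump a b n x.
Proof.
move=> ax xb; rewrite /smooth_bump /theta expr0 mulr1 ifT ?expR_gt0 //.
by rewrite !mulr_gt0 ?ltr0n ?subr_gt0.
Qed.

Lemma cvg_smooth_bump a b x : a <= b -> smooth_bump a b n x @[n --> \oo] --> ((a < x < b)%R%:R : R).
Proof.
move=> ab; have [/andP[ax xb]|h] := boolP (a < x < b); last first.
  by under eq_cvg do rewrite smooth_bump_out //; exact: cvg_cst.
have y0 : 0 < (x - a) * (b - x) by rewrite mulr_gt0 // subr_gt0.
have -> : (fun n => smooth_bump a b n x) = fun n => expR (- (harmonic n * ((x - a) * (b - x))^-1)).
  apply/funext => n; rewrite /smooth_bump /theta expr0 mulr1 ifT; last by rewrite mulr_gt0.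
  by rewrite invfM.
suff : (fun n => expR (- (harmonic n * ((x - a) * (b - x))^-1))) @ \oo --> expR (0 : R).
  by rewrite expR0.
apply: continuous_cvg; first exact: continuous_expR.
rewrite -oppr0; apply: cvgN; rewrite -(mul0r ((x - a) * (b - x))^-1).
by apply: cvgMl; exact: cvg_harmonic.
Qed.

Lemma test_function_smooth_bump a b n : a <= b -> test_function (smooth_bump a b n).
Proof.
move=> ab; split; first by rewrite smooth_bumpE; exact: smooth_theta.
exists (Num.max `|a| `|b|) => x; rewrite gt_max => /andP[xa xb].
apply: smooth_bump_out => //; apply/negP => /andP[ax bx].
have := ler_norm (- a); have := ler_norm b; rewrite normrN.
by move: xa xb; case: (lerP 0 x) => h; rewrite ?(ger0_norm h) ?(ltr0_norm h); lra.
Qed.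

End TestFunctions.

(** * Locally integrable and absolutely continuous functions *)

Section AbsolutelyContinuous.
Context {R : realType}.
Notation mu := (@lebesgue_measure R).
Implicit Types (f g h : R -> R) (a b c x y : R).

Lemma continuous_cst c : continuous (fun _ : R => c).
Proof. by move=> x; exact: cvg_cst. Qed.

Lemma measurable_segment a b : measurable (`[a, b] : set (measurableTypeR R)).
Proof. exact: measurable_itv. Qed.
#[local] Hint Resolve measurable_segment : core.

Definition locint g : Prop :=
  measurable_fun setT g /\ forall a b, mu.-integrable `[a, b] (EFin \o g).

Local Notation I a b g := (\int[mu]_(x in `[a, b]) g x).

Lemma locintD f g : locint f -> locint g -> locint (fun x => f x + g x).
Proof.
move=> [mf hf] [mg hg]; split; first exact: measurable_funD.
by move=> a b; have := integrableD (measurable_segment a b) (hf a b) (hg a b).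
Qed.

Lemma locintZ c f : locint f -> locint (fun x => c * f x).
Proof.
move=> [mf hf]; split; first exact: measurable_funM.
by move=> a b; have := integrableZl (measurable_segment a b) c (hf a b).
Qed.

Lemma locintN f : locint f -> locint (fun x => - f x).
Proof. by move=> /(locintZ (-1)); under eq_fun do rewrite mulN1r. Qed.

Lemma locintB f g : locint f -> locint g -> locint (fun x => f x - g x).
Proof. by move=> hf hg; apply: locintD => //; exact: locintN. Qed.

Lemma locint_norm f : locint f -> locint (fun x => `|f x|).
Proof.
move=> [mf hf]; split; first exact: measurableT_comp.
by move=> a b; exact: integrable_norm (hf a b).
Qed.

Lemma intbl_locint f : intbl mu f -> locint f.
Proof.
move=> hf; split; first exact: (intbl_measurable hf).
move=> a b; exact: (integrableS measurableT (measurable_segment a b) (@subsetT _ _) hf).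
Qed.

Lemma continuous_locint f : continuous f -> locint f.
Proof.
move=> cf; split; first exact: continuous_measurable_fun.
move=> a b; apply: continuous_compact_integrable; first exact: segment_compact.
exact: continuous_subspaceT.
Qed.

Lemma continuous_bounded f a b : continuous f ->
  exists2 M, 0 <= M & forall x, a <= x -> x <= b -> `|f x| <= M.
Proof.
move=> cf; have [ab|ba] := leP a b; last first.
  by exists 0 => // x ax xb; lra.
have cn : {within `[a, b], continuous (fun x => `|f x|)}.
  apply: continuous_subspaceT => x; apply: continuous_comp; first exact: cf.
  exact: norm_continuous.
have [c _ hc] := EVT_max ab cn; exists `|f c| => // x ax xb.
by apply: hc; rewrite in_itv /= ax.
Qed.

Lemma locintM f g : locint f -> continuous g -> locint (fun x => f x * g x).
Proof.
move=> [mf hf] cg; have mg := continuous_measurable_fun cg.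
split; first exact: measurable_funM.
move=> a b; have [M M0 hM] := continuous_bounded a b cg.
have := integrableZl (measurable_segment a b) M (hf a b).
apply: le_integrable => //.
  by apply/measurable_EFinP; apply: measurable_funS (measurable_funM mf mg).
move=> x; rewrite /= in_itv /= => /andP[ax xb].
by rewrite lee_fin !normrM mulrC ler_wpM2r // (ger0_norm M0) hM.
Qed.

Lemma sqint_locint f : sqint mu f -> locint f.
Proof.
move=> [mf hf]; split=> // a b.
have h1 : mu.-integrable `[a, b] (EFin \o (fun x => f x ^+ 2)).
  exact: (integrableS measurableT (measurable_segment a b) (@subsetT _ _) hf).
have h2 : mu.-integrable `[a, b] (EFin \o (fun=> 1 : R)).
  by case: (continuous_locint (@continuous_cst 1)).
have := integrableD (measurable_segment a b) h1 h2; apply: le_integrable => //.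
  by apply/measurable_EFinP; apply: measurable_funS mf.
move=> x _ /=; rewrite lee_fin [leRHS]ger0_norm ?addr_ge0 ?sqr_ge0 //.
by rewrite ler_norml; have := sqr_ge0 (f x - 1); have := sqr_ge0 (f x + 1);
   rewrite sqrrD sqrrB !expr1n !mulr1; have := sqr_ge0 (f x); lra.
Qed.

Lemma itv_intD f g a b : locint f -> locint g ->
  I a b (fun x => f x + g x) = I a b f + I a b g.
Proof. by move=> [_ hf] [_ hg]; exact: RintegralD. Qed.

Lemma itv_intZ c f a b : locint f -> I a b (fun x => c * f x) = c * I a b f.
Proof. by move=> [_ hf]; exact: RintegralZl. Qed.

Lemma itv_int_le f g a b : locint f -> locint g ->
  (forall x, a <= x -> x <= b -> f x <= g x) -> I a b f <= I a b g.
Proof.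
move=> [_ hf] [_ hg] fg; apply: le_Rintegral => // x.
by rewrite /= in_itv /= => /andP[]; exact: fg.
Qed.

Lemma itv_int_norm f a b : locint f -> `|I a b f| <= I a b (fun x => `|f x|).
Proof. by move=> [_ hf]; exact: le_normr_Rintegral. Qed.

Lemma itv_int_cst c a b : a <= b -> I a b (fun=> c) = c * (b - a).
Proof.
move=> ab; rewrite Rintegral_cst //.
have := @lebesgue_measure_itv R `[a, b]; rewrite /= lte_fin.
case: ltP => [_ -> //|ba ->].
by rewrite (_ : b = a) ?subrr ?mulr0 //; lra.
Qed.

Lemma itv_int_cat f a b c : locint f -> a <= b -> b <= c ->
  I a c f = I a b f + I b c f.
Proof.
move=> [_ hf] ab bc; apply/eqP; rewrite addrC -subr_eq; apply/eqP.
rewrite Rintegral_itvB ?bnd_simp // Rintegral_itv_obnd_cbnd //.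
by apply: integrableS (hf b c) => //; apply: subset_itvr; rewrite bnd_simp.
Qed.

Lemma itv_int_point f a : I a a f = 0.
Proof. by rewrite set_itv1 Rintegral_set1. Qed.

(** Monotone convergence along the segments [-n, n], which exhaust the line. *)
Lemma intbl_of_segments (f : R -> R) (B : R) : locint f -> (forall x, 0 <= f x) ->
  (forall n : nat, I (- n%:R) n%:R f <= B) -> intbl mu f /\ \int[mu]_x f x <= B.
Proof.
move=> [mf hf] f0 hB.
pose F (n : nat) : set R := `[- n%:R, n%:R]%classic.
have hU : \bigcup_n F n = setT.
  apply/seteqP; split=> // x _; exists (Num.truncn `|x|).+1 => //.
  by rewrite /F /= in_itv /= -ler_norml ltW // truncnS_gt.
have hmono : {homo F : n m / (n <= m)%N >-> (n <= m)%O}.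
  move=> n m nm; rewrite subsetEset /F; apply: subset_itv; rewrite bnd_simp.
    by rewrite lerN2 ler_nat.
  by rewrite ler_nat.
have mF n : measurable (F n) by exact: measurable_segment.
have cv : (\int[mu]_(x in F i) (f x)%:E @[i --> \oo] -->
    \int[mu]_(x in \bigcup_i F i) (f x)%:E)%E.
  apply: ge0_nondecreasing_set_cvg_integral => //.
  - by move=> n; apply/measurable_EFinP; exact: measurable_funS mf.
  - by move=> n x _; rewrite lee_fin.
rewrite hU in cv.
have le : (\int[mu]_x (f x)%:E <= B%:E)%E.
  apply: (cvge_le _ cv); apply: nearW => n /=.
  have := hB n; rewrite -lee_fin /Rintegral fineK //.
  by apply: integrable_fin_num; [exact: mF|exact: hf].
have fin : intbl mu f.
  apply/integrableP; split; first exact/measurable_EFinP.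
  under eq_integral do rewrite /= ger0_norm //.
  exact: le_lt_trans le (ltry B).
split=> //; rewrite -lee_fin /Rintegral fineK //.
exact: integrable_fin_num.
Qed.

Lemma segment_restrict_intbl f a b : intbl mu f ->
  intbl mu (fun x => if a <= x <= b then f x else 0) /\
  I a b f = \int[mu]_x (if a <= x <= b then f x else 0).
Proof.
move=> hf.
have e : f \_ `[a, b] = fun x => if a <= x <= b then f x else 0.
  apply/funext => x; rewrite patchE; case: ifPn => [|/negP h].
    by rewrite inE /= in_itv /= => ->.
  by rewrite ifN //; apply/negP => hx; apply: h; rewrite inE /= in_itv.
split; last by rewrite Rintegral_mkcond e.
have /(integrable_mkcond _ (measurable_segment _ _)) := proj2 (intbl_locint hf) a b.
by apply: eq_integrable => // x _; rewrite -e /= !patchE; case: ifP.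
Qed.

Lemma segment_le_Rintegral f a b : intbl mu f -> (forall x, 0 <= f x) ->
  I a b f <= \int[mu]_x f x.
Proof.
move=> hf f0; have [h ->] := segment_restrict_intbl a b hf.
by apply: Rint_le => // x; case: ifP.
Qed.

(** Otherwise all segments [-n, n] would carry at most the total mass minus [e], and so would the
    line. *)
Lemma intbl_tail w e : intbl mu w -> 0 < e ->
  exists n : nat, \int[mu]_x `|w x| - e <= I (- n%:R) n%:R (fun x => `|w x|).
Proof.
move=> iw e0; apply: contrapT => /forallNP h.
have [] := @intbl_of_segments (fun x => `|w x|) (\int[mu]_x `|w x| - e).
- exact: intbl_locint (intbl_norm iw).
- by [].
- by move=> n; have /negP := h n; rewrite -ltNge => /ltW.
- by move=> _; rewrite lerDl oppr_ge0 leNgt e0.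
Qed.

(** Absolute continuity with density [g], put in integral form so that no almost everywhere
    differentiation is involved. *)
Definition ac f g : Prop :=
  locint g /\ forall a b, a <= b -> f b - f a = I a b g.

Lemma ac_exists g : locint g -> exists2 f, ac f g & f 0 = 0.
Proof.
move=> hg; exists (fun x => if 0 <= x then I 0 x g else - I x 0 g); last first.
  by rewrite lexx itv_int_point.
split=> // a b ab; case: ifPn => b0; case: ifPn => a0; rewrite -?ltNge in a0 b0.
- by rewrite (itv_int_cat hg a0 ab); ring.
- by rewrite (itv_int_cat hg (ltW a0) b0); ring.
- lra.
- by rewrite (itv_int_cat hg ab (ltW b0)); ring.
Qed.

Lemma ac_lin c f f' g g' : ac f f' -> ac g g' ->
  ac (fun x => c * f x + g x) (fun x => c * f' x + g' x).
Proof.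
move=> [h1 h2] [h3 h4]; split; first by apply: locintD => //; exact: locintZ.
move=> a b ab; rewrite itv_intD ?itv_intZ -?h2 -?h4 //; last exact: locintZ.
by ring.
Qed.

Lemma ac_cst c : ac (fun=> c) (fun=> 0).
Proof.
split; first by apply: continuous_locint; exact: continuous_cst.
by move=> a b ab; rewrite itv_int_cst // mul0r subrr.
Qed.

Lemma ac_continuous f g : ac f g -> continuous f.
Proof.
move=> [[mg ig] hf] x.
have ab : x - 1 < x + 1 by lra.
have h : {within `[x - 1, x + 1], continuous (fun y => f (x - 1) + I (x - 1) y g)}.
  move=> y; apply: (@continuousD _ _ _ _ _ (y : subspace _)).
    exact: cvg_cst.
  by have := parameterized_integral_continuous (ltW ab) (ig (x - 1) (x + 1)); exact.
have {}h : {within `[x - 1, x + 1], continuous f}.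
  move: h; apply: subspace_eq_continuous => y; rewrite inE /= in_itv /= => /andP[xy _].
  by rewrite /from_subspace -(hf _ _ xy); ring.
apply: (within_continuous_continuous ab h); rewrite in_itv /=; lra.
Qed.

Lemma ac_ext f g f2 g2 : f =1 f2 -> g =1 g2 -> ac f g -> ac f2 g2.
Proof. by move=> /funext <- /funext <-. Qed.

Lemma ac_derive f g : (forall x, is_derive x (1 : R) f (g x)) -> continuous g ->
  ac f g.
Proof.
move=> df cg; split; first exact: continuous_locint.
move=> a b; rewrite le_eqVlt => /predU1P[->|ab].
  by rewrite subrr itv_int_point.
have cf : continuous f.
  by move=> x; apply/differentiable_continuous/derivable1_diffP; case: (df x).
rewrite /Rintegral (continuous_FTC2 (F := f)) //.
- exact: continuous_subspaceT.
- split.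
  + by move=> x _; case: (df x).
  + exact: cvg_at_right_filter (cf a).
  + exact: cvg_at_left_filter (cf b).
- by move=> x _; rewrite derive1E; case: (df x).
Qed.

Lemma nondecreasing_of_local (u : R -> R) (d a b : R) : 0 < d -> a <= b ->
  (forall x y, a <= x -> x <= y -> y <= b -> y - x < d -> u x <= u y) ->
  u a <= u b.
Proof.
move=> d0 ab hu.
pose n := Num.truncn ((b - a) / d).
pose h := (b - a) / n.+1%:R.
have n0 : 0 < n.+1%:R :> R by rewrite ltr0n.
have h0 : 0 <= h by rewrite divr_ge0 ?subr_ge0 // ltW.
have hd : h < d.
  by rewrite /h ltr_pdivrMr // mulrC -ltr_pdivrMr // truncnS_gt.
have hn : h * n.+1%:R = b - a by rewrite /h divfK // gt_eqF.
clearbody h.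
suff : forall k, (k <= n.+1)%N -> u a <= u (a + k%:R * h).
  move=> /(_ n.+1 (leqnn _)); rewrite mulrC hn.
  by rewrite (_ : a + (b - a) = b) //; ring.
elim=> [|k ih] kn; first by rewrite mul0r addr0.
apply: le_trans (ih (ltnW kn)) _.
have kh : 0 <= k%:R * h by rewrite mulr_ge0.
have kn' : k.+1%:R * h <= n.+1%:R * h by rewrite ler_wpM2r // ler_nat.
rewrite -natr1 in kn' *.
by apply: hu; lra.
Qed.

(** Let E be the product minus a primitive of the expected density. By uniform continuity of [f] and
    [g], on short intervals the increments of E are at most [e] times those of a primitive of |f'| +
    |g'|; hence E is constant. *)
Lemma ac_mul f f' g g' : ac f f' -> ac g g' ->
  ac (fun x => f x * g x) (fun x => f' x * g x + f x * g' x).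
Proof.
move=> acf acg; have cf := ac_continuous acf; have cg := ac_continuous acg.
have [lf' hf] := acf; have [lg' hg] := acg.
have l1 : locint (fun x => f' x * g x) by exact: locintM.
have l2 : locint (fun x => f x * g' x).
  by under eq_fun do rewrite mulrC; exact: locintM.
have l : locint (fun x => f' x * g x + f x * g' x) by exact: locintD.
split=> // a b ab.
have [H [_ hH] _] := ac_exists l.
have lk : locint (fun x => `|f' x| + `|g' x|).
  by apply: locintD; exact: locint_norm.
have [K [_ hK] _] := ac_exists lk.
pose E x := f x * g x - H x.
suff E0 : E b - E a = 0 by rewrite -hH //; move: E0; rewrite /E; lra.
have unif (u : R -> R) : continuous u -> forall e : R, 0 < e -> exists2 d, 0 < d & forall x y : R,
    a <= x -> x <= b -> a <= y -> y <= b -> `|y - x| < d -> `|u y - u x| <= e.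
  move=> cu; apply: (@segment_uniformly_continuous R R (fun x y : R => `|x - y|) _ _ u).
  - exact: distrC.
  - by move=> v w z; rewrite (_ : w - z = (w - v) + (v - z)) ?ler_normD //; ring.
  - move=> x _ _ e e0; have /cvgrPdist_le /(_ e e0) [d /= d0 hd] := cu x.
    by exists d => // y _ _ yx; rewrite distrC; apply: hd; rewrite /= distrC.
have step e : 0 < e -> `|E b - E a| <= e * (K b - K a).
  move=> e0.
  have [d1 d10 hd1] := unif f cf e e0.
  have [d2 d20 hd2] := unif g cg e e0.
  have d0 : 0 < Num.min d1 d2 by rewrite lt_min d10.
  have loc x y : a <= x -> x <= y -> y <= b -> y - x < Num.min d1 d2 ->
      `|E y - E x| <= e * (K y - K x).
    move=> ax xy yb; rewrite lt_min => /andP[y1 y2].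
    (* The increment of f g is g(x) (f(y) - f(x)) + f(y) (g(y) - g(x)), and both brackets are
       integrals of densities. *)
    have -> : E y - E x =
        I x y (fun s => (g x - g s) * f' s + (f y - f s) * g' s).
      have -> : (fun s => (g x - g s) * f' s + (f y - f s) * g' s) =
          fun s => (g x * f' s + f y * g' s) + (-1) * (f' s * g s + f s * g' s).
        by apply/funext => s; ring.
      rewrite itv_intD ?itv_intZ //; [|by apply: locintD; exact: locintZ|exact: locintZ].
      rewrite itv_intD ?itv_intZ //; [|exact: locintZ..].
      by rewrite -hf // -hg // -hH // /E; ring.
    have lloc : locint (fun s => (g x - g s) * f' s + (f y - f s) * g' s).
      apply: locintD; under eq_fun do rewrite mulrC; apply: locintM => //.
        by move=> z; apply: continuousB; [exact: cvg_cst|exact: cg].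
      by move=> z; apply: continuousB; [exact: cvg_cst|exact: cf].
    apply: le_trans (itv_int_norm _ _ lloc) _.
    rewrite hK // -itv_intZ //; apply: itv_int_le; [exact: locint_norm|exact: locintZ|].
    move=> s xs sy; apply: le_trans (ler_normD _ _) _; rewrite !normrM mulrDr.
    apply: lerD; apply: ler_wpM2r => //.
      apply: hd2 => //; [exact: le_trans ax xs|exact: le_trans sy yb|exact: le_trans xy yb|].
      by rewrite distrC ger0_norm ?subr_ge0 // (le_lt_trans _ y2) // lerD2r.
    apply: hd1 => //; [exact: le_trans ax xs|exact: le_trans sy yb|exact: le_trans ax xy|].
    by rewrite ger0_norm ?subr_ge0 // (le_lt_trans _ y1) // lerD2l lerN2.
  (* The local estimate says that e K + E and e K - E are nondecreasing on short intervals, hence on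
     [a, b]. *)
  rewrite ler_norml; apply/andP; split.
    have := @nondecreasing_of_local (fun x => e * K x + E x) _ a b d0 ab.
    have h x y : a <= x -> x <= y -> y <= b -> y - x < Num.min d1 d2 ->
        e * K x + E x <= e * K y + E y.
      by move=> ax xy yb yx; have := loc x y ax xy yb yx; rewrite ler_norml; lra.
    by move=> /(_ h); lra.
  have := @nondecreasing_of_local (fun x => e * K x - E x) _ a b d0 ab.
  have h x y : a <= x -> x <= y -> y <= b -> y - x < Num.min d1 d2 ->
      e * K x - E x <= e * K y - E y.
    by move=> ax xy yb yx; have := loc x y ax xy yb yx; rewrite ler_norml; lra.
  by move=> /(_ h); lra.
apply/eqP; rewrite -normr_le0; apply/ler_addgt0Pr => e e0; rewrite add0r.
have K0 : 0 <= K b - K a.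
  rewrite hK //; apply: Rintegral_ge0 => x _; exact: addr_ge0.
have k1 : 0 < K b - K a + 1 by lra.
apply: le_trans (step _ (divr_gt0 e0 k1)) _.
by rewrite mulrAC ler_pdivrMr // ler_wpM2l ?(ltW e0) //; lra.
Qed.

End AbsolutelyContinuous.

(** * Weak derivatives *)

Section WeakDerivative.
Context {R : realType}.
Notation mu := (@lebesgue_measure R).
Implicit Types (f g h phi : R -> R) (a b c x y : R).
#[local] Hint Resolve measurable_segment : core.
Local Notation I a b g := (\int[mu]_(x in `[a, b]) g x).

Lemma ae_imply (P Q : R -> Prop) : (forall x, P x -> Q x) ->
  {ae mu, forall x, P x} -> {ae mu, forall x, Q x}.
Proof.
move=> h; apply: filterS; first exact: (ae_filter_ringOfSetsType mu).
by move=> x; exact: h.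
Qed.

Lemma ae_imply2 (P Q S : R -> Prop) : (forall x, P x -> Q x -> S x) ->
  {ae mu, forall x, P x} -> {ae mu, forall x, Q x} -> {ae mu, forall x, S x}.
Proof.
move=> h; apply: filterS2; first exact: (ae_filter_ringOfSetsType mu).
by move=> x; exact: h.
Qed.

Lemma ae_eq_map (j : R -> R -> R) f g : f = g %[ae mu] ->
  (fun x => j x (f x)) = (fun x => j x (g x)) %[ae mu].
Proof. by apply: ae_imply => x h _; rewrite h. Qed.

(** The real-valued form of [weak_derivative], which splits into real and imaginary parts because
    test functions are real. *)
Definition wd f g : Prop := forall phi, test_function phi ->
  \int[mu]_x (f x * derive1 (phi : R -> R^o) x) = - \int[mu]_x (g x * phi x).

Lemma test_continuous phi : test_function phi -> continuous phi.
Proof.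
move=> [hphi _] x; apply/differentiable_continuous/derivable1_diffP.
exact: (hphi 0%N).
Qed.

Lemma test_continuous_derive phi : test_function phi ->
  continuous (derive1 (phi : R -> R^o)).
Proof.
move=> [hphi _] x; apply/differentiable_continuous/derivable1_diffP.
exact: (hphi 1%N).
Qed.

Lemma test_ac phi : test_function phi -> ac phi (derive1 (phi : R -> R^o)).
Proof.
move=> hphi; apply: ac_derive; last exact: test_continuous_derive.
by move=> x; apply: smooth_is_derive; case: hphi.
Qed.

Lemma test_support phi : test_function phi -> exists2 M : R, 0 < M &
  forall x, M <= `|x| -> phi x = 0 /\ derive1 (phi : R -> R^o) x = 0.
Proof.
move=> [hphi [M hM]]; exists (`|M| + 1); first by have := normr_ge0 M; lra.
move=> x Mx; have M1 := ler_norm M; split; first by apply: hM; lra.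
rewrite derive1E.
have h : is_derive x (1 : R) phi 0.
  apply: (@near_eq_is_derive _ _ _ (cst 0)); near=> y; rewrite hM //.
  have : `|y - x| < 1.
    by near: y; exists 1 => //= y; rewrite /= distrC.
  have := ler_normD y (x - y); rewrite (_ : y + (x - y) = x); last by ring.
  rewrite (distrC x y); lra.
by case: h.
Unshelve. all: by end_near.
Qed.

Lemma Rintegral_support f a b : (forall x, ~~ (a <= x <= b) -> f x = 0) ->
  \int[mu]_x f x = I a b f.
Proof.
move=> h; rewrite [RHS]Rintegral_mkcond; apply: eq_Rintegral => x _.
rewrite patchE; case: ifPn => //; rewrite notin_setE /= in_itv /= => /negP.
exact: h.
Qed.

Lemma intbl_support f a b : mu.-integrable `[a, b] (EFin \o f) ->
  (forall x, ~~ (a <= x <= b) -> f x = 0) -> intbl mu f.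
Proof.
move=> hf h; have /(integrable_mkcond _ (measurable_segment a b)) := hf.
apply: eq_integrable => // x _ /=; rewrite patchE; case: ifPn => //.
by rewrite notin_setE /= in_itv /= => /negP/h ->.
Qed.

Lemma support_segment (M x : R) : ~~ (- M <= x <= M) -> M <= `|x|.
Proof. by rewrite -ler_norml -ltNge => /ltW. Qed.

Lemma test_mul_intbl f psi (M : R) : locint f -> continuous psi ->
  (forall x, M <= `|x| -> psi x = 0) -> intbl mu (fun x => f x * psi x).
Proof.
move=> hf cpsi hpsi.
apply: (intbl_support (a := - M) (b := M)); first by case: (locintM hf cpsi).
by move=> x /support_segment/hpsi ->; rewrite mulr0.
Qed.

Lemma wd_intbl f g phi : locint f -> locint g -> test_function phi ->
  intbl mu (fun x => f x * derive1 (phi : R -> R^o) x) /\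
  intbl mu (fun x => g x * phi x).
Proof.
move=> hf hg hphi; have [M _ hM] := test_support hphi.
split; apply: (test_mul_intbl (M := M)) => //.
- exact: test_continuous_derive.
- by move=> x /hM[].
- exact: test_continuous.
- by move=> x /hM[].
Qed.

(** The product with a test function is absolutely continuous and vanishes at both ends of a segment
    containing the support. *)
Lemma ac_wd f g : ac f g -> wd f g.
Proof.
move=> acf phi hphi; have cf := ac_continuous acf; have [lg _] := acf.
have [M M0 hM] := test_support hphi.
have [_ /(_ (- M) M)] := ac_mul acf (test_ac hphi).
have MM : - M <= M by lra.
move=> /(_ MM).
have [-> _] := hM M (ler_norm M).
have [-> _] : phi (- M) = 0 /\ _ := hM (- M) ltac:(by rewrite normrN ler_norm).
rewrite !mulr0 subrr => h.
have [i1 i2] := wd_intbl (continuous_locint cf) lg hphi.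
have : \int[mu]_x (g x * phi x + f x * derive1 (phi : R -> R^o) x) = 0.
  rewrite (Rintegral_support (a := - M) (b := M)) -?h //.
  by move=> x /support_segment/hM[-> ->]; rewrite !mulr0 addr0.
rewrite RintD //; lra.
Qed.

Lemma wd_lin c f f' g g' : locint f -> locint f' -> locint g -> locint g' ->
  wd f f' -> wd g g' ->
  wd (fun x => c * f x + g x) (fun x => c * f' x + g' x).
Proof.
move=> lf lf' lg lg' hf hg phi hphi.
have [i1 i2] := wd_intbl lf lf' hphi; have [i3 i4] := wd_intbl lg lg' hphi.
have e1 := RintD (intblZ c i1) i3; have e2 := RintD (intblZ c i2) i4.
rewrite !RintZ // hf // hg // in e1 e2.
rewrite (_ : (fun x => (c * f x + g x) * _) = fun x =>
  c * (f x * derive1 (phi : R -> R^o) x) + g x * derive1 (phi : R -> R^o) x);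
  last by apply/funext => x; ring.
rewrite (_ : (fun x => (c * f' x + g' x) * _) = fun x =>
  c * (f' x * phi x) + g' x * phi x); last by apply/funext => x; ring.
rewrite e1 e2; ring.
Qed.

Lemma wd_ae f g f2 g2 : locint f -> locint g -> locint f2 -> locint g2 ->
  f = f2 %[ae mu] -> g = g2 %[ae mu] -> wd f g -> wd f2 g2.
Proof.
move=> lf lg lf2 lg2 ef eg h phi hphi.
have [i1 i2] := wd_intbl lf lg hphi; have [i3 i4] := wd_intbl lf2 lg2 hphi.
have e1 := Rintegral_ae (intbl_measurable i1) (intbl_measurable i3)
  (ae_eq_map (fun x y => y * derive1 (phi : R -> R^o) x) ef).
have e2 := Rintegral_ae (intbl_measurable i2) (intbl_measurable i4)
  (ae_eq_map (fun x y => y * phi x) eg).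
by have := h phi hphi; rewrite e1 e2.
Qed.

Lemma locint_locally_integrable g : locint g -> locally_integrable setT g.
Proof.
move=> [mg ig]; split => //; first exact: openT.
move=> K _ cK.
have [M [_ hM]] := compact_bounded cK.
pose B := Num.max 0 M + 1.
have KB : K `<=` `[- B, B].
  move=> x Kx; rewrite /= in_itv /= -ler_norml; apply: hM => //.
  rewrite /B; have : M <= Num.max 0 M by rewrite le_max lexx orbT.
  lra.
have /integrableP[_] := ig (- B) B; apply: le_lt_trans.
apply: ge0_subset_integral => //.
- exact: compact_measurable.
- by do 2 apply: measurableT_comp => //; apply: measurable_funS mg.
Qed.

(** Lebesgue differentiation of the primitive based at -n, which is identically zero, gives the
    claim to the right of -n; countably many n cover the line. *)
Lemma ae_eq0_of_segments g : locint g -> (forall a b, a <= b -> I a b g = 0) ->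
  g = (fun=> 0) %[ae mu].
Proof.
move=> lg hI.
have key n : {ae mu, forall x, - n%:R < x -> g x = 0}.
  have := @FTC1 R g (BLeft (- n%:R)) (fun y => (proj2 lg) (- n%:R) y)
    (locint_locally_integrable lg).
  set F := fun x => _.
  have F0 : F = cst 0.
    apply/funext => x; rewrite /F /=; have [nx|xn] := leP (- n%:R) x; first exact: hI.
    by rewrite set_itv_ge ?Rintegral_set0 // bnd_simp -ltNge.
  apply: ae_imply => x h nx.
  have [|_ <-] := h; first by rewrite lte_fin.
  by rewrite F0 derive1_cst.
have : {ae mu, forall x n, - n%:R < x -> g x = 0} by apply/ae_foralln.
apply: ae_imply => x h _; apply: (h (Num.truncn `|x|).+1).
have := truncnS_gt `|x|; have := ler_norm (- x); rewrite normrN; lra.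
Qed.

(** The bumps tend to the indicator of ]a, b[ and are dominated by 1, so the integral of [g] over
    every segment is a limit of zeros. *)
Lemma du_bois_reymond g : locint g ->
  (forall phi, test_function phi -> \int[mu]_x (g x * phi x) = 0) ->
  g = (fun=> 0) %[ae mu].
Proof.
move=> lg h; apply: ae_eq0_of_segments => // a b ab.
have [mg ig] := lg.
have mO : measurable (`]a, b[ : set (measurableTypeR R)) by exact: measurable_itv.
have igO : mu.-integrable `]a, b[ (EFin \o g).
  apply: integrableS (ig a b) => //; apply: subset_itv; by rewrite bnd_simp.
have cl f : locint f -> \int[mu]_(x in `]a, b[) f x = I a b f.
  move=> [mf if_].
  have i1 : mu.-integrable `[a, b[ (EFin \o f).
    apply: integrableS (if_ a b) => //; apply: subset_itv; by rewrite bnd_simp.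
  rewrite Rintegral_itv_obnd_cbnd ?Rintegral_itv_bndo_bndc //.
  apply: integrableS (if_ a b) => //; apply: subset_itv; by rewrite bnd_simp.
have cb n : continuous (smooth_bump a b n).
  by apply: test_continuous; exact: test_function_smooth_bump.
have mb n : measurable_fun `]a, b[ (fun x => g x * smooth_bump a b n x).
  by apply: measurable_funS (proj1 (locintM lg (cb n))).
have i0 n : \int[mu]_(x in `]a, b[) (g x * smooth_bump a b n x) = 0.
  rewrite cl; last exact: locintM.
  rewrite -(Rintegral_support (a := a) (b := b)) ?h //; first exact: test_function_smooth_bump.
  move=> x xab; rewrite smooth_bump_out ?mulr0 //; apply: contra xab => /andP[].
  by move=> /ltW -> /ltW ->.
have ib n : mu.-integrable `]a, b[ (EFin \o (fun x => g x * smooth_bump a b n x)).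
  apply: integrableS (proj2 (locintM lg (cb n)) a b) => //.
  by apply: subset_itv; rewrite bnd_simp.
have [|||||_ _ lim] := @dominated_convergence _ _ _ mu `]a, b[ mO
  (fun n x => (g x * smooth_bump a b n x)%:E) (EFin \o g) (EFin \o (fun x => `|g x|)).
- by move=> n; exact: (measurable_int mu (ib n)).
- exact: (measurable_int mu igO).
- apply: aeW => x /=; rewrite in_itv /= => xab.
  apply: cvg_EFin; first by apply: nearW.
  have := @cvg_smooth_bump _ a b x ab; rewrite xab => hc.
  suff : (fun n => g x * smooth_bump a b n x) @ \oo --> g x * true%:R by rewrite mulr1.
  exact: cvgMr.
- exact: integrable_norm.
- apply: aeW => x n _ /=; rewrite lee_fin normrM ler_piMr //.
  by rewrite ger0_norm ?smooth_bump_ge0 ?smooth_bump_le1.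
rewrite -cl // /Rintegral.
have e0 : (fun n => \int[mu]_(x in `]a, b[) (g x * smooth_bump a b n x)%:E)%E = fun=> 0%E.
  apply/funext => n.
  rewrite -[LHS]fineK; first by congr EFin; exact: i0.
  exact: (integrable_fin_num mO (ib n)).
rewrite e0 in lim.
have l0 : (fun=> 0%E : \bar R) @ \oo --> (0%E : \bar R) by exact: cvg_cst.
have := cvg_unique (@ereal_hausdorff R) lim l0.
by move=> ->.
Qed.

Lemma wd_unique f g1 g2 : locint f -> locint g1 -> locint g2 ->
  wd f g1 -> wd f g2 -> g1 = g2 %[ae mu].
Proof.
move=> lf l1 l2 h1 h2.
have : (fun x => g1 x - g2 x) = (fun=> 0) %[ae mu].
  apply: du_bois_reymond; first exact: locintB.
  move=> phi hphi.
  have [i0 i1] := wd_intbl lf l1 hphi; have [_ i2] := wd_intbl lf l2 hphi.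
  rewrite (_ : (fun x => _) = fun x => g1 x * phi x - g2 x * phi x).
    by rewrite RintB //; have := h1 phi hphi; have := h2 phi hphi; lra.
  by apply/funext => x; ring.
by apply: ae_imply => x h _; apply/eqP; rewrite -subr_eq0; apply/eqP/h.
Qed.

Lemma ac_is_derive f g x : ac f g -> continuous g -> is_derive x (1 : R) f (g x).
Proof.
move=> [[mg ig] hf] cg.
have ax : x - 1 < x by lra.
have xu : x < x + 1 by lra.
have [d1 d2] := continuous_FTC1_closed xu (ig (x - 1) (x + 1)) ax (cg x).
have : is_derive x (1 : R) (fun y => f (x - 1) + I (x - 1) y g) (g x).
  rewrite -[g x]add0r; apply: is_derive_add.
  by rewrite derive1E in d2; exact: (DeriveDef d1 d2).
apply: near_eq_is_derive; near=> y.
rewrite -hf; first by ring.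
apply: ltW; near: y; exact: lt_nbhsr.
Unshelve. all: by end_near.
Qed.

(** A test function minus a suitable multiple of a fixed bump [p] has mean zero, hence is the
    derivative of a test function. So [f] pairs with [phi] as the constant [c] does, and du
    Bois-Reymond concludes. *)
Lemma wd0_cst f : locint f -> wd f (fun=> 0) -> exists c, f = (fun=> c) %[ae mu].
Proof.
move=> lf hf.
have m11 : -1 <= 1 :> R by lra.
pose p : R -> R := smooth_bump (-1) 1 0.
have tp : test_function p by exact: test_function_smooth_bump.
have [M0 M00 hM0] := test_support tp.
have int0 psi : test_function psi -> intbl mu psi.
  move=> tpsi; have [M _ hM] := test_support tpsi.
  have [_] := continuous_locint (test_continuous tpsi).
  move=> /(_ (- M) M) /intbl_support; apply.
  by move=> x /support_segment/hM[].
pose c0 := \int[mu]_x p x.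
(* A nonnegative bump of integral 0 would vanish almost everywhere, yet it is positive on ]-1, 1[,
   of measure 2. *)
have c00 : c0 != 0.
  apply/eqP => c0E.
  have h0 : {ae mu, forall x, p x = 0}.
    have := @ae_eq_integral_abs _ _ _ mu setT measurableT (EFin \o p)
      (measurable_int mu (int0 p tp)).
    case=> [+ _]; rewrite (_ : (\int[mu]_x `|(EFin \o p) x|)%E = c0%:E).
      rewrite c0E => /(_ erefl); apply: ae_imply => x h.
      by have [] := h Logic.I.
    rewrite /c0 /Rintegral fineK; last exact: integrable_fin_num (int0 p tp).
    by apply: eq_integral => x _ /=; rewrite ger0_norm // smooth_bump_ge0.
  have [N [mN N0 hN]] := h0.
  have sub : `]-1, 1[ `<=` N.
    move=> x; rewrite /= in_itv /= => /andP[x1 x2]; apply: hN => /=.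
    by apply/eqP; rewrite gt_eqF // smooth_bump_gt0.
  pose A : set (measurableTypeR R) := [set` `](-1 : R), (1 : R)[].
  have : (mu A <= mu N)%E.
    by apply: le_measure => //; rewrite inE //; exact: measurable_itv.
  have -> : mu A = _ := @lebesgue_measure_itv R `]-1, 1[.
  rewrite N0 /= lte_fin ifT; last by lra.
  by rewrite -EFinD lee_fin; lra.
pose c := (\int[mu]_x (f x * p x)) / c0.
exists c.
suff : (fun x => f x - c) = (fun=> 0) %[ae mu].
  by apply: ae_imply => x h _; have := h Logic.I; lra.
apply: du_bois_reymond.
  by apply: locintB => //; exact: continuous_locint (@continuous_cst _ c).
move=> phi tphi.
have [M M_gt0 hM] := test_support tphi.
pose K := Num.max M M0.
have hK x : K <= `|x| -> phi x = 0 /\ p x = 0.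
  by rewrite /K ge_max => /andP[/hM[-> _] /hM0[-> _]].
have K0 : 0 < K by rewrite /K lt_max M_gt0.
pose cphi := \int[mu]_x phi x.
pose theta x := phi x + (- (cphi / c0)) * p x.
have st : smooth theta by apply: smooth_lin; [case: tphi|case: tp].
have theta0 x : K <= `|x| -> theta x = 0.
  by rewrite /theta => /hK[-> ->]; rewrite mulr0 addr0.
have it : \int[mu]_x theta x = 0.
  rewrite /theta RintD ?RintZ -/cphi -/c0; [|exact: int0|exact: int0|].
    by field.
  by apply: intblZ; exact: int0.
have ct : continuous theta.
  move=> x; apply/differentiable_continuous/derivable1_diffP; exact: (st 0%N).
have [F acF _] := ac_exists (continuous_locint ct).
have [_ hF] := acF.
pose Phi x := F x - F (- K).
have dPhi x : is_derive x (1 : R) Phi (theta x).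
  rewrite -[theta x]addr0; apply: is_derive_add.
  exact: ac_is_derive.
have zero_out x y : x <= y -> (forall z, x <= z -> z <= y -> theta z = 0) ->
    F y = F x.
  move=> xy hz; apply/eqP; rewrite -subr_eq0 hF //.
  have -> : I x y theta = I x y (fun=> 0).
    by apply: eq_Rintegral => z; rewrite inE /= in_itv /= => /andP[]; exact: hz.
  by rewrite Rintegral_cst // mul0r.
(* The primitive from -K vanishes to the left of -K, and to the right of K because [theta] has mean
   zero. *)
have tPhi : test_function Phi.
  split; first exact: (smooth_antiderivative st dPhi).
  exists K => x Kx; rewrite /Phi.
  have [x0|x0] := leP 0 x.
    rewrite ger0_norm // in Kx.
    rewrite (@zero_out K x (ltW Kx)); last first.
      by move=> z z1 z2; apply: theta0; rewrite ger0_norm //; lra.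
    rewrite hF; last by lra.
    rewrite -(@Rintegral_support theta) ?it // => z /support_segment.
    exact: theta0.
  rewrite ltr0_norm // in Kx.
  rewrite (@zero_out x (- K)) ?subrr //; first by lra.
  by move=> z z1 z2; apply: theta0; rewrite ler0_norm; lra.
have dPhiE : derive1 (Phi : R -> R^o) = theta.
  by apply/funext => x; rewrite derive1E; case: (dPhi x).
have := hf Phi tPhi; rewrite dPhiE.
rewrite (_ : (fun x => 0 * Phi x) = fun=> 0); last by apply/funext => x; rewrite mul0r.
rewrite Rintegral_cst // mul0r oppr0.
have i1 : intbl mu (fun x => f x * phi x).
  by apply: (test_mul_intbl (M := M)) => //; [exact: test_continuous|move=> x /hM[]].
have i2 : intbl mu (fun x => f x * p x).
  by apply: (test_mul_intbl (M := M0)) => //; [exact: test_continuous|move=> x /hM0[]].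
rewrite (_ : (fun x => f x * theta x) =
  fun x => f x * phi x + (- (cphi / c0)) * (f x * p x)); last first.
  by apply/funext => x; rewrite /theta; ring.
rewrite RintD ?RintZ //; last exact: intblZ.
move=> h.
rewrite (_ : (fun x => (f x - c) * phi x) = fun x => f x * phi x + (- c) * phi x).
  rewrite RintD ?RintZ //; [|exact: int0|by apply: intblZ; exact: int0].
  rewrite -/cphi -[RHS]h /c; by field.
by apply/funext => x; ring.
Qed.

(** Subtracting a primitive of [g] leaves a function with zero weak derivative, which is almost
    everywhere constant. *)
Lemma wd_ac f g : locint f -> locint g -> wd f g ->
  exists2 F, ac F g & f = F %[ae mu].
Proof.
move=> lf lg h; have [G acG _] := ac_exists lg.
have lG := continuous_locint (ac_continuous acG).
have [c hc] : exists c, (fun x => (-1) * G x + f x) = (fun=> c) %[ae mu].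
  apply: wd0_cst; first by apply: locintD => //; exact: locintZ.
  have := wd_lin (-1) lG lg lf lg (ac_wd acG) h.
  by rewrite (_ : (fun x => _ + g x) = fun=> 0) //; apply/funext => x; ring.
exists (fun x => 1 * G x + c).
  apply: ac_ext (ac_lin 1 acG (ac_cst c)) => // x.
  by rewrite mul1r addr0.
by move: hc; apply: ae_imply => x hx _; have := hx Logic.I; lra.
Qed.

(* [u] tends to 0 at infinity: its oscillation there is small since [w] is
   integrable, and [u] is integrable itself. *)
Lemma ac_integral0 u w : ac u w -> intbl mu u -> intbl mu w -> \int[mu]_x w x = 0.
Proof.
move=> acu iu iw; apply/eqP; rewrite -normr_le0; apply/ler_addgt0Pr => e5 e50.
have arith (S X Y Z e : R) : S - e <= X -> 0 <= Y ->
    X + (Y + Z) <= S \/ Z + (Y + X) <= S -> Z <= e.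
  by clear => ? ? []; lra.
(* One [e] for the part of the integral outside [-n, n], and 2 e for the value of [u] at each
   endpoint. *)
rewrite add0r; pose e := e5 / 5; have e0 : 0 < e by rewrite divr_gt0.
have [n hn] := intbl_tail iw e0; have nn : - n%:R <= n%:R :> R.
  by rewrite ge0_cp // ler0n.
have iw' := intbl_norm iw; have lw' := intbl_locint iw'.
have lw := intbl_locint iw; have [_ hu] := acu.
have tail a b : a <= b -> n%:R <= a \/ b <= - n%:R -> I a b (fun x => `|w x|) <= e.
  move=> ab out; have pos c d : 0 <= I c d (fun x => `|w x|) by exact: Rintegral_ge0.
  case: out => out.
    have := segment_le_Rintegral (- n%:R) b iw' (fun x => normr_ge0 (w x)).
    rewrite (itv_int_cat lw' nn) ?(le_trans out ab) // (itv_int_cat lw' out ab).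
    by move=> h; apply: (arith _ _ _ _ _ hn (pos n%:R a)); left.
  have := segment_le_Rintegral a n%:R iw' (fun x => normr_ge0 (w x)).
  rewrite (itv_int_cat lw' ab) ?(le_trans out nn) // (itv_int_cat lw' out nn).
  by move=> h; apply: (arith _ _ _ _ _ hn (pos b (- n%:R))); right.
(* On an interval of length T where [u] oscillates by at most [e], a value above 2 e would keep |u|
   above [e] throughout and give it an integral of at least e T = K + 1. *)
pose K := \int[mu]_x `|u x|; pose T := (K + 1) / e.
have K0 : 0 <= K by exact: Rintegral_ge0.
have T0 : 0 < T by rewrite divr_gt0 // ltr_wpDl.
have small a x : n%:R <= a \/ a + T <= - n%:R -> a <= x -> x <= a + T -> `|u x| <= 2 * e.
  move=> out ax xb; have osc c d : a <= c -> c <= d -> d <= a + T -> `|u d - u c| <= e.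
    move=> ac_ cd db; rewrite hu //; apply: le_trans (itv_int_norm _ _ lw) _.
    by apply: tail => //; case: out => h; [left; apply: le_trans h ac_|right; apply: le_trans db h].
  have low y : a <= y -> y <= a + T -> `|u x| - e <= `|u y|.
    move=> ay yb; rewrite lerBlDl -lerBlDr; apply: le_trans (lerB_dist _ _) _.
    by have [xy|yx] := leP x y; [rewrite distrC; exact: osc|exact: osc (ltW yx) _].
  have : I a (a + T) (fun=> `|u x| - e) <= K.
    apply: le_trans (segment_le_Rintegral a (a + T) (intbl_norm iu) (fun z => normr_ge0 (u z))).
    by apply: itv_int_le low; [exact/continuous_locint/continuous_cst|exact/intbl_locint/intbl_norm].
  rewrite itv_int_cst ?lerDl ?(ltW T0) // [a + T]addrC addrK /T mulrA ler_pdivrMr //.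
  by move: K0 e0; clear; nra.
have u1 : `|u n%:R| <= 2 * e by apply: (small n%:R); rewrite ?lerDl ?(ltW T0) //; left.
have u2 : `|u (- n%:R)| <= 2 * e.
  by apply: (small (- n%:R - T)); rewrite ?subrK ?lerBlDr ?lerDl ?(ltW T0) //; right.
have [ir er] := segment_restrict_intbl (- n%:R) n%:R iw.
have [ir' er'] := segment_restrict_intbl (- n%:R) n%:R iw'.
have d : `|\int[mu]_x w x - I (- n%:R) n%:R w| <= e.
  apply: (@le_trans _ _ (\int[mu]_x `|w x| - I (- n%:R) n%:R (fun x => `|w x|))); last by rewrite lerBlDr addrC -lerBlDr.
  rewrite er er' -!RintB //; apply: Rint_norm_le; [exact: intblB|exact: intblB|] => x.
  by case: ifP => _; rewrite ?subrr ?normr0 // !subr0.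
rewrite -hu // in d; move: d u1 u2; rewrite !ler_norml /e; clear; lra.
Qed.

Lemma intbl_ae f g : measurable_fun setT g -> f = g %[ae mu] ->
  intbl mu f -> intbl mu g.
Proof.
move=> mg fg hf; have mf := intbl_measurable hf.
apply/integrableP; split; first exact/measurable_EFinP.
have /integrableP[_] := hf; apply: le_lt_trans.
rewrite le_eqVlt; apply/orP; left; apply/eqP; apply: ge0_ae_eq_integral => //.
- by do 2 apply: measurableT_comp => //.
- by do 2 apply: measurableT_comp => //.
- by move: fg; apply: ae_imply => x h _ /=; rewrite h.
Qed.

Lemma sqint_ae f g : measurable_fun setT g -> f = g %[ae mu] ->
  sqint mu f -> sqint mu g.
Proof.
move=> mg fg [mf hf]; split=> //; apply: intbl_ae hf; first exact: measurable_funX.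
exact: (ae_eq_map (fun _ y => y ^+ 2) fg).
Qed.

(** On absolutely continuous representatives the sum is the integral of (f g)'. Products of
    square-integrable functions are integrable, so [ac_integral0] applies to f g. *)
Lemma integral_derivative_product f f' g g' :
  sqint mu f -> sqint mu f' -> sqint mu g -> sqint mu g' ->
  wd f f' -> wd g g' ->
  \int[mu]_x (f' x * g x) + \int[mu]_x (f x * g' x) = 0.
Proof.
move=> sf sf' sg sg' hf hg.
have [F acF fF] := wd_ac (sqint_locint sf) (sqint_locint sf') hf.
have [G acG gG] := wd_ac (sqint_locint sg) (sqint_locint sg') hg.
have mF := continuous_measurable_fun (ac_continuous acF).
have mG := continuous_measurable_fun (ac_continuous acG).
have sF := sqint_ae mF fF sf; have sG := sqint_ae mG gG sg.
rewrite -RintD; [|exact: sqint_mul|exact: sqint_mul].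
have := ac_integral0 (ac_mul acF acG) (sqint_mul sF sG)
  (intblD (sqint_mul sf' sG) (sqint_mul sF sg')).
move=> <-; apply: Rintegral_ae.
- exact: (intbl_measurable (intblD (sqint_mul sf' sg) (sqint_mul sf sg'))).
- exact: (intbl_measurable (intblD (sqint_mul sf' sG) (sqint_mul sF sg'))).
- by move: fF gG; apply: ae_imply2 => x h1 h2 _ /=; rewrite (h1 Logic.I) (h2 Logic.I).
Qed.

End WeakDerivative.

(** * Closedness of the weak derivative in L^2 *)

Section WeakDerivativeClosed.
Context {R : realType}.
Notation mu := (@lebesgue_measure R).

Lemma test_sqint (phi : R -> R) : test_function phi ->
  sqint mu phi /\ sqint mu (derive1 (phi : R -> R^o)).
Proof.
move=> tphi; have c1 := test_continuous tphi.
have c2 := test_continuous_derive tphi.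
have [M _ hM] := test_support tphi.
split; split; try exact: continuous_measurable_fun.
  by apply: (test_mul_intbl (M := M) (continuous_locint c1) c1) => x /hM[].
by apply: (test_mul_intbl (M := M) (continuous_locint c2) c2) => x /hM[].
Qed.

(** For a fixed test function both sides are continuous in L^2, by Cauchy-Schwarz against [phi] and
    its derivative. *)
Lemma wd_closed (f g : nat -> R -> R) (F G : R -> R) :
  (forall n, sqint mu (f n)) -> (forall n, sqint mu (g n)) ->
  sqint mu F -> sqint mu G -> (forall n, wd (f n) (g n)) ->
  (forall e : R, 0 < e -> exists n, nrm2 mu (fun x => f n x - F x) <= e /\
     nrm2 mu (fun x => g n x - G x) <= e) ->
  wd F G.
Proof.
move=> hf hg hF hG hw hl phi tphi.
have [s0 s1] := test_sqint tphi.
set D := derive1 (phi : R -> R^o).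
apply/eqP; rewrite -subr_eq0 opprK -normr_le0; apply/ler_addgt0Pr => e e0.
rewrite add0r.
pose K := nrm2 mu D + nrm2 mu phi + 1.
have K0 : 0 < K by rewrite /K ltr_wpDl // addr_ge0 ?nrm2_ge0.
have [n [h1 h2]] := hl _ (divr_gt0 e0 K0).
have b1 := cauchy_schwarz (sqintB (hf n) hF) s1.
have b2 := cauchy_schwarz (sqintB (hg n) hG) s0.
have e1 : \int[mu]_x ((f n x - F x) * D x) =
    \int[mu]_x (f n x * D x) - \int[mu]_x (F x * D x).
  by rewrite -RintB; [under eq_Rintegral do rewrite mulrBl|exact: sqint_mul..].
have e2 : \int[mu]_x ((g n x - G x) * phi x) =
    \int[mu]_x (g n x * phi x) - \int[mu]_x (G x * phi x).
  by rewrite -RintB; [under eq_Rintegral do rewrite mulrBl|exact: sqint_mul..].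
have e3 := hw n phi tphi; rewrite -/D in e3.
have -> : \int[mu]_x (F x * D x) + \int[mu]_x (G x * phi x) =
  - (\int[mu]_x ((f n x - F x) * D x) + \int[mu]_x ((g n x - G x) * phi x)).
  by rewrite e1 e2 e3; ring.
rewrite normrN; apply: le_trans (ler_normD _ _) _.
apply: le_trans (lerD b1 b2) _.
apply: (@le_trans _ _ (e / K * nrm2 mu D + e / K * nrm2 mu phi)).
  by apply: lerD; rewrite ler_wpM2r ?nrm2_ge0.
rewrite -mulrDr mulrAC ler_pdivrMr // ler_wpM2l ?(ltW e0) //.
by rewrite /K lerDl ler01.
Qed.
End WeakDerivativeClosed.

(** * Complex-valued square-integrable functions and their weak derivatives *)

Section ComplexL2.
Context {R : realType}.
Notation mu := (@lebesgue_measure R).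
Local Notation Re := (@complex.Re R).
Local Notation Im := (@complex.Im R).
Implicit Types (f g h : cfun R) (a : R[i]).

Lemma cfun_Re_lin a f g x :
  Re ((a *: f + g) x) = (Re a * Re (f x) - Im a * Im (f x)) + Re (g x).
Proof.
change ((a *: f + g) x) with (a * f x + g x : R[i]).
by case: a (f x) (g x) => [? ?] [? ?] [? ?].
Qed.

Lemma cfun_Im_lin a f g x :
  Im ((a *: f + g) x) = (Re a * Im (f x) + Im a * Re (f x)) + Im (g x).
Proof.
change ((a *: f + g) x) with (a * f x + g x : R[i]).
by case: a (f x) (g x) => [? ?] [? ?] [? ?].
Qed.

Lemma inL2P f : inLp 2%:E f <->
  sqint mu (fun x => Re (f x)) /\ sqint mu (fun x => Im (f x)).
Proof.
by split=> -[h1 h2]; split; apply/Lfun2P.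
Qed.

Lemma inL2_lin a f g : inLp 2%:E f -> inLp 2%:E g -> inLp 2%:E (a *: f + g).
Proof.
move=> /inL2P[f1 f2] /inL2P[g1 g2]; apply/inL2P; split.
  under eq_fun do rewrite cfun_Re_lin.
  by apply: sqintD => //; apply: sqintB; exact: sqintZ.
under eq_fun do rewrite cfun_Im_lin.
by apply: sqintD => //; apply: sqintD; exact: sqintZ.
Qed.

Lemma inL2B f g : inLp 2%:E f -> inLp 2%:E g -> inLp 2%:E (f - g).
Proof. by move=> hf hg; have := inL2_lin (-1) hg hf; rewrite scaleN1r addrC. Qed.

Lemma cfun_Re_sub f g :
  (fun x => Re ((f - g) x)) = fun x => Re (f x) - Re (g x).
Proof.
apply/funext => x; change ((f - g) x) with (f x - g x : R[i]).
by case: (f x) (g x) => [? ?] [? ?].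
Qed.

Lemma cfun_Im_sub f g :
  (fun x => Im ((f - g) x)) = fun x => Im (f x) - Im (g x).
Proof.
apply/funext => x; change ((f - g) x) with (f x - g x : R[i]).
by case: (f x) (g x) => [? ?] [? ?].
Qed.

Lemma inL2_0 : inLp 2%:E (0 : cfun R).
Proof. by apply/inL2P; split; exact: sqint0. Qed.

Lemma inL2Z (a : R[i]) (f : cfun R) : inLp 2%:E f -> inLp 2%:E (a *: f).
Proof. by move=> hf; have := inL2_lin a hf inL2_0; rewrite addr0. Qed.

Lemma inL2D (f g : cfun R) : inLp 2%:E f -> inLp 2%:E g -> inLp 2%:E (f + g).
Proof. by move=> hf hg; have := inL2_lin 1 hf hg; rewrite scale1r. Qed.

Lemma normL2E f : inLp 2%:E f -> normL2 f ^+ 2 =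
  nrm2 mu (fun x => Re (f x)) ^+ 2 + nrm2 mu (fun x => Im (f x)) ^+ 2.
Proof.
move=> /inL2P[[m1 i1] [m2 i2]].
rewrite !nrm2_sqr -RintD // /normL2 unlock.
have e : (\int[mu]_x (`|(Normc.normc (f x))%:E| `^ 2))%E =
    (\int[mu]_x (Re (f x) ^+ 2 + Im (f x) ^+ 2))%:E.
  rewrite /Rintegral fineK; last by apply: integrable_fin_num => //; exact: intblD.
  apply: eq_integral => x _ /=.
  rewrite ger0_norm ?normc_ge0 // powR_mulrn ?normc_ge0 //.
  by case: (f x) => p q /=; rewrite sqr_sqrtr // addr_ge0 ?sqr_ge0.
rewrite e /= powR12_sqrt; last first.
  by apply: Rintegral_ge0 => x _; rewrite addr_ge0 ?sqr_ge0.
by rewrite sqr_sqrtr //; apply: Rintegral_ge0 => x _; rewrite addr_ge0 ?sqr_ge0.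
Qed.

Lemma normL2_ge0 f : 0 <= normL2 f.
Proof. by rewrite fine_ge0 // Lnorm_ge0. Qed.

Lemma normL2_sqrt f : inLp 2%:E f -> normL2 f = Num.sqrt
  (nrm2 mu (fun x => Re (f x)) ^+ 2 + nrm2 mu (fun x => Im (f x)) ^+ 2).
Proof. by move=> /normL2E <-; rewrite sqrtr_sqr ger0_norm ?normL2_ge0. Qed.

Lemma nrm2_Re_le f : inLp 2%:E f -> nrm2 mu (fun x => Re (f x)) <= normL2 f.
Proof.
move=> hf; rewrite -(ler_pXn2r (n := 2)) ?nnegrE ?nrm2_ge0 ?normL2_ge0 //.
by rewrite normL2E // lerDl sqr_ge0.
Qed.

Lemma nrm2_Im_le f : inLp 2%:E f -> nrm2 mu (fun x => Im (f x)) <= normL2 f.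
Proof.
move=> hf; rewrite -(ler_pXn2r (n := 2)) ?nnegrE ?nrm2_ge0 ?normL2_ge0 //.
by rewrite normL2E // lerDr sqr_ge0.
Qed.

(** The triangle inequality in the Euclidean plane, which carries bounds for components over to a
    norm of the form sqrt (x^2 + y^2). *)
Lemma ler_sqrt_add (a b c d : R) : 0 <= a -> 0 <= b -> 0 <= c -> 0 <= d ->
  Num.sqrt ((a + b) ^+ 2 + (c + d) ^+ 2) <=
  Num.sqrt (a ^+ 2 + c ^+ 2) + Num.sqrt (b ^+ 2 + d ^+ 2).
Proof.
move=> a0 b0 c0 d0.
have p0 : 0 <= a ^+ 2 + c ^+ 2 by rewrite addr_ge0 ?sqr_ge0.
have q0 : 0 <= b ^+ 2 + d ^+ 2 by rewrite addr_ge0 ?sqr_ge0.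
rewrite -(ler_pXn2r (n := 2)) ?nnegrE ?addr_ge0 ?sqrtr_ge0 //.
rewrite sqr_sqrtr ?addr_ge0 ?sqr_ge0 // [leRHS]sqrrD !sqr_sqrtr // -sqrtrM //.
have h : a * b + c * d <= Num.sqrt ((a ^+ 2 + c ^+ 2) * (b ^+ 2 + d ^+ 2)).
  have s0 : 0 <= a * b + c * d by rewrite addr_ge0 ?mulr_ge0.
  rewrite -[leLHS](ger0_norm s0) -sqrtr_sqr ler_wsqrtr //.
  have := sqr_ge0 (a * d - b * c); nra.
rewrite -mulr_natl; nra.
Qed.

Lemma normL2D f g : inLp 2%:E f -> inLp 2%:E g ->
  normL2 (f + g) <= normL2 f + normL2 g.
Proof.
move=> hf hg; rewrite !normL2_sqrt //; last exact: inL2D.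
have /inL2P[f1 f2] := hf; have /inL2P[g1 g2] := hg.
apply: le_trans (ler_sqrt_add _ _ _ _); rewrite ?nrm2_ge0 //.
have e1 : (fun x => Re ((f + g) x)) = fun x => Re (f x) + Re (g x).
  by apply/funext => x; change ((f + g) x) with (f x + g x : R[i]);
    case: (f x) (g x) => [? ?] [? ?].
have e2 : (fun x => Im ((f + g) x)) = fun x => Im (f x) + Im (g x).
  by apply/funext => x; change ((f + g) x) with (f x + g x : R[i]);
    case: (f x) (g x) => [? ?] [? ?].
rewrite e1 e2; apply: ler_wsqrtr.
by apply: lerD; rewrite ler_pXn2r ?nnegrE ?addr_ge0 ?nrm2_ge0 //; exact: nrm2D.
Qed.

Lemma normL2Z a f : inLp 2%:E f -> normL2 (a *: f) = Normc.normc a * normL2 f.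
Proof.
move=> hf; have hz := inL2Z a hf.
apply/eqP; rewrite -(eqrXn2 (n := 2)) ?mulr_ge0 ?normL2_ge0 ?normc_ge0 //.
rewrite exprMn !normL2E //.
have /inL2P[[_ i1] [_ i2]] := hf; have /inL2P[[_ i3] [_ i4]] := hz.
rewrite !nrm2_sqr -!RintD // -RintZ; last exact: intblD.
apply/eqP; apply: eq_Rintegral => x _.
change ((a *: f) x) with (a * f x : R[i]).
case: a (f x) {hz i3 i4} => [p q] [r s] /=.
by rewrite sqr_sqrtr ?addr_ge0 ?sqr_ge0 //; ring.
Qed.

Lemma normL2B (f g : cfun R) : inLp 2%:E f -> inLp 2%:E g ->
  normL2 (f - g) <= normL2 f + normL2 g.
Proof.
move=> hf hg; rewrite -scaleN1r; apply: le_trans (normL2D hf (inL2Z _ hg)) _.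
by rewrite normL2Z // normcN Normc.normc1 mul1r.
Qed.

Lemma ReIm_eq_ae f g : f = g %[ae mu] ->
  (fun x => Re (f x)) = (fun x => Re (g x)) %[ae mu] /\
  (fun x => Im (f x)) = (fun x => Im (g x)) %[ae mu].
Proof.
by move=> h; split; move: h; apply: ae_imply => x h xT; rewrite (h xT).
Qed.

Lemma normL2_ae f g : inLp 2%:E f -> inLp 2%:E g -> f = g %[ae mu] ->
  normL2 f = normL2 g.
Proof.
move=> hf hg /ReIm_eq_ae[e1 e2]; rewrite !normL2_sqrt //.
have /inL2P[[f1 _] [f2 _]] := hf; have /inL2P[[g1 _] [g2 _]] := hg.
by rewrite (nrm2_ae f1 g1 e1) (nrm2_ae f2 g2 e2).
Qed.

Lemma normL2_0 : normL2 (0 : cfun R) = 0.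
Proof. by rewrite -(scale0r 0) normL2Z ?Normc.normc0 ?mul0r //; exact: inL2_0. Qed.

Lemma inL2_complete (f : nat -> cfun R) : (forall n, inLp 2%:E (f n)) ->
  (forall e : R, 0 < e -> exists n0, forall n m, (n0 <= n)%N -> (n0 <= m)%N ->
     normL2 (f n - f m) <= e) ->
  exists2 h, inLp 2%:E h & forall e : R, 0 < e -> exists n0, forall n,
    (n0 <= n)%N -> normL2 (f n - h) <= e.
Proof.
move=> hf hC.
have [||p sp hp] := @sqint_complete _ _ _ mu (fun n x => Re (f n x)).
- by move=> n; have /inL2P[] := hf n.
- move=> e /hC[n0 hn0]; exists n0 => n m hn hm.
  apply: le_trans (hn0 n m hn hm); rewrite -cfun_Re_sub.
  by apply: nrm2_Re_le; exact: inL2B.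
have [||q sq hq] := @sqint_complete _ _ _ mu (fun n x => Im (f n x)).
- by move=> n; have /inL2P[] := hf n.
- move=> e /hC[n0 hn0]; exists n0 => n m hn hm.
  apply: le_trans (hn0 n m hn hm); rewrite -cfun_Im_sub.
  by apply: nrm2_Im_le; exact: inL2B.
have hh : inLp 2%:E ((fun x => Complex (p x) (q x)) : cfun R) by apply/inL2P.
exists (fun x => Complex (p x) (q x)) => // e e0.
have e2 : 0 < e / 2 by rewrite divr_gt0.
have [n1 h1] := hp _ e2; have [n2 h2] := hq _ e2.
exists (n1 + n2)%N => n hn.
rewrite normL2_sqrt; last exact: inL2B.
rewrite cfun_Re_sub cfun_Im_sub /=.
apply: le_trans (_ : Num.sqrt ((e / 2 + e / 2) ^+ 2) <= e); last first.
  by rewrite sqrtr_sqr -splitr gtr0_norm.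
apply: ler_wsqrtr.
have b1 := h1 n (leq_trans (leq_addr _ _) hn).
have b2 := h2 n (leq_trans (leq_addl _ _) hn).
rewrite sqrrD; apply: (@le_trans _ _ ((e / 2) ^+ 2 + (e / 2) ^+ 2)).
  by apply: lerD; rewrite ler_pXn2r ?nnegrE ?nrm2_ge0 ?(ltW e2).
by rewrite lerD2r lerDl mulrn_wge0 // mulr_ge0 // ltW.
Qed.

Lemma weak_derivativeP f g : weak_derivative f g <->
  wd (fun x => Re (f x)) (fun x => Re (g x)) /\
  wd (fun x => Im (f x)) (fun x => Im (g x)).
Proof.
have eR (u : cfun R) (psi : R -> R) :
    (fun x => Re (u x * Complex (psi x) 0)) = fun x => Re (u x) * psi x.
  by apply/funext => x; case: (u x) => p q /=; rewrite mulr0 subr0.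
have eI (u : cfun R) (psi : R -> R) :
    (fun x => Im (u x * Complex (psi x) 0)) = fun x => Im (u x) * psi x.
  by apply/funext => x; case: (u x) => p q /=; rewrite mulr0 add0r.
split=> [h|[h1 h2] phi tphi].
  by split=> phi tphi; have := h phi tphi; rewrite /cintegral;
    rewrite !eR !eI => -[].
have := h1 phi tphi; have := h2 phi tphi; rewrite /cintegral !eR !eI => -> ->.
by [].
Qed.

Lemma weak_derivative0 : weak_derivative (0 : cfun R) 0.
Proof. by apply/weak_derivativeP; split; exact: (ac_wd (ac_cst 0)). Qed.

(** [wderiv] is a choice with default 0; membership in H^1 says that there is something to
    choose. *)
Lemma inH1_wderiv f : inH1 f -> inLp 2%:E (wderiv f) /\ weak_derivative f (wderiv f).
Proof.
by move=> [_ [g hg]]; apply: (xgetPex 0 (P := [set g | inLp 2%:E g /\ weak_derivative f g]));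
   exists g.
Qed.

Lemma weak_derivative_unique f g h : inLp 2%:E f -> inLp 2%:E g -> inLp 2%:E h ->
  weak_derivative f g -> weak_derivative f h -> g = h %[ae mu].
Proof.
move=> /inL2P[f1 f2] /inL2P[g1 g2] /inL2P[h1 h2].
move=> /weak_derivativeP[w1 w2] /weak_derivativeP[w3 w4].
have := wd_unique (sqint_locint f2) (sqint_locint g2) (sqint_locint h2) w2 w4.
have := wd_unique (sqint_locint f1) (sqint_locint g1) (sqint_locint h1) w1 w3.
apply: ae_imply2 => x e1 e2 xT; apply/eqP.
by rewrite eq_complex (e1 xT) (e2 xT) !eqxx.
Qed.

Lemma wderiv_ae f g : inLp 2%:E f -> inLp 2%:E g -> weak_derivative f g ->
  inH1 f /\ wderiv f = g %[ae mu].
Proof.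
move=> hf hg fg; have h1 : inH1 f by split=> //; exists g.
have [hw fw] := inH1_wderiv h1.
by split=> //; exact: weak_derivative_unique fw fg.
Qed.

Lemma weak_derivative_lin a f f' g g' : inLp 2%:E f -> inLp 2%:E f' ->
  inLp 2%:E g -> inLp 2%:E g' -> weak_derivative f f' -> weak_derivative g g' ->
  weak_derivative (a *: f + g) (a *: f' + g').
Proof.
move=> /inL2P[f1 f2] /inL2P[f1' f2'] /inL2P[g1 g2] /inL2P[g1' g2'].
move=> /weak_derivativeP[w1 w2] /weak_derivativeP[w3 w4].
have [lf1 lf2] := (sqint_locint f1, sqint_locint f2).
have [lf1' lf2'] := (sqint_locint f1', sqint_locint f2').
have [lg1 lg2] := (sqint_locint g1, sqint_locint g2).
have [lg1' lg2'] := (sqint_locint g1', sqint_locint g2').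
apply/weak_derivativeP; split.
  have := wd_lin (Re a) lf1 lf1' (locintD (locintZ (- Im a) lf2) lg1)
    (locintD (locintZ (- Im a) lf2') lg1') w1 (wd_lin (- Im a) lf2 lf2' lg1 lg1' w2 w3).
  congr wd; apply/funext => x; rewrite cfun_Re_lin; ring.
have := wd_lin (Re a) lf2 lf2' (locintD (locintZ (Im a) lf1) lg2)
  (locintD (locintZ (Im a) lf1') lg2') w2 (wd_lin (Im a) lf1 lf1' lg2 lg2' w1 w4).
congr wd; apply/funext => x; rewrite cfun_Im_lin; ring.
Qed.

Lemma inH1_lin a f g : inH1 f -> inH1 g -> inH1 (a *: f + g) /\
  wderiv (a *: f + g) = a *: wderiv f + wderiv g %[ae mu].
Proof.
move=> hf hg; have [[lf _] [lg _]] := (hf, hg).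
have [f1 f2] := inH1_wderiv hf; have [g1 g2] := inH1_wderiv hg.
by apply: wderiv_ae; [exact: inL2_lin|exact: inL2_lin|exact: weak_derivative_lin].
Qed.

Lemma weak_derivative_ae f f2 g g2 : inLp 2%:E f -> inLp 2%:E f2 ->
  inLp 2%:E g -> inLp 2%:E g2 -> f = f2 %[ae mu] -> g = g2 %[ae mu] ->
  weak_derivative f g -> weak_derivative f2 g2.
Proof.
move=> /inL2P[a1 a2] /inL2P[b1 b2] /inL2P[c1 c2] /inL2P[d1 d2].
move=> /ReIm_eq_ae[e1 e2] /ReIm_eq_ae[e3 e4] /weak_derivativeP[w1 w2].
apply/weak_derivativeP; split.
  exact: wd_ae (sqint_locint a1) (sqint_locint c1) (sqint_locint b1)
    (sqint_locint d1) e1 e3 w1.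
exact: wd_ae (sqint_locint a2) (sqint_locint c2) (sqint_locint b2)
  (sqint_locint d2) e2 e4 w2.
Qed.

Lemma weak_derivative_closed (f g : nat -> cfun R) (F G : cfun R) :
  (forall n, inLp 2%:E (f n)) -> (forall n, inLp 2%:E (g n)) ->
  inLp 2%:E F -> inLp 2%:E G ->
  (forall n, weak_derivative (f n) (g n)) ->
  (forall e : R, 0 < e -> exists n, normL2 (f n - F) <= e /\ normL2 (g n - G) <= e) ->
  weak_derivative F G.
Proof.
move=> hf hg hF hG hw hl.
have /inL2P[F1 F2] := hF; have /inL2P[G1 G2] := hG.
apply/weak_derivativeP; split.
  apply: (@wd_closed R (fun n x => Re (f n x)) (fun n x => Re (g n x))) => //.
  - by move=> n; have /inL2P[] := hf n.
  - by move=> n; have /inL2P[] := hg n.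
  - by move=> n; have /weak_derivativeP[] := hw n.
  - move=> e /hl[n [h1 h2]]; exists n; split.
      by apply: le_trans h1; rewrite -cfun_Re_sub; exact/nrm2_Re_le/inL2B.
    by apply: le_trans h2; rewrite -cfun_Re_sub; exact/nrm2_Re_le/inL2B.
apply: (@wd_closed R (fun n x => Im (f n x)) (fun n x => Im (g n x))) => //.
- by move=> n; have /inL2P[] := hf n.
- by move=> n; have /inL2P[] := hg n.
- by move=> n; have /weak_derivativeP[] := hw n.
- move=> e /hl[n [h1 h2]]; exists n; split.
    by apply: le_trans h1; rewrite -cfun_Im_sub; exact/nrm2_Im_le/inL2B.
  by apply: le_trans h2; rewrite -cfun_Im_sub; exact/nrm2_Im_le/inL2B.
Qed.
End ComplexL2.

(** * The energy space and the Klein-Gordon group *)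

Section SeminormAlgebra.
Context {R : realType} (V : lmodType R[i]).

Lemma seminorm_hypot (p q : V -> R) : seminorm p -> seminorm q ->
  seminorm (fun u => Num.sqrt (p u ^+ 2 + q u ^+ 2)).
Proof.
move=> hp hq; split=> [u v|a u].
  apply: le_trans (ler_sqrt_add _ _ _ _); rewrite ?(seminorm_ge0 hp) ?(seminorm_ge0 hq) //.
  apply: ler_wsqrtr; apply: lerD; rewrite ler_pXn2r ?nnegrE ?addr_ge0
    ?(seminorm_ge0 hp) ?(seminorm_ge0 hq) //; [exact: (seminormD hp)|exact: (seminormD hq)].
rewrite (seminormZ hp) (seminormZ hq) !exprMn -mulrDr sqrtrM ?sqr_ge0 //.
by rewrite sqrtr_sqr ger0_norm ?normc_ge0.
Qed.

Lemma seminorm_scaled (c : R) (p : V -> R) : 0 <= c -> seminorm p ->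
  seminorm (fun u => c * p u).
Proof.
move=> c0 hp; split=> [u v|a u].
  by rewrite -mulrDr ler_wpM2l // (seminormD hp).
by rewrite (seminormZ hp) mulrCA.
Qed.

Lemma seminorm_add (p q : V -> R) : seminorm p -> seminorm q ->
  seminorm (fun u => p u + q u).
Proof.
move=> hp hq; split=> [u v|a u].
  by rewrite addrACA lerD // ?(seminormD hp) ?(seminormD hq).
by rewrite (seminormZ hp) (seminormZ hq) mulrDr.
Qed.
End SeminormAlgebra.

Section EnergySpace.
Context {R : realType}.
Notation mu := (@lebesgue_measure R).

Definition energy_pred : {pred state R} := fun u => `[< in_energy u >].

Lemma energy_predE (u : state R) : (u \in energy_pred) <-> in_energy u.
Proof. by split=> [/asboolP|h]; [|apply/asboolP]. Qed.

Lemma inH1_0 : inH1 (0 : cfun R).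
Proof.
split; first exact: inL2_0.
by exists 0; split; [exact: inL2_0|exact: weak_derivative0].
Qed.

Lemma in_energy_lin (a : R[i]) (u v : state R) :
  in_energy u -> in_energy v -> in_energy (a *: u + v).
Proof.
move=> [u1 u2] [v1 v2]; split; last exact: inL2_lin.
by have [] := inH1_lin a u1 v1.
Qed.

Lemma energy_submod_closed : GRing.submod_closed energy_pred.
Proof.
split; first by apply/energy_predE; split; [exact: inH1_0|exact: inL2_0].
move=> a u v /energy_predE hu /energy_predE hv; apply/energy_predE.
exact: in_energy_lin.
Qed.

HB.instance Definition _ :=
  GRing.isSubmodClosed.Build R[i] (state R) energy_pred energy_submod_closed.

(** The group is controlled only on states of finite energy. As a submodule of pairs of functions,
    they form a module over R[i] to which the abstract results apply. *)
Record energy_space := EnergySpace {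
  energy_val :> state R; energy_valP : energy_val \in energy_pred }.
HB.instance Definition _ := [isSub for energy_val].
HB.instance Definition _ := [Choice of energy_space by <:].
HB.instance Definition _ := [SubChoice_isSubLmodule of energy_space by <:].
End EnergySpace.
Arguments energy_space R : clear implicits.

Section EnergyNorm.
Context {R : realType}.
Notation mu := (@lebesgue_measure R).
Local Notation E := (energy_space R).
Local Notation pos u := (energy_val u).1.
Local Notation mom u := (energy_val u).2.
Local Notation Re := (@complex.Re R).
Local Notation Im := (@complex.Im R).
Implicit Types u v w : E.

Lemma energy_in u : in_energy (u : state R).
Proof. exact/energy_predE/energy_valP. Qed.

Definition to_energy (u : state R) (hu : in_energy u) : E :=
  EnergySpace (proj2 (energy_predE u) hu).

Definition pos_norm u : R := normL2 (pos u).
Definition der_norm u : R := normL2 (wderiv (pos u)).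
Definition mom_norm u : R := normL2 (mom u).
Definition energy_norm u : R := norm_energy u.

Lemma energy_fstD u v : pos (u + v) = pos u + pos v.
Proof. by []. Qed.
Lemma energy_sndD u v : mom (u + v) = mom u + mom v.
Proof. by []. Qed.
Lemma energy_fstZ (a : R[i]) u : pos (a *: u) = a *: pos u.
Proof. by []. Qed.
Lemma energy_sndZ (a : R[i]) u : mom (a *: u) = a *: mom u.
Proof. by []. Qed.

Lemma pos_seminorm : seminorm pos_norm.
Proof.
split=> [u v|a u]; rewrite /pos_norm.
  rewrite energy_fstD; apply: normL2D.
    by have [[]] := energy_in u.
  by have [[]] := energy_in v.
by rewrite energy_fstZ; apply: normL2Z; have [[]] := energy_in u.
Qed.

Lemma mom_seminorm : seminorm mom_norm.
Proof.
split=> [u v|a u]; rewrite /mom_norm.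
  rewrite energy_sndD; apply: normL2D.
    by have [] := energy_in u.
  by have [] := energy_in v.
by rewrite energy_sndZ; apply: normL2Z; have [] := energy_in u.
Qed.

Lemma energy_wderiv u : inLp 2%:E (wderiv (pos u)) /\
  weak_derivative (pos u) (wderiv (pos u)).
Proof. by apply: inH1_wderiv; have [] := energy_in u. Qed.

(** The chosen derivative is linear only almost everywhere, so linearity is stated at the level of
    the norm. *)
Lemma der_norm_lin (a : R[i]) u v :
  der_norm (a *: u + v) = normL2 (a *: wderiv (pos u) + wderiv (pos v)).
Proof.
have [hu _] := energy_in u; have [hv _] := energy_in v.
have [h1 h2] := inH1_lin a hu hv.
apply: normL2_ae h2; first by have [] := inH1_wderiv h1.
by apply: inL2_lin; [have [] := energy_wderiv u|have [] := energy_wderiv v].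
Qed.

Lemma der_seminorm : seminorm der_norm.
Proof.
(* [wderiv 0] is some function vanishing almost everywhere; its norm has to be discarded explicitly
   when homogeneity is deduced from the linear formula with second term 0. *)
have z : der_norm 0 = 0.
  have [h1 h2] := wderiv_ae inL2_0 inL2_0 (weak_derivative0 (R := R)).
  rewrite -(@normL2_0 R); apply: normL2_ae h2.
    by have [] := inH1_wderiv h1.
  exact: inL2_0.
split=> [u v|a u].
  have := der_norm_lin 1 u v; rewrite !scale1r => ->.
  by apply: normL2D; [have [] := energy_wderiv u|have [] := energy_wderiv v].
have hu := proj1 (energy_wderiv u); have h0 := proj1 (energy_wderiv 0).
have hau := inL2Z a hu.
have := der_norm_lin a u 0; rewrite addr0 => e.
rewrite /der_norm -normL2Z //; apply/eqP; rewrite eq_le; apply/andP; split.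
  by rewrite -/(der_norm _) e; apply: le_trans (normL2D hau h0) _; rewrite -/(der_norm 0) z addr0.
have -> : a *: wderiv (pos u) =
    (a *: wderiv (pos u) + wderiv (pos (0 : E))) - wderiv (pos (0 : E)).
  by rewrite addrK.
rewrite -/(der_norm (a *: u)) e.
have hs := inL2_lin a hu h0.
by apply: le_trans (normL2B hs h0) _; rewrite -/(der_norm 0) z addr0.
Qed.

Lemma energy_seminorm : seminorm energy_norm.
Proof.
apply: seminorm_add mom_seminorm.
exact: seminorm_hypot pos_seminorm der_seminorm.
Qed.

Lemma le_hypot_l (x y : R) : 0 <= x -> x <= Num.sqrt (x ^+ 2 + y ^+ 2).
Proof.
by move=> x0; rewrite -{1}(ger0_norm x0) -sqrtr_sqr ler_wsqrtr // lerDl sqr_ge0.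
Qed.

Lemma le_hypot_r (x y : R) : 0 <= y -> y <= Num.sqrt (x ^+ 2 + y ^+ 2).
Proof. by rewrite addrC; exact: le_hypot_l. Qed.

Lemma hypot_le (x y : R) : 0 <= x -> 0 <= y -> Num.sqrt (x ^+ 2 + y ^+ 2) <= x + y.
Proof.
move=> x0 y0; rewrite -[leRHS](ger0_norm (addr_ge0 x0 y0)) -sqrtr_sqr.
by apply: ler_wsqrtr; rewrite sqrrD addrAC lerDl mulrn_wge0 // mulr_ge0.
Qed.

Lemma pos_le u : pos_norm u <= energy_norm u.
Proof.
apply: le_trans (le_hypot_l (der_norm u) (normL2_ge0 _)) _.
by rewrite /energy_norm /norm_energy lerDl normL2_ge0.
Qed.

Lemma der_le u : der_norm u <= energy_norm u.
Proof.
apply: le_trans (le_hypot_r (pos_norm u) (normL2_ge0 _)) _.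
by rewrite /energy_norm /norm_energy lerDl normL2_ge0.
Qed.

Lemma mom_le u : mom_norm u <= energy_norm u.
Proof. by rewrite /energy_norm /norm_energy lerDr sqrtr_ge0. Qed.

Lemma energy_le u : energy_norm u <= pos_norm u + der_norm u + mom_norm u.
Proof. by rewrite lerD2r; apply: hypot_le; exact: normL2_ge0. Qed.

Lemma energy_null w : pos w = 0 %[ae mu] ->
  mom w = 0 %[ae mu] -> energy_norm w = 0.
Proof.
move=> h1 h2; have [[w1 _] w2] := energy_in w; have [w3 w4] := energy_wderiv w.
apply/eqP; rewrite eq_le (seminorm_ge0 energy_seminorm) andbT.
apply: le_trans (energy_le w) _.
have -> : pos_norm w = 0.
  by rewrite -(@normL2_0 R); apply: normL2_ae h1 => //; exact: inL2_0.
have -> : mom_norm w = 0.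
  by rewrite -(@normL2_0 R); apply: normL2_ae h2 => //; exact: inL2_0.
rewrite addr0 add0r /der_norm.
rewrite (normL2_ae w3 (inL2_0 (R := R))) ?normL2_0 //.
apply: (weak_derivative_unique (f := 0) (inL2_0 (R := R)) w3 (inL2_0 (R := R))).
  by apply: (weak_derivative_ae w1 (inL2_0 (R := R)) w3 w3 h1 _ w4); exact: ae_eq_refl.
exact: weak_derivative0.
Qed.

Lemma energy_eq u v : eq_energy u v -> energy_norm (u - v) = 0.
Proof.
move=> [h1 h2]; apply: energy_null.
  move: h1; apply: ae_imply => x hx xT.
  change (pos u x - pos v x = 0 :> R[i]).
  by rewrite (hx xT) subrr.
move: h2; apply: ae_imply => x hx xT.
change (mom u x - mom v x = 0 :> R[i]).
by rewrite (hx xT) subrr.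
Qed.

(** Positions, their derivatives and momenta converge separately in L^2, and closedness of the weak
    derivative ties the first two limits together. *)
Lemma energy_complete : seminorm_complete energy_norm.
Proof.
move=> u hu.
have sB n m : wderiv ((u n - u m : E) : state R).1 =
    wderiv (pos (u n)) - wderiv (pos (u m)) %[ae mu].
  have [h1 _] := energy_in (u n); have [h2 _] := energy_in (u m).
  have [_] := inH1_lin (-1) h2 h1.
  by rewrite !scaleN1r addrC [X in _ = X %[ae _]]addrC.
have dB n m : der_norm (u n - u m) =
    normL2 (wderiv (pos (u n)) - wderiv (pos (u m))).
  apply: normL2_ae (sB n m); first by have [] := energy_wderiv (u n - u m).
  by apply: inL2B; [have [] := energy_wderiv (u n)|have [] := energy_wderiv (u m)].
have [||psi hpsi lpsi] := @inL2_complete R (fun n => pos (u n)).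
- by move=> n; have [[]] := energy_in (u n).
- move=> e /hu[n0 hn0]; exists n0 => n m hn hm.
  exact: le_trans (pos_le (u n - u m)) (hn0 n m hn hm).
have [||g hg lg] := @inL2_complete R (fun n => wderiv (pos (u n))).
- by move=> n; have [] := energy_wderiv (u n).
- move=> e /hu[n0 hn0]; exists n0 => n m hn hm.
  by rewrite -dB; exact: le_trans (der_le (u n - u m)) (hn0 n m hn hm).
have [||pi hpi lpi] := @inL2_complete R (fun n => mom (u n)).
- by move=> n; have [] := energy_in (u n).
- move=> e /hu[n0 hn0]; exists n0 => n m hn hm.
  exact: le_trans (mom_le (u n - u m)) (hn0 n m hn hm).
have wg : weak_derivative psi g.
  apply: (weak_derivative_closed (f := fun n => pos (u n))
    (g := fun n => wderiv (pos (u n)))) => //.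
  - by move=> n; have [[]] := energy_in (u n).
  - by move=> n; have [] := energy_wderiv (u n).
  - by move=> n; have [] := energy_wderiv (u n).
  - move=> e e0; have [n1 h1] := lpsi e e0; have [n2 h2] := lg e e0.
    by exists (n1 + n2)%N; split; [apply: h1; exact: leq_addr|apply: h2; exact: leq_addl].
have [psiH psig] := wderiv_ae hpsi hg wg.
have hl : in_energy (psi, pi) by split.
exists (to_energy hl) => e e0.
have e3 : 0 < e / 3 by rewrite divr_gt0.
have [n1 h1] := lpsi _ e3; have [n2 h2] := lg _ e3; have [n3 h3] := lpi _ e3.
exists (n1 + n2 + n3)%N => n hn.
apply: le_trans (energy_le _) _.
have b1 : pos_norm (u n - to_energy hl) <= e / 3.
  apply: h1; apply: leq_trans hn; rewrite -addnA; exact: leq_addr.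
have b3 : mom_norm (u n - to_energy hl) <= e / 3.
  by apply: h3; apply: leq_trans hn; exact: leq_addl.
have b2 : der_norm (u n - to_energy hl) <= e / 3.
  have hn2 : (n2 <= n)%N.
    by apply: leq_trans hn; rewrite addnAC; exact: leq_addl.
  apply: le_trans (h2 n hn2).
  have -> : u n - to_energy hl = (-1) *: to_energy hl + u n by rewrite scaleN1r addrC.
  rewrite der_norm_lin.
  have c1 := proj1 (energy_wderiv (to_energy hl)).
  have c2 := proj1 (energy_wderiv (u n)).
  rewrite (normL2_ae (inL2_lin (-1) c1 c2) (inL2B c2 hg)) //.
  move: psig; apply: ae_imply => x hx xT.
  change (-1 * wderiv psi x + wderiv (pos (u n)) x =
    wderiv (pos (u n)) x - g x :> R[i]).
  by rewrite (hx xT) mulN1r addrC.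
lra.
Qed.
End EnergyNorm.

(** * Conservation of energy and uniform boundedness of the group *)

Section KleinGordonGroup.
Context {R : realType}.
Notation mu := (@lebesgue_measure R).
Local Notation E := (energy_space R).
Local Notation pos u := (energy_val u).1.
Local Notation mom u := (energy_val u).2.
Local Notation Re := (@complex.Re R).
Local Notation Im := (@complex.Im R).

(** The real part of the L^2 inner product, which is the cross term of the squared norm along a real
    parameter. *)
Definition dotL2 (f g : cfun R) : R :=
  \int[mu]_x (Re (f x) * Re (g x)) + \int[mu]_x (Im (f x) * Im (g x)).

Lemma nrm2_sqr_lin (h : R) (f g : R -> R) : sqint mu f -> sqint mu g ->
  nrm2 mu (fun x => h * g x + f x) ^+ 2 =
  nrm2 mu f ^+ 2 + 2 * h * \int[mu]_x (f x * g x) + h ^+ 2 * nrm2 mu g ^+ 2.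
Proof.
move=> hf hg; have hfg := sqint_mul hf hg; have [_ f2] := hf; have [_ g2] := hg.
have hs := sqintD (sqintZ h hg) hf.
rewrite !nrm2_sqr //.
rewrite -(RintZ (2 * h)) // -(RintZ (h ^+ 2)) // -RintD //; last exact: intblZ.
rewrite -RintD; [|by apply: intblD => //; exact: intblZ|exact: intblZ].
by congr Rintegral; apply/funext => x; ring.
Qed.

Lemma normL2_sqr_lin (h : R) (f g : cfun R) : inLp 2%:E f -> inLp 2%:E g ->
  normL2 (h%:c *: g + f) ^+ 2 =
  normL2 f ^+ 2 + 2 * h * dotL2 f g + h ^+ 2 * normL2 g ^+ 2.
Proof.
move=> hf hg; rewrite !normL2E //; last exact: inL2_lin.
have /inL2P[f1 f2] := hf; have /inL2P[g1 g2] := hg.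
have -> : (fun x => Re ((h%:c *: g + f) x)) = fun x => h * Re (g x) + Re (f x).
  by apply/funext => x; rewrite cfun_Re_lin /= mul0r subr0.
have -> : (fun x => Im ((h%:c *: g + f) x)) = fun x => h * Im (g x) + Im (f x).
  by apply/funext => x; rewrite cfun_Im_lin /= mul0r addr0.
rewrite (nrm2_sqr_lin h f1 g1) (nrm2_sqr_lin h f2 g2) /dotL2 mulrDr.
move: (nrm2 _ _) (nrm2 _ _) (nrm2 _ _) (nrm2 _ _) (Rintegral _ _ _) (Rintegral _ _ _) => *.
ring.
Qed.

(** With chi = pi and sigma = D' - k psi the mass terms cancel, and what remains is the integral of
    (D chi)', which is zero. *)
Lemma skew_identity (k : R) (psi D D' chi chi' pi sigma : R -> R) :
  sqint mu psi -> sqint mu D -> sqint mu D' -> sqint mu chi -> sqint mu chi' ->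
  sqint mu pi -> sqint mu sigma -> wd D D' -> wd chi chi' ->
  chi = pi %[ae mu] -> sigma = (fun x => D' x - k * psi x) %[ae mu] ->
  \int[mu]_x (D x * chi' x) + k * \int[mu]_x (psi x * chi x) +
  \int[mu]_x (pi x * sigma x) = 0.
Proof.
move=> h1 h2 h3 h4 h5 h6 h7 w1 w2 e1 e2.
have -> : \int[mu]_x (pi x * sigma x) =
    \int[mu]_x (D' x * chi x) - k * \int[mu]_x (psi x * chi x).
  have i1 := sqint_mul h1 h4; have i2 := sqint_mul h3 h4.
  rewrite -(RintZ k i1) -(RintB i2 (intblZ k i1)).
  have i3 := intblB i2 (intblZ k i1).
  apply: Rintegral_ae; [exact: intbl_measurable (sqint_mul h6 h7)|exact: intbl_measurable i3|].
  move: e1 e2; apply: ae_imply2 => x a b xT; rewrite -(a xT) (b xT); ring.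
have := integral_derivative_product h2 h3 h4 h5 w1 w2; lra.
Qed.

Context (m : R) (m_gt0 : 0 < m) (W0 : R -> state R -> state R).
Context (W0_group : KG_group m W0).

Definition energy_group (t : R) (u : E) : E :=
  to_energy (C0_group_stable W0_group.1 t (energy_in u)).

Lemma energy_group_seminormed : seminormed_group energy_norm energy_group.
Proof.
have [hC _] := W0_group; split.
- move=> t a u v; apply: energy_eq.
  exact: (C0_group_linear hC t a (energy_in u) (energy_in v)).
- move=> t; have [C h] := C0_group_bounded hC t; exists C => u.
  exact: (h _ (energy_in u)).
- by move=> u; apply: energy_eq; exact: (C0_group_0 hC (energy_in u)).
- by move=> s t u; apply: energy_eq; exact: (C0_group_D hC s t (energy_in u)).
- move=> u e e0; have := C0_group_continuous hC (energy_in u).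
  move=> /cvgrPdist_le /(_ e e0) [d /= d0 hd]; exists d => // h hh.
  have := hd h; rewrite /ball /= sub0r normrN => /(_ hh).
  by rewrite sub0r normrN; apply: le_trans; exact: ler_norm.
Qed.

(** Multiplying the difference quotient by |h| turns the limit in [generator] into the estimate in
    [generates]. *)
Lemma generatesP (u v : E) : generates energy_norm energy_group u v <->
  @KG_domain R u /\ eq_energy v (KG_operator m u).
Proof.
have [_ hG] := W0_group; have hN := @energy_seminorm R.
have hs := energy_group_seminormed.
have quo (h : R) : h != 0 ->
    energy_norm (h^-1%:c *: (energy_group h u - u) - v) =
    `|h|^-1 * energy_norm (energy_group h u - u - h%:c *: v).
  move=> h0; rewrite -normfV -(seminormZr hN) (scalerBr _ (energy_group h u - u)) scalerA.
  have -> : h^-1%:c * h%:c = 1 :> R[i] by rewrite -rmorphM mulVf.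
  by rewrite scale1r.
have key : generates energy_norm energy_group u v <->
    (norm_energy (Complex h^-1 0 *: (W0 h (energy_val u) - energy_val u) - energy_val v) @[h --> (0 : R)^'] --> (0 : R)).
  split.
    move=> hu; apply/cvgrPdist_le => e e0; have [d d0 hd] := hu e e0.
    exists d => //= h hh h0.
    have n0 : h != 0 by [].
    rewrite sub0r normrN.
    have -> : norm_energy (Complex h^-1 0 *: (W0 h (energy_val u) - energy_val u) - energy_val v) =
      energy_norm (h^-1%:c *: (energy_group h u - u) - v) by [].
    rewrite ger0_norm ?(seminorm_ge0 hN) // quo // mulrC ler_pdivrMr ?normr_gt0 //.
    by apply: hd; move: hh; rewrite /ball /= sub0r normrN.
  move=> /cvgrPdist_le hu e e0; have [d /= d0 hd] := hu e e0.
  exists d => // h hh; have [->|n0] := eqVneq h 0.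
    rewrite normr0 mulr0 rmorph0 scale0r subr0.
    by rewrite (group_0 hs).
  have := hd h; rewrite /ball /= sub0r normrN => /(_ hh n0).
  rewrite sub0r normrN.
  have -> : norm_energy (Complex h^-1 0 *: (W0 h (energy_val u) - energy_val u) - energy_val v) =
    energy_norm (h^-1%:c *: (energy_group h u - u) - v) by [].
  rewrite ger0_norm ?(seminorm_ge0 hN) // quo //.
  by rewrite mulrC ler_pdivrMr ?normr_gt0.
apply: iff_trans key _.
exact: (hG u v (energy_in u) (energy_in v)).
Qed.

(** Its square is the Klein-Gordon energy, the sum of the squared L^2 norms of psi', m psi and pi.
    For m > 0 it is equivalent to the energy norm. *)
Definition KG_norm (u : E) : R :=
  Num.sqrt (Num.sqrt (der_norm u ^+ 2 + (m * pos_norm u) ^+ 2) ^+ 2 + mom_norm u ^+ 2).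

Lemma KG_seminorm : seminorm KG_norm.
Proof.
apply: seminorm_hypot (mom_seminorm (R := R)).
apply: seminorm_hypot (der_seminorm (R := R)) _.
exact: seminorm_scaled (ltW m_gt0) (pos_seminorm (R := R)).
Qed.

Lemma KG_norm_sqr u :
  KG_norm u ^+ 2 = der_norm u ^+ 2 + m ^+ 2 * pos_norm u ^+ 2 + mom_norm u ^+ 2.
Proof.
by rewrite sqr_sqrtr ?addr_ge0 ?sqr_ge0 // sqr_sqrtr ?addr_ge0 ?sqr_ge0 // exprMn.
Qed.

Lemma KG_norm_le u : KG_norm u <= (2 + m) * energy_norm u.
Proof.
have p0 : 0 <= pos_norm u by exact: normL2_ge0.
have p1 : 0 <= der_norm u by exact: normL2_ge0.
have p2 : 0 <= mom_norm u by exact: normL2_ge0.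
apply: le_trans (hypot_le (sqrtr_ge0 _) p2) _.
have hq := hypot_le p1 (mulr_ge0 (ltW m_gt0) p0).
have q0 := pos_le u; have q1 := der_le u; have q2 := mom_le u.
have q3 := ler_wpM2l (ltW m_gt0) q0.
move: q3 hq q1 q2; rewrite mulrDl; lra.
Qed.

Lemma le_KG_norm u : energy_norm u <= (m^-1 + 2) * KG_norm u.
Proof.
have p0 : 0 <= pos_norm u by exact: normL2_ge0.
have p1 : 0 <= der_norm u by exact: normL2_ge0.
have p2 : 0 <= mom_norm u by exact: normL2_ge0.
apply: le_trans (energy_le u) _.
have h0 := le_hypot_l (mom_norm u) (sqrtr_ge0 (der_norm u ^+ 2 + (m * pos_norm u) ^+ 2)).
have h1 := le_hypot_l (m * pos_norm u) p1.
have h2 := le_hypot_r (der_norm u) (mulr_ge0 (ltW m_gt0) p0).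
have h3 := le_hypot_r (Num.sqrt (der_norm u ^+ 2 + (m * pos_norm u) ^+ 2)) p2.
rewrite -/(KG_norm u) in h0 h3.
have h4 : pos_norm u <= m^-1 * KG_norm u.
  by rewrite mulrC ler_pdivlMr // mulrC; exact: le_trans h2 h0.
move: h4 (le_trans h1 h0) h3; rewrite mulrDl; lra.
Qed.

(* Conservation of energy at the infinitesimal level. *)
Lemma KG_norm_generates (w v : E) (h : R) : generates energy_norm energy_group w v ->
  KG_norm (w + h%:c *: v) ^+ 2 = KG_norm w ^+ 2 + h ^+ 2 * KG_norm v ^+ 2.
Proof.
move=> /generatesP[[[_ hD] _] [e1 e2]].
have [[[hpsi _] hpi] [[hchi _] hsi]] := (energy_in w, energy_in v).
have [hE wE] := energy_wderiv v; have [hd _] := energy_wderiv w.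
have [hD' wD] := inH1_wderiv hD.
rewrite addrC !KG_norm_sqr der_norm_lin /pos_norm /mom_norm energy_fstD energy_sndD
  energy_fstZ energy_sndZ !normL2_sqr_lin // -/(der_norm w) -/(der_norm v).
(* The coefficient of 2 h in the expanded energy; it vanishes by the skew identity for real and
   imaginary parts. *)
have key : dotL2 (wderiv (pos w)) (wderiv (pos v)) +
    m ^+ 2 * dotL2 (pos w) (pos v) +
    dotL2 (mom w) (mom v) = 0.
  move/inL2P: hpsi => [p1 p2]; move/inL2P: hpi => [q1 q2].
  move/inL2P: hchi => [c1 c2]; move/inL2P: hsi => [s1 s2].
  move/inL2P: hE => [E1 E2]; move/inL2P: hd => [d1 d2]; move/inL2P: hD' => [D1 D2].
  move/weak_derivativeP: wE => [wE1 wE2]; move/weak_derivativeP: wD => [wD1 wD2].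
  have [a1 a2] := ReIm_eq_ae e1; have [b1 b2] := ReIm_eq_ae e2.
  have [eR eI] := (cfun_Re_lin (- Complex (m ^+ 2) 0) (pos w)
      (wderiv (wderiv (pos w))), cfun_Im_lin (- Complex (m ^+ 2) 0)
      (pos w) (wderiv (wderiv (pos w)))).
  have iR := skew_identity (k := m ^+ 2) p1 d1 D1 c1 E1 q1 s1 wD1 wE1 a1.
  have iI := skew_identity (k := m ^+ 2) p2 d2 D2 c2 E2 q2 s2 wD2 wE2 a2.
  rewrite /dotL2 mulrDr.
  rewrite [LHS](_ : _ = 0 + 0); first by rewrite addr0.
  rewrite -{1}iR; last first.
    move: b1; apply: ae_imply => x a xT; rewrite (a xT).
    by have := eR x; rewrite scaleNr addrC => ->; rewrite /=; ring.
  rewrite -iI; last first.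
    move: b2; apply: ae_imply => x a xT; rewrite (a xT).
    by have := eI x; rewrite scaleNr addrC => ->; rewrite /=; ring.
  ring.
rewrite [LHS](_ : _ = 2 * h * (dotL2 (wderiv (pos w)) (wderiv (pos v)) +
    m ^+ 2 * dotL2 (pos w) (pos v) +
    dotL2 (mom w) (mom v)) + (der_norm w ^+ 2 + m ^+ 2 * normL2 (pos w) ^+ 2 +
    normL2 (mom w) ^+ 2 + h ^+ 2 * (der_norm v ^+ 2 + m ^+ 2 * normL2 (pos v) ^+ 2 +
    normL2 (mom v) ^+ 2))); last ring.
by rewrite key mulr0 add0r.
Qed.

Lemma energy_group_bounded : exists2 M : R, 0 <= M &
  forall t u, energy_norm (energy_group t u) <= M * energy_norm u.
Proof.
have c1 : 0 <= 2 + m by rewrite addr_ge0 // ltW.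
have c2 : 0 <= m^-1 + 2 by rewrite addr_ge0 // invr_ge0 ltW.
exists ((m^-1 + 2) * (2 + m)); first exact: mulr_ge0.
apply: (group_uniformly_bounded (@energy_seminorm R) (@energy_complete R)
  energy_group_seminormed KG_seminorm c1 c2 KG_norm_le le_KG_norm).
exact: KG_norm_generates.
Qed.
End KleinGordonGroup.

(** * The resolvent *)

Section DampedSystem.
Context {R : realType}.
Notation mu := (@lebesgue_measure R).
Local Notation I a b g := (\int[mu]_(x in `[a, b]) g x).

(* For [k > 0] the primitive vanishing at [+oo], for [k < 0] the one vanishing
   at [-oo]. *)
Lemma decaying_primitive (k : R) (Phi w : R -> R) : k != 0 ->
  measurable_fun setT Phi -> locint Phi -> intbl mu w ->
  (forall y, `|Phi y| <= expR (- (k * y)) * w y) ->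
  exists2 T, ac T (fun y => - Phi y) &
    forall x, `|T x| <= expR (- (k * x)) * \int[mu]_x w x.
Proof.
move=> k0 mPhi lPhi iw hPhi.
(* The kernel gives the integral of [Phi] from x to infinity for k > 0, and minus its integral from
   minus infinity to x for k < 0. On its support the exponential at y is at most the one at x. *)
pose c (x y : R) : R := (x <= y)%R%:R - (k < 0)%R%:R.
have w0 y : 0 <= w y.
  by have := le_trans (normr_ge0 _) (hPhi y); rewrite pmulr_rge0 // expR_gt0.
have bnd x y : `|c x y * Phi y| <= expR (- (k * x)) * w y.
  have e0 : 0 <= expR (- (k * x)) * w y by rewrite mulr_ge0 ?expR_ge0.
  rewrite normrM /c; have [xy|yx] := leP x y; have [kn|kp] := ltP k 0.
  - by rewrite subrr normr0 mul0r.
  - rewrite subr0 normr1 mul1r; apply: le_trans (hPhi y) _.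
    by rewrite ler_wpM2r // ler_expR lerN2 ler_wpM2l.
  - rewrite sub0r normrN1 mul1r; apply: le_trans (hPhi y) _.
    by rewrite ler_wpM2r // ler_expR lerN2 ler_wnM2l // ltW.
  - by rewrite subrr normr0 mul0r.
have mc x : measurable_fun setT (fun y => c x y * Phi y).
  apply: measurable_funM => //; apply: measurable_funB => //.
  by apply: measurableT_comp => //; exact: measurable_fun_ler.
have ic x : intbl mu (fun y => c x y * Phi y).
  refine (@intbl_le _ _ _ mu _ _ (mc x) (bnd x) _); exact: intblZ.
exists (fun x => \int[mu]_y (c x y * Phi y)); last first.
  by move=> x; rewrite -RintZ //; apply: Rint_norm_le (ic x) _ (bnd x); exact: intblZ.
split; first exact: locintN.
move=> a b ab; rewrite -RintB //.
transitivity (\int[mu]_y (- (if (a <= y) && (y < b) then Phi y else 0))).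
  congr Rintegral; apply/funext => y; rewrite /c.
  have [ay|ya] := leP a y; have [byy|yb] := leP b y => /=; try ring.
  by have := lt_le_trans ya (le_trans ab byy); rewrite ltxx.
rewrite (Rintegral_support (a := a) (b := b)); last first.
  move=> x /negP h; case: ifPn; rewrite ?oppr0 // => /andP[h1 h2].
  by case: h; rewrite h1 ltW.
have [_ hl] := lPhi.
have sub : mu.-integrable `[a, b[ (EFin \o Phi).
  by apply: integrableS (hl a b) => //; apply: subset_itv; rewrite bnd_simp.
rewrite -!Rintegral_itv_bndo_bndc.
- by apply: eq_Rintegral => y; rewrite inE /= in_itv /= => ->.
- by have := integrableN sub.
- have := integrableN sub; apply: eq_integrable => // y.
  by rewrite inE /= in_itv /= => ->.
Qed.

(* With v = a + i b, kappa = k + i l and q = p + i r, this is v' = kappa v - q. *)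
Lemma damped_system (k l : R) (p r : R -> R) : k != 0 ->
  intbl mu p -> intbl mu r ->
  exists a b : R -> R,
    [/\ ac a (fun x => k * a x - l * b x - p x),
        ac b (fun x => k * b x + l * a x - r x) &
        forall x, `|a x| <= 2 * \int[mu]_x (`|p x| + `|r x|) /\
                  `|b x| <= 2 * \int[mu]_x (`|p x| + `|r x|)].
Proof.
move=> k0 ip ir; set B := \int[mu]_x (`|p x| + `|r x|).
pose e (s x : R) : R := expR (s * x).
have de s x : is_derive x (1 : R) (e s) (s * e s x).
  apply: (is_derive_eq (is_derive_comp (g := fun y => s * y) (is_derive_expR (s * x))
    (is_derive_scale s (is_derive_id x (1 : R))))).
  by rewrite /e; ring.
pose C (x : R) : R := cos (l * x); pose S (x : R) : R := sin (l * x).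
have dC x : is_derive x (1 : R) C (- l * S x).
  apply: (is_derive_eq (is_derive_comp (g := fun y => l * y) (is_derive_cos (l * x))
    (is_derive_scale l (is_derive_id x (1 : R))))).
  by rewrite /S; ring.
have dS x : is_derive x (1 : R) S (l * C x).
  apply: (is_derive_eq (is_derive_comp (g := fun y => l * y) (is_derive_sin (l * x))
    (is_derive_scale l (is_derive_id x (1 : R))))).
  by rewrite /C; ring.
have cont (f g : R -> R) : (forall x, is_derive x (1 : R) f (g x)) -> continuous f.
  by move=> h x; apply/differentiable_continuous/derivable1_diffP; case: (h x).
have ce s := cont _ _ (de s); have cC := cont _ _ dC; have cS := cont _ _ dS.
have cM (f g : R -> R) : continuous f -> continuous g -> continuous (fun x => f x * g x).
  by move=> hf hg x; exact: cvgM (hf x) (hg x).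
have cD (f g : R -> R) : continuous f -> continuous g -> continuous (fun x => f x + g x).
  by move=> hf hg x; exact: cvgD (hf x) (hg x).
(* A + i D is e^(kappa x). *)
pose A x := e k x * C x; pose D x := e k x * S x.
have acA : ac A (fun x => k * A x + (- l) * D x).
  apply: ac_derive; last by apply: (cD _ _); apply: (cM _ _); try exact: continuous_cst; exact: cM.
  move=> x; apply: (is_derive_eq (is_derive_mul (de k x) (dC x))); rewrite /A /D; ring.
have acD : ac D (fun x => k * D x + l * A x).
  apply: ac_derive; last by apply: (cD _ _); apply: (cM _ _); try exact: continuous_cst; exact: cM.
  move=> x; apply: (is_derive_eq (is_derive_mul (de k x) (dS x))); rewrite /A /D; ring.
have lp := intbl_locint ip; have lr := intbl_locint ir.
(* Phi1 + i Phi2 is e^(-kappa y) q(y). *)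
pose Phi1 y := (C y * p y + S y * r y) * e (- k) y.
pose Phi2 y := (C y * r y - S y * p y) * e (- k) y.
have locCM (f : R -> R) (g : R -> R) : continuous f -> locint g -> locint (fun x => f x * g x).
  by move=> cf lg; under eq_fun do rewrite mulrC; exact: locintM.
have l1 : locint Phi1 by apply: locintM => //; apply: locintD; exact: locCM.
have l2 : locint Phi2 by apply: locintM => //; apply: locintB; exact: locCM.
have iw : intbl mu (fun x => `|p x| + `|r x|) by apply: intblD; exact: intbl_norm.
have C1 y : `|C y| <= 1 by rewrite ler_norml cos_geN1 cos_le1.
have S1 y : `|S y| <= 1 by rewrite ler_norml sin_geN1 sin_le1.
have eE y : e (- k) y = expR (- (k * y)) by rewrite /e mulNr.
have le1 (x y : R) : `|x| <= 1 -> `|x * y| <= `|y|.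
  by move=> h; rewrite normrM ler_piMl.
have b1 y : `|Phi1 y| <= expR (- (k * y)) * (`|p y| + `|r y|).
  rewrite /Phi1 normrM mulrC eE ger0_norm ?expR_ge0 // ler_wpM2l ?expR_ge0 //.
  by apply: le_trans (ler_normD _ _) _; apply: lerD; exact: le1.
have b2 y : `|Phi2 y| <= expR (- (k * y)) * (`|p y| + `|r y|).
  rewrite /Phi2 normrM mulrC eE ger0_norm ?expR_ge0 // ler_wpM2l ?expR_ge0 //.
  by apply: le_trans (ler_normB _ _) _; rewrite addrC; apply: lerD; exact: le1.
have [T1 acT1 T1b] := decaying_primitive k0 (proj1 l1) l1 iw b1.
have [T2 acT2 T2b] := decaying_primitive k0 (proj1 l2) l2 iw b2.
have ee x : e k x * e (- k) x = 1.
  by rewrite eE /e -expRD subrr expR0.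
have cs x : C x ^+ 2 + S x ^+ 2 = 1 by exact: cos2Dsin2.
(* Variation of constants: v = e^(kappa x) (T1 + i T2), where T1 + i T2 has derivative -e^(-kappa x)
   q. *)
exists (fun x => A x * T1 x - D x * T2 x), (fun x => D x * T1 x + A x * T2 x); split.
- apply: ac_ext (ac_lin (-1) (ac_mul acD acT2) (ac_mul acA acT1)) => x; first by ring.
  transitivity (k * (A x * T1 x - D x * T2 x) - l * (D x * T1 x + A x * T2 x)
     - (e k x * e (- k) x) * (C x ^+ 2 + S x ^+ 2) * p x); last by rewrite ee cs !mul1r.
  by rewrite /Phi1 /Phi2 /A /D; ring.
- apply: ac_ext (ac_lin 1 (ac_mul acD acT1) (ac_mul acA acT2)) => x; first by ring.
  transitivity (k * (D x * T1 x + A x * T2 x) + l * (A x * T1 x - D x * T2 x)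
     - (e k x * e (- k) x) * (C x ^+ 2 + S x ^+ 2) * r x); last by rewrite ee cs !mul1r.
  by rewrite /Phi1 /Phi2 /A /D; ring.
- have bA (f T : R -> R) x : `|f x| <= 1 -> `|T x| <= expR (- (k * x)) * B ->
      `|e k x * f x * T x| <= B.
    move=> f1 Tb; rewrite mulrAC normrM.
    apply: (@le_trans _ _ (`|e k x * T x|)); first by rewrite ler_piMr.
    rewrite normrM ger0_norm ?expR_ge0 //.
    apply: le_trans (ler_wpM2l (expR_ge0 _) Tb) _.
    by rewrite mulrA -eE ee mul1r.
  move=> x; have h1 := bA C T1 x (C1 x) (T1b x); have h2 := bA S T2 x (S1 x) (T2b x).
  have h3 := bA S T1 x (S1 x) (T1b x); have h4 := bA C T2 x (C1 x) (T2b x).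
  split; first by apply: le_trans (ler_normB _ _) _; rewrite mulr_natl mulr2n; exact: lerD.
  by apply: le_trans (ler_normD _ _) _; rewrite mulr_natl mulr2n; exact: lerD.
Qed.

(* (a^2 + b^2)' = 2 k (a^2 + b^2) - 2 (a p + b r). *)
Lemma damped_system_sqint (k l M : R) (p r a b : R -> R) : k != 0 ->
  intbl mu p -> intbl mu r ->
  ac a (fun x => k * a x - l * b x - p x) ->
  ac b (fun x => k * b x + l * a x - r x) ->
  (forall x, `|a x| <= M /\ `|b x| <= M) ->
  \int[mu]_x (`|p x| + `|r x|) <= M ->
  [/\ sqint mu a, sqint mu b & nrm2 mu a ^+ 2 + nrm2 mu b ^+ 2 <= 2 * M ^+ 2 / `|k|].
Proof.
move=> k0 ip ir aca acb hM hB.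
have ca := ac_continuous aca; have cb := ac_continuous acb.
have ma := continuous_measurable_fun ca; have mb := continuous_measurable_fun cb.
have ak : 0 < `|k| by rewrite normr_gt0.
have [la lb] := (continuous_locint ca, continuous_locint cb).
have laa := locintM la ca; have lbb := locintM lb cb.
have lp := intbl_locint ip; have lr := intbl_locint ir.
have lpa := locintM lp ca; have lrb := locintM lr cb.
have iw : intbl mu (fun x => `|p x| + `|r x|) by apply: intblD; exact: intbl_norm.
have lw := intbl_locint iw.
have M0 : 0 <= M by exact: le_trans (normr_ge0 _) (proj1 (hM 0)).
(* Integrating the identity over [-n, n] bounds 2 |k| times the integral by 2 M^2 from the endpoints
   plus 2 M^2 from the source term. *)
have seg (n : nat) : I (- n%:R) n%:R (fun x => a x * a x + b x * b x) <= 2 * M ^+ 2 / `|k|.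
  have nn : - n%:R <= n%:R :> R by rewrite lerNl; have : 0 <= n%:R :> R by []; lra.
  have [_ /(_ _ _ nn) h] := ac_lin 1 (ac_mul aca aca) (ac_mul acb acb).
  rewrite (_ : (fun x => 1 * _ + _) = (fun x => 2 * k * (a x * a x + b x * b x) +
    (-2) * (p x * a x + r x * b x))) in h; last by apply/funext => x; ring.
  have ls := locintD laa lbb; have lq := locintD lpa lrb.
  rewrite itv_intD ?itv_intZ // in h; [|exact: locintZ|exact: locintZ].
  pose J := I (- n%:R) n%:R (fun x => a x * a x + b x * b x).
  pose K := I (- n%:R) n%:R (fun x => p x * a x + r x * b x).
  rewrite -/J -/K in h; rewrite -/J.
  have KM : `|K| <= M * M.
    apply: le_trans (itv_int_norm _ _ lq) _.
    apply: (@le_trans _ _ (I (- n%:R) n%:R (fun x => M * (`|p x| + `|r x|)))).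
      apply: itv_int_le; [exact: locint_norm|exact: locintZ|] => x _ _.
      apply: le_trans (ler_normD _ _) _; rewrite mulrDr !normrM.
      rewrite (mulrC M `|p x|) (mulrC M `|r x|).
      by have [h1 h2] := hM x; apply: lerD; rewrite ler_wpM2l.
    rewrite itv_intZ // ler_wpM2l //; apply: le_trans hB.
    by apply: segment_le_Rintegral => // x; rewrite addr_ge0.
  have sq (x : R) : 0 <= a x * a x + b x * b x <= 2 * M ^+ 2.
    have [h1 h2] := hM x; have h3 : a x ^+ 2 <= M ^+ 2.
      by rewrite -real_normK ?num_real // ler_pXn2r ?nnegrE.
    have h4 : b x ^+ 2 <= M ^+ 2 by rewrite -real_normK ?num_real // ler_pXn2r ?nnegrE.
    rewrite -!expr2 addr_ge0 ?sqr_ge0 //=.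
    by rewrite mulr_natl mulr2n lerD.
  have J0 : 0 <= J by apply: Rintegral_ge0 => x _; case/andP: (sq x).
  have kJ : 2 * (`|k| * J) <= 2 * M ^+ 2 + 2 * (M * M).
    have -> : `|k| * J = `|k * J| by rewrite normrM (ger0_norm J0).
    rewrite !mul1r in h; move: (sq n%:R) (sq (- n%:R)) KM h; rewrite ler_norml.
    move: (_ + _) (_ + _) => u v /andP[u0 u1] /andP[v0 v1] /andP[K0 K1] h.
    suff : `|k * J| <= M ^+ 2 + M * M by lra.
    by rewrite ler_norml; apply/andP; split; move: h u0 u1 v0 v1 K0 K1; clear; lra.
  rewrite ler_pdivlMr // mulrC; move: kJ; rewrite expr2; lra.
have [||int1 int2] := @intbl_of_segments _ _ _ _ _ seg.
- exact: locintD.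
- by move=> x; rewrite -!expr2 addr_ge0 ?sqr_ge0.
have mle (f g : R -> R) : measurable_fun setT f -> (forall x, f x ^+ 2 <= g x) ->
    intbl mu g -> sqint mu f.
  move=> mf fg ig; split=> //; apply: (@intbl_le _ _ _ mu _ _ _ _ ig); first exact: measurable_funX.
  by move=> x; rewrite ger0_norm ?sqr_ge0.
have sa : sqint mu a.
  by apply: (mle _ _ ma _ int1) => x; rewrite -expr2 lerDl -expr2 sqr_ge0.
have sb : sqint mu b.
  by apply: (mle _ _ mb _ int1) => x; rewrite -[b x * _]expr2 lerDr -expr2 sqr_ge0.
split=> //; rewrite !nrm2_sqr -(RintD (proj2 sa) (proj2 sb)).
by apply: le_trans int2; under eq_fun do rewrite !expr2.
Qed.
End DampedSystem.

(** * The resolvent of the Klein-Gordon generator near the imaginary axis *)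

Section Resolvent.
Context {R : realType}.
Notation mu := (@lebesgue_measure R).
Local Notation E := (energy_space R).
Local Notation Re := (@complex.Re R).
Local Notation Im := (@complex.Im R).

Lemma damped_solution (q : cfun R) : inLp 1%:E q -> inLp 2%:E q ->
  exists2 B : R, 0 <= B & forall k l : R, k != 0 -> exists v : cfun R,
    [/\ inLp 2%:E v, weak_derivative v (Complex k l *: v - q) &
        normL2 v <= B / Num.sqrt `|k|].
Proof.
move=> [/Lfun1_integrable ip /Lfun1_integrable ir] q2.
pose B := \int[mu]_x (`|Re (q x)| + `|Im (q x)|).
have B0 : 0 <= B by apply: Rintegral_ge0 => x _; rewrite addr_ge0.
(* With sup bound 2 B the squared L^2 norm is at most 8 B^2 / |k|, which is below (3 B)^2 / |k|. *)
exists (3 * B); first by rewrite mulr_ge0.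
move=> k l k0.
have [a [b [aca acb hab]]] := damped_system l k0 ip ir.
have BB : B <= 2 * B by lra.
have [sa sb n2] := damped_system_sqint k0 ip ir aca acb hab BB.
pose v : cfun R := fun x => Complex (a x) (b x).
have hv : inLp 2%:E v by apply/inL2P.
exists v; split=> //.
  apply/weak_derivativeP; split; apply: ac_wd.
    apply: ac_ext aca => x //.
    change ((Complex k l *: v - q) x) with (Complex k l * v x - q x : R[i]).
    by rewrite /v; case: (q x).
  apply: ac_ext acb => x //.
  change ((Complex k l *: v - q) x) with (Complex k l * v x - q x : R[i]).
  by rewrite /v; case: (q x).
have k1 : 0 < `|k| by rewrite normr_gt0.
rewrite normL2_sqrt // ler_pdivlMr ?sqrtr_gt0 // -sqrtrM ?addr_ge0 ?sqr_ge0 //.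
have B3 : 0 <= 3 * B by rewrite mulr_ge0.
rewrite -[leRHS](ger0_norm B3) -(sqrtr_sqr (3 * B)) ler_wsqrtr //.
move: n2; rewrite ler_pdivlMr // => /le_trans; apply.
by rewrite -/B; move: (sqr_ge0 B); rewrite !expr2; clearbody B; lra.
Qed.

(** The explicit square root with positive real part of -c + 2 i al d, where c = al^2 - m^2 - d^2:
    k^2 = (S - c) / 2 for S the modulus, and l = al d / k. *)
Lemma resolvent_exponent (m al d : R) : 0 < d -> al ^+ 2 - m ^+ 2 - d ^+ 2 > 0 ->
  exists k l : R, [/\ 0 < k, Complex k l ^+ 2 = Complex (m ^+ 2) 0 + Complex d al ^+ 2 &
    l ^+ 2 = k ^+ 2 + (al ^+ 2 - m ^+ 2 - d ^+ 2)].
Proof.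
move=> d0 c0; set c := al ^+ 2 - m ^+ 2 - d ^+ 2.
have al0 : al != 0.
  by apply: contraTneq c0 => ->; have := sqr_ge0 m; have := sqr_ge0 d; rewrite -leNgt; lra.
have c0' : 0 < c by [].
pose S := Num.sqrt (c ^+ 2 + (2 * al * d) ^+ 2).
have S2 : S ^+ 2 = c ^+ 2 + (2 * al * d) ^+ 2.
  by rewrite sqr_sqrtr // addr_ge0 ?sqr_ge0.
have Sc : c < S.
  rewrite -[X in X < _](gtr0_norm c0') -sqrtr_sqr ltr_sqrt ?ltrDl ?exprn_even_gt0 //=.
    by rewrite !mulf_neq0 // gt_eqF.
  by rewrite ltr_wpDl ?sqr_ge0 // exprn_even_gt0 //= !mulf_neq0 // gt_eqF.
have X0 : 0 < (S - c) / 2 by rewrite divr_gt0 // subr_gt0.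
pose k := Num.sqrt ((S - c) / 2).
have k0 : 0 < k by rewrite sqrtr_gt0.
have k2 : k ^+ 2 = (S - c) / 2 by rewrite sqr_sqrtr // ltW.
have kl : k * (al * d / k) = al * d by field; rewrite gt_eqF.
have l2 : (al * d / k) ^+ 2 = k ^+ 2 + c.
  apply: (mulfI (lt0r_neq0 X0)); rewrite -{1}k2 -exprMn kl k2.
  transitivity ((S ^+ 2 - c ^+ 2) / 4); last by field.
  by rewrite S2; field.
exists k, (al * d / k); split=> //.
have h : k * k - (al * d / k) * (al * d / k) = m ^+ 2 + (d * d - al * al).
  by rewrite -!expr2 l2 /c; ring.
move: h kl; move: (al * d / k) => l h kl.
change (Complex (k * k - l * l) (k * l + l * k) =
  Complex (m ^+ 2 + (d * d - al * al)) (0 + (d * al + al * d)) :> R[i]).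
rewrite h; congr Complex; rewrite (mulrC l k) kl; ring.
Qed.

(** From k l = al d: while k <= 1 the factor l^2 is at most 1 + al^2, so k is at least a multiple of
    d; for k > 1 >= d this is clear. Also |kappa| >= |l|, and l^2 is at least al^2 - m^2 - d^2. *)
Lemma resolvent_exponents (m al : R) : m ^+ 2 < al ^+ 2 ->
  exists d0 c : R, [/\ 0 < d0, 0 < c & forall d, 0 < d -> d <= d0 ->
    exists k l : R, [/\ c * d <= k, 0 < k,
      Complex k l ^+ 2 = Complex (m ^+ 2) 0 + Complex d al ^+ 2,
      c <= Normc.normc (Complex k l) & d <= 1]].
Proof.
move=> mal; have c0 : 0 < al ^+ 2 - m ^+ 2 by rewrite subr_gt0.
set c1 := al ^+ 2 - m ^+ 2 in c0.
have a0 : 0 < `|al|.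
  by rewrite normr_gt0; apply: contraTneq mal => ->; rewrite expr0n /= -leNgt sqr_ge0.
(* For d below this threshold, d^2 takes away at most half of the gap al^2 - m^2. *)
pose d0 := Num.min 1 (Num.sqrt (c1 / 2)).
have s0 : 0 < Num.sqrt (c1 / 2) by rewrite sqrtr_gt0 divr_gt0.
pose c := Num.min (`|al| / (1 + `|al|)) (Num.sqrt (c1 / 2)).
have f0 : 0 < `|al| / (1 + `|al|) by rewrite divr_gt0 // addr_gt0.
exists d0, c; split; [by rewrite lt_min ltr01 s0|by rewrite lt_min f0 s0|] => d dgt.
rewrite /d0 le_min => /andP[d1 d2].
have dsq : d ^+ 2 <= c1 / 2.
  by rewrite -[leRHS]sqr_sqrtr ?(ltW (divr_gt0 c0 _)) // ler_pXn2r ?nnegrE ?(ltW dgt) ?(ltW s0).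
have cc : al ^+ 2 - m ^+ 2 - d ^+ 2 > 0 by rewrite -/c1; lra.
have [k [l [k0 hkl hl]]] := resolvent_exponent dgt cc.
exists k, l; split=> //.
- apply: (@le_trans _ _ (`|al| / (1 + `|al|) * d)).
    by rewrite ler_wpM2r ?(ltW dgt) // ge_min lexx.
  have kd : (k * l) ^+ 2 = (d * al) ^+ 2.
    by congr (_ ^+ 2); move: hkl; rewrite !expr2 => -[_]; lra.
  have key : (d * `|al|) ^+ 2 <= k ^+ 2 * (1 + al ^+ 2).
    rewrite exprMn real_normK ?num_real // -exprMn -kd exprMn hl.
    have [k1|k1] := leP (k ^+ 2) 1.
      rewrite ler_wpM2l ?sqr_ge0 //; have := sqr_ge0 m; have := sqr_ge0 d; lra.
    rewrite -hl -exprMn kd exprMn.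
    apply: (@le_trans _ _ (1 * al ^+ 2)).
      by rewrite ler_wpM2r ?sqr_ge0 // expr_le1 // ltW.
    by rewrite ler_pM ?sqr_ge0 ?(ltW k1) // lerDr.
  rewrite mulrAC ler_pdivrMr ?addr_gt0 // -(ler_pXn2r (n := 2)) ?nnegrE
    ?mulr_ge0 ?addr_ge0 ?(ltW k0) ?(ltW dgt) //.
  rewrite mulrC; apply: le_trans key _.
  rewrite exprMn ler_wpM2l ?sqr_ge0 // sqrrD expr1n mul1r real_normK ?num_real //.
  by rewrite addrAC lerDl mulrn_wge0.
- rewrite /c ge_min; apply/orP; right; rewrite /= ler_wsqrtr // hl -/c1.
  by have := sqr_ge0 k; lra.
Qed.

Context (m : R) (m_gt0 : 0 < m) (W0 : R -> state R -> state R).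
Context (W0_group : KG_group m W0).

(** Let [u] and [v] be the solutions for -kappa and kappa. In (v - u)' the sources cancel, so psi' =
    (v + u) / 2, whose derivative is kappa^2 psi - q. The first row of the resolvent equation forces
    the momentum lambda psi, and kappa^2 = m^2 + lambda^2 gives the second row. *)
Lemma KG_resolvent (al : R) (q : cfun R) (hq : in_energy ((0, q) : state R)) :
  inLp 1%:E q -> m ^+ 2 < al ^+ 2 ->
  exists d0 C0 : R, 0 < d0 /\ forall d, 0 < d -> d <= d0 ->
    exists2 P : E, generates energy_norm (energy_group W0_group) P
        (Complex d al *: P - to_energy hq) &
      energy_norm P <= C0 / Num.sqrt d.
Proof.
move=> q1 mal; have [_ q2] := hq.
have [B B0 hB] := damped_solution q1 q2.
have [d0 [c [dgt cgt hd]]] := resolvent_exponents mal.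
(* With X = B / sqrt k, the derivative costs X, the position X / c and the momentum (1 + |al|) X /
   c; then k >= c d. *)
exists d0, (B / Num.sqrt c * (1 + c^-1 * (2 + `|al|))); split=> // d d_gt d_le.
have [k [l [ck k0 kap ckap d1]]] := hd d d_gt d_le.
have [v [v2 vw vn]] := hB k l (lt0r_neq0 k0).
have [u [u2 uw un]] := hB (- k) (- l) ltac:(by rewrite oppr_eq0 gt_eqF).
rewrite normrN gtr0_norm // in un; rewrite gtr0_norm // in vn.
set K := Complex k l in vw kap ckap.
have uw' : weak_derivative u (- K *: u - q) by [].
set la := Complex d al in kap *.
have K0 : K != 0.
  by apply: contraTneq ckap => ->; rewrite Normc.normc0 -ltNge.
pose psi : cfun R := (2 * K)^-1 *: (v - u).
pose D : cfun R := 2^-1 *: (v + u).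
pose D2 : cfun R := K ^+ 2 *: psi - q.
have hpsi : inLp 2%:E psi by apply: inL2Z; exact: inL2B.
have hD : inLp 2%:E D by apply: inL2Z; exact: inL2D.
have hD2 : inLp 2%:E D2 by apply: inL2B => //; exact: inL2Z.
have Ku2 : inLp 2%:E (- K *: u - q) by apply: inL2B => //; exact: inL2Z.
have Kv2 : inLp 2%:E (K *: v - q) by apply: inL2B => //; exact: inL2Z.
have two : (2 : R[i]) != 0 by rewrite pnatr_eq0.
have w1 : weak_derivative psi D.
  have := weak_derivative_lin (2 * K)^-1 (inL2_lin (-1) u2 v2) (inL2_lin (-1) Ku2 Kv2)
    inL2_0 inL2_0 (weak_derivative_lin (-1) u2 Ku2 v2 Kv2 uw' vw) weak_derivative0.
  congr weak_derivative; first by rewrite addr0 scaleN1r addrC.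
  have -> : D = ((2 * K)^-1 * K) *: (v + u).
    by rewrite /D; congr (_ *: _); field; rewrite K0.
  by move: (2 * K)^-1 => z; module.
have w2 : weak_derivative D D2.
  have := weak_derivative_lin 2^-1 (inL2_lin 1 u2 v2) (inL2_lin 1 Ku2 Kv2)
    inL2_0 inL2_0 (weak_derivative_lin 1 u2 Ku2 v2 Kv2 uw' vw) weak_derivative0.
  congr weak_derivative; first by rewrite addr0 scale1r addrC.
  rewrite /D2 /psi scalerA; have -> : K ^+ 2 * (2 * K)^-1 = K * 2^-1.
    by field; rewrite K0.
  transitivity ((K * 2^-1) *: (v - u) - (2^-1 * 2) *: q); last by rewrite mulVf // scale1r.
  by move: (2^-1 : R[i]) => z; module.
have [psi1 psiD] := wderiv_ae hpsi hD w1.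
have [hw _] := inH1_wderiv psi1.
have w3 : weak_derivative (wderiv psi) D2.
  apply: (weak_derivative_ae hD hw hD2 hD2 _ _ w2); last exact: ae_eq_refl.
  by move: psiD; apply: ae_imply => x h xT; rewrite (h xT).
have [psi2 psiD2] := wderiv_ae hw hD2 w3.
have pi1 : inH1 (la *: psi).
  by have [] := inH1_lin la psi1 inH1_0; rewrite addr0.
have hP : in_energy ((psi, la *: psi) : state R) by split=> //; exact: inL2Z.
exists (to_energy hP).
  apply/generatesP; split; first by split.
  split.
    apply: aeW => x _.
    change (la * psi x - 0 = la * psi x :> R[i]); exact: subr0.
  move: psiD2; apply: ae_imply => x h xT.
  change (la * (la * psi x) - q x =
    wderiv (wderiv psi) x - Complex (m ^+ 2) 0 * psi x :> R[i]).
  rewrite (h xT).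
  change (D2 x) with (K ^+ 2 * psi x - q x : R[i]); rewrite kap; ring.
apply: le_trans (energy_le _) _.
have n1 : normL2 (v - u) <= 2 * (B / Num.sqrt k).
  by apply: le_trans (normL2B v2 u2) _; lra.
have n2 : normL2 (v + u) <= 2 * (B / Num.sqrt k).
  by apply: le_trans (normL2D v2 u2) _; lra.
set X := B / Num.sqrt k in n1 n2.
have cD : normL2 D <= X.
  rewrite normL2Z; last exact: inL2D.
  have -> : Normc.normc (2^-1 : R[i]) = 2^-1.
    by rewrite Normc.normcV -[2]/(2%:R) -(rmorph_nat (real_complex R)) normc_real ger0_norm.
  lra.
have cpsi : normL2 psi <= c^-1 * X.
  rewrite normL2Z; last exact: inL2B.
  rewrite Normc.normcV Normc.normcM -(rmorph_nat (real_complex R)) normc_real ger0_norm //.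
  have Kgt : 0 < Normc.normc K by exact: lt_le_trans cgt ckap.
  rewrite invfM mulrAC mulrC; apply: ler_pM.
  - by rewrite invr_ge0 ltW.
  - by rewrite mulr_ge0 ?invr_ge0 // normL2_ge0.
  - by rewrite lef_pV2 ?posrE.
  - lra.
have cla : Normc.normc la <= 1 + `|al|.
  rewrite /la /=; rewrite -(real_normK (num_real al)).
  by apply: le_trans (hypot_le (ltW d_gt) (normr_ge0 al)) _; rewrite lerD2r.
have X0 : 0 <= X by rewrite divr_ge0 // sqrtr_ge0.
have cpi : normL2 (la *: psi) <= (1 + `|al|) * (c^-1 * X).
  rewrite normL2Z //; apply: ler_pM => //; [exact: normc_ge0|exact: normL2_ge0].
have cder : normL2 (wderiv psi) <= X by rewrite (normL2_ae hw hD psiD).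
have XX : X <= B / Num.sqrt c / Num.sqrt d.
  rewrite /X -mulrA -invfM -sqrtrM ?(ltW cgt) // ler_wpM2l // lef_pV2 ?posrE ?sqrtr_gt0 ?mulr_gt0 //.
  by rewrite ler_wsqrtr.
apply: (@le_trans _ _ (X * (1 + c^-1 * (2 + `|al|)))).
  by rewrite /pos_norm /der_norm /mom_norm /=; move: cpsi cder cpi; lra.
rewrite [leRHS]mulrAC ler_wpM2r // addr_ge0 // mulr_ge0 ?addr_ge0 // invr_ge0 ltW //.
Qed.
End Resolvent.

(** * The oscillating weight *)

Section OscillatingWeight.
Context {R : realType}.
Implicit Types (al be ga x y xi : R).

Definition phase al be ga x : R := al * x + be * ln (1 + x) + ga.

(* The real part of the weight for [ga = 0], its imaginary part for
   [ga = - pi / 2]. *)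
Definition chirp al be ga x : R := cos (phase al be ga x) * (1 + x)^-1.

Definition chirp' al be ga x : R :=
  - (al * (1 + x)^-1 + be * (1 + x)^-1 ^+ 2) * sin (phase al be ga x)
  - (1 + x)^-1 ^+ 2 * cos (phase al be ga x).

Definition chirp'' al be ga x : R :=
  cos (phase al be ga x) *
    (2 * (1 + x)^-1 ^+ 3 - (al + be * (1 + x)^-1) ^+ 2 * (1 + x)^-1) +
  sin (phase al be ga x) * (2 * al * (1 + x)^-1 ^+ 2 + 3 * be * (1 + x)^-1 ^+ 3).

Lemma is_derive_recip x : 0 <= x ->
  is_derive x (1 : R) (fun y => (1 + y)^-1) (- (1 + x)^-1 ^+ 2).
Proof.
move=> x0; have x1 : 1 + x != 0 by rewrite gt_eqF // ltr_pwDl.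
apply: (is_derive_eq (is_derive_inv x1
  (is_derive_add (is_derive_const 1 x) (is_derive_id x (1 : R))))).
by rewrite add0r mulN1r exprVn.
Qed.

Lemma is_derive_phase al be ga x : 0 <= x ->
  is_derive x (1 : R) (phase al be ga) (al + be * (1 + x)^-1).
Proof.
move=> x0; have x1 : 0 < 1 + x by rewrite ltr_pwDl.
have h := is_derive_comp (g := fun y => 1 + y) (is_derive1_ln x1)
  (is_derive_add (is_derive_const 1 x) (is_derive_id x (1 : R))).
apply: (is_derive_eq (is_derive_add (is_derive_add
  (is_derive_scale al (is_derive_id x (1 : R))) (is_derive_scale be h))
  (is_derive_const ga x))).
by rewrite add0r !mulr1 addr0.
Qed.

Lemma is_derive_cos_phase al be ga x : 0 <= x ->
  is_derive x (1 : R) (fun y => cos (phase al be ga y))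
    (- sin (phase al be ga x) * (al + be * (1 + x)^-1)).
Proof.
by move=> x0; apply: (is_derive_comp (g := phase al be ga) (is_derive_cos _));
  exact: is_derive_phase.
Qed.

Lemma is_derive_sin_phase al be ga x : 0 <= x ->
  is_derive x (1 : R) (fun y => sin (phase al be ga y))
    (cos (phase al be ga x) * (al + be * (1 + x)^-1)).
Proof.
by move=> x0; apply: (is_derive_comp (g := phase al be ga) (is_derive_sin _));
  exact: is_derive_phase.
Qed.

Lemma is_derive_chirp al be ga x : 0 <= x ->
  is_derive x (1 : R) (chirp al be ga) (chirp' al be ga x).
Proof.
move=> x0.
apply: (is_derive_eq (is_derive_mul (is_derive_cos_phase al be ga x0) (is_derive_recip x0))).
rewrite /chirp'; move: (1 + x)^-1 => g; ring.
Qed.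

Lemma is_derive_chirp' al be ga x : 0 <= x ->
  is_derive x (1 : R) (chirp' al be ga) (chirp'' al be ga x).
Proof.
move=> x0; have dg := is_derive_recip x0.
have dc := is_derive_cos_phase al be ga x0; have ds := is_derive_sin_phase al be ga x0.
have dg2 := is_derive_exprn 2 dg.
have d1 := is_derive_mul (is_derive_opp (is_derive_add (is_derive_scale al dg)
  (is_derive_scale be dg2))) ds.
apply: (is_derive_eq (is_derive_add d1 (is_derive_opp (is_derive_mul dg2 dc)))).
rewrite /chirp''; move: (1 + x)^-1 => g /=; ring.
Qed.

(** Bounding 1 / (1 + x) by 1 in [chirp''], the cosine contributes 2 + (|al| + |be|)^2 and the sine
    3 (|al| + |be|). *)
Definition chirp_bound al be : R := (`|al| + `|be|) ^+ 2 + 3 * (`|al| + `|be|) + 2.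

Lemma chirp''_le al be ga x : 0 <= x -> `|chirp'' al be ga x| <= chirp_bound al be.
Proof.
move=> x0; rewrite /chirp'' /chirp_bound.
have : 0 <= (1 + x)^-1 <= 1.
  by rewrite invr_ge0 addr_ge0 //= invf_le1 ?ltr_pwDl // lerDl.
move: (1 + x)^-1 => g /andP[g0 g1].
have gn n : 0 <= g ^+ n <= 1 by rewrite exprn_ge0 //= exprn_ile1.
set A := `|al| + `|be|.
have A0 : 0 <= A by rewrite addr_ge0.
have c1 : `|cos (phase al be ga x)| <= 1 by rewrite ler_norml cos_geN1 cos_le1.
have s1 : `|sin (phase al be ga x)| <= 1 by rewrite ler_norml sin_geN1 sin_le1.
have le1 (u v : R) : `|u| <= 1 -> `|u * v| <= `|v|.
  by move=> h; rewrite normrM ler_piMl.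
have le2 (u : R) n : `|u * g ^+ n| <= `|u|.
  have /andP[h0 h1] := gn n.
  by rewrite normrM ler_piMr // ger0_norm.
apply: le_trans (ler_normD _ _) _.
have h1 := le1 _ (2 * g ^+ 3 - (al + be * g) ^+ 2 * g) c1.
have h2 := le1 _ (2 * al * g ^+ 2 + 3 * be * g ^+ 3) s1.
have h3 : `|2 * g ^+ 3 - (al + be * g) ^+ 2 * g| <= 2 + A ^+ 2.
  apply: le_trans (ler_normB _ _) _; apply: lerD.
    by apply: le_trans (le2 _ _) _; rewrite ger0_norm.
  have h := le2 ((al + be * g) ^+ 2) 1; rewrite expr1 in h.
  apply: le_trans h _; rewrite normrX ler_pXn2r ?nnegrE //.
  apply: le_trans (ler_normD _ _) _; rewrite lerD2l.
  by have := le2 be 1; rewrite expr1.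
have h4 : `|2 * al * g ^+ 2 + 3 * be * g ^+ 3| <= 3 * A.
  apply: le_trans (ler_normD _ _) _.
  apply: le_trans (lerD (le2 _ _) (le2 _ _)) _.
  rewrite !normrM (ger0_norm (_ : 0 <= 2)) // (ger0_norm (_ : 0 <= 3)) // /A.
  have := normr_ge0 al; lra.
move: (le_trans h1 h3) (le_trans h2 h4); move: (_ * (_ - _)) (_ * (_ + _)) => *; lra.
Qed.

(** The derivative is taken at an arbitrary tag, so the mean value theorem is used twice: for
    [chirp] on [x, y], then for [chirp'] between the intermediate point and the tag. *)
Lemma chirp_taylor al be ga x xi y : 0 <= x -> x <= xi -> xi <= y ->
  `|chirp al be ga y - chirp al be ga x - (y - x) * chirp' al be ga xi| <=
  chirp_bound al be * (y - x) ^+ 2.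
Proof.
move=> x0 xxi xiy; have xy := le_trans xxi xiy.
have K0 : 0 <= chirp_bound al be.
  exact: le_trans (normr_ge0 _) (chirp''_le al be ga x0).
have cont (f f' : R -> R) (a b : R) : 0 <= a ->
    (forall z : R, 0 <= z -> is_derive z (1 : R) f (f' z)) -> {within `[a, b], continuous f}.
  move=> a0 hf; apply: derivable_within_continuous => z.
  rewrite in_itv /= => /andP[az _]; by case: (hf z (le_trans a0 az)).
have mvt (f f' : R -> R) (a b : R) : 0 <= a -> a <= b ->
    (forall z : R, 0 <= z -> is_derive z (1 : R) f (f' z)) ->
    exists2 z, a <= z <= b & f b - f a = f' z * (b - a).
  move=> a0 ab hf; have [||z] := @MVT_segment R f f' a b ab.
  - by move=> z; rewrite in_itv /= => /andP[az _]; apply: hf; apply: le_trans a0 (ltW az).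
  - exact: cont hf.
  - by rewrite in_itv /= => h e; exists z.
have [z /andP[xz zy] ->] := mvt _ _ x y x0 xy (fun z => @is_derive_chirp al be ga z).
rewrite mulrC -mulrBr normrM ger0_norm ?subr_ge0 // mulrC expr2 mulrA.
rewrite ler_wpM2r ?subr_ge0 //.
have lip (a b : R) : 0 <= a -> a <= b ->
    `|chirp' al be ga b - chirp' al be ga a| <= chirp_bound al be * (b - a).
  move=> a0 ab.
  have [t /andP[at_ _] ->] := mvt _ _ a b a0 ab (fun z => @is_derive_chirp' al be ga z).
  by rewrite normrM (ger0_norm (_ : 0 <= b - a)) ?subr_ge0 // ler_wpM2r ?subr_ge0 //
    chirp''_le // (le_trans a0).
have [xiz|zxi] := leP xi z.
  apply: le_trans (lip _ _ (le_trans x0 xxi) xiz) _.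
  rewrite ler_wpM2l //; lra.
rewrite distrC; apply: le_trans (lip _ _ (le_trans x0 xz) (ltW zxi)) _.
rewrite ler_wpM2l //; lra.
Qed.

Definition weight al be x : R[i] :=
  Complex (chirp al be 0 x) (chirp al be (- (pi / 2)) x).
Definition weight' al be x : R[i] :=
  Complex (chirp' al be 0 x) (chirp' al be (- (pi / 2)) x).

Lemma phase_shift al be ga x : phase al be ga x = phase al be 0 x + ga.
Proof. by rewrite /phase addr0. Qed.

(** The power (1 + x)^(1 - i be) has modulus 1 + x and argument -be ln (1 + x), so dividing by it
    adds be ln (1 + x) to the phase. *)
Lemma oscillating_weightE (mu rho s x : R) : 0 <= x ->
  oscillating_weight mu rho s x = weight (2 * s * mu) (2 * s * rho) x.
Proof.
move=> x0; have x1 : 0 < 1 + x by rewrite ltr_pwDl.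
set al := 2 * s * mu; set be := 2 * s * rho.
pose ph := be * ln (1 + x).
have e1 : cexp (Complex 0 (al * x)) = Complex (cos (al * x)) (sin (al * x)).
  by rewrite /cexp /= expR0 !mul1r.
have e2 : rcpow (1 + x) (Complex 1 (- be)) =
    Complex ((1 + x) * cos ph) (- ((1 + x) * sin ph)).
  rewrite /rcpow /cexp /= !mul1r !mulr0 !mulNr add0r oppr0 addr0 lnK ?posrE //.
  by rewrite cosN sinN mulrN.
have e3 : phase al be 0 x = al * x + ph by rewrite /phase addr0.
have wE : weight al be x = Complex (cos (al * x + ph) / (1 + x)) (sin (al * x + ph) / (1 + x)).
  by rewrite /weight /chirp (phase_shift _ _ (- _)) cosBpihalf e3.
rewrite /oscillating_weight e1 e2 wE.
have nz : Complex ((1 + x) * cos ph) (- ((1 + x) * sin ph)) != 0 :> R[i].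
  apply/eqP => -[h1 h2].
  have := cos2Dsin2 ph; have xn := lt0r_neq0 x1.
  have -> : cos ph = 0 by apply: (mulfI xn); rewrite h1 mulr0.
  have -> : sin ph = 0 by apply: (mulfI xn); rewrite mulr0 -[LHS]opprK h2 oppr0.
  by rewrite expr0n /= addr0 => /eqP; rewrite eq_sym oner_eq0.
apply: (mulIf nz); rewrite mulfVK //.
have cs := cos2Dsin2 ph; have xn := lt0r_neq0 x1.
set c1 := cos (al * x + ph); set s1 := sin (al * x + ph).
change (Complex (cos (al * x)) (sin (al * x)) =
  Complex (c1 / (1 + x) * ((1 + x) * cos ph) - s1 / (1 + x) * (- ((1 + x) * sin ph)))
    (c1 / (1 + x) * (- ((1 + x) * sin ph)) + s1 / (1 + x) * ((1 + x) * cos ph)) :> R[i]).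
rewrite /c1 /s1 cosD sinD; congr Complex.
  transitivity (cos (al * x) * (cos ph ^+ 2 + sin ph ^+ 2)); first by rewrite cs mulr1.
  by field.
transitivity (sin (al * x) * (cos ph ^+ 2 + sin ph ^+ 2)); first by rewrite cs mulr1.
by field.
Qed.

Lemma normc_weight al be x : 0 <= x -> Normc.normc (weight al be x) <= (1 + x)^-1.
Proof.
move=> x0; have g0 : 0 <= (1 + x)^-1 by rewrite invr_ge0 addr_ge0.
rewrite /weight /= /chirp (phase_shift _ _ (- _)) cosBpihalf !exprMn -mulrDl.
by rewrite cos2Dsin2 mul1r sqrtr_sqr ger0_norm.
Qed.

(** Explicitly w' - i al w = (i be - 1) w / (1 + x), and the modulus of i be - 1 is at most 1 +
    |be|. *)
Lemma normc_weight' al be x : 0 <= x ->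
  Normc.normc (weight' al be x - Complex 0 al * weight al be x) <=
  (1 + `|be|) / (1 + x) ^+ 2.
Proof.
move=> x0; rewrite /weight /weight' /chirp /chirp'.
rewrite (phase_shift _ _ (- _)) cosBpihalf sinBpihalf -exprVn.
have g0 : 0 <= (1 + x)^-1 by rewrite invr_ge0 addr_ge0.
have cs := cos2Dsin2 (phase al be 0 x).
move: (cos _) (sin _) (1 + x)^-1 cs g0 => c s g cs g0.
rewrite [X in Normc.normc X](_ : _ = Complex (- (g ^+ 2 * (be * s + c))) (g ^+ 2 * (be * c - s))).
  rewrite /=.
  have -> : (- (g ^+ 2 * (be * s + c))) ^+ 2 + (g ^+ 2 * (be * c - s)) ^+ 2 =
    (g ^+ 2) ^+ 2 * ((1 + be ^+ 2) * (c ^+ 2 + s ^+ 2)) by ring.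
  rewrite cs mulr1 sqrtrM ?sqr_ge0 // sqrtr_sqr ger0_norm ?sqr_ge0 // mulrC.
  rewrite ler_wpM2r ?sqr_ge0 //.
  have := hypot_le (ler01) (normr_ge0 be).
  by rewrite expr1n real_normK ?num_real.
by apply/eqP; rewrite eq_complex /=; apply/andP; split; apply/eqP; ring.
Qed.

Lemma weight_taylor al be x xi y : 0 <= x -> x <= xi -> xi <= y ->
  Normc.normc (weight al be y - weight al be x - (y - x)%:c * weight' al be xi) <=
  2 * chirp_bound al be * (y - x) ^+ 2.
Proof.
move=> x0 xxi xiy.
have h1 := chirp_taylor al be 0 x0 xxi xiy.
have h2 := chirp_taylor al be (- (pi / 2)) x0 xxi xiy.
rewrite (_ : weight al be y - weight al be x - _ = Complex
  (chirp al be 0 y - chirp al be 0 x - (y - x) * chirp' al be 0 xi)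
  (chirp al be (- (pi / 2)) y - chirp al be (- (pi / 2)) x -
     (y - x) * chirp' al be (- (pi / 2)) xi)).
  rewrite /= -(real_normK (num_real (_ - _ - (y - x) * chirp' al be 0 xi))).
  rewrite -(real_normK (num_real (_ - _ - (y - x) * chirp' al be (- (pi / 2)) xi))).
  apply: le_trans (hypot_le (normr_ge0 _) (normr_ge0 _)) _.
  by apply: le_trans (lerD h1 h2) _; rewrite -mulrA mulr_natl mulr2n.
by apply/eqP; rewrite eq_complex /= !mul0r subr0 addr0 !eqxx.
Qed.
End OscillatingWeight.

(** * The improper integral and its decay *)

Lemma energy_val_sum (R : realType) (n : nat) (f : 'I_n -> energy_space R) :
  energy_val (\sum_(i < n) f i) = \sum_(i < n) energy_val (f i).
Proof. exact: (big_morph (@energy_val R) (id1 := 0) (op1 := +%R)). Qed.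

Theorem lemma7p3 (R : realType) (m mu rho : R) (q : cfun R)
    (W0 : R -> state R -> state R) :
  0 < m -> 0 < mu -> mu < m -> m < 2 * mu ->
  inLp 2%:E q -> inLp 1%:E q ->
  KG_group m W0 ->
  forall s : R, s = 1 \/ s = -1 ->
  exists G : R -> state R,
    (forall t : R, 0 <= t ->
       is_improper_RInt_energy
         (fun tau => oscillating_weight mu rho s tau *:
                     W0 (- tau) ((0, q) : state R)) t (G t)) /\
    (exists C : R, \forall t \near +oo, norm_energy (G t) <= C * t `^ (- (1 / 3))).
Proof.
move=> m0 mu0 _ m2mu q2 q1 hW s hs.
set F := fun tau => _.
have hq : in_energy ((0, q) : state R) by split=> //; exact: inH1_0.
pose Q := to_energy hq; pose W := energy_group hW.
pose al := 2 * s * mu; pose be := 2 * s * rho.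
have mal : m ^+ 2 < al ^+ 2.
  (* Both signs give the same square, so m < 2 mu yields al^2 > m^2 in either case. *)
  have -> : al ^+ 2 = (2 * mu) ^+ 2 by rewrite /al; case: hs => ->; ring.
  by rewrite ltr_pXn2r ?nnegrE ?(ltW m0) // ltW // mulr_gt0.
have [M M0 hM] := energy_group_bounded m0 hW.
have [d0 [C0 [d00 hres]]] := KG_resolvent hW hq q1 mal.
have c0 : 0 <= 1 + `|be| by rewrite addr_ge0.
have L0 : 0 <= 2 * chirp_bound al be.
  by rewrite mulr_ge0 // (le_trans (normr_ge0 _) (chirp''_le al be 0 (lexx 0))).
have hN := @energy_seminorm R; have hC := @energy_complete R.
have hG := energy_group_seminormed hW.
have [P hP] := weighted_orbit_primitive hN hC hG M0 hM Q c0 L0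
  (normc_weight al be) (normc_weight' al be) (weight_taylor al be) d00.
have [l [hl1 hl2]] := decay_limit hN hC hG M0 hM c0 L0
  (normc_weight al be) (normc_weight' al be) (weight_taylor al be) d00 hres hP.
(* With [P] a primitive on [0, T] for every T and [l] its limit at infinity, the tail from t is
   [l - P t]. *)
exists (fun t => energy_val (l - P t)); split=> [t t0|].
  split; first exact: energy_in.
  exists (fun T => energy_val (P T - P t)); split=> [T tT|].
    split; first exact: energy_in.
    move=> e e0.
    have [d dgt hd] := primitive_riemann_sum hN tT (primitive_sub t0 (lexx T) (hP T)) e0.
    exists d => // n x xi xa xb hx.
    have := hd n x xi xa xb hx.
    (* The tags are then nonnegative, which is where the oscillating weight agrees with [weight]. *)
    have mono i : (i <= n)%N -> t <= x i.
      elim: i => [_|i ih iltn]; first by rewrite xa.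
      have [h1 h2 _] := hx i iltn.
      exact: le_trans (ih (ltnW iltn)) (le_trans h1 h2).
    congr (_ < _).
    rewrite /energy_norm; congr norm_energy.
    transitivity (energy_val (\sum_(i < n) (x i.+1 - x i)%:c *:
        (weight al be (xi i) *: W (- xi i) Q)) - energy_val (P T - P t)); first by [].
    congr (_ - _); apply: etrans (energy_val_sum _) _; apply: eq_bigr => i _.
    have [h1 _ _] := hx i (ltn_ord i).
    have xi0 : 0 <= xi i.
      by apply: le_trans t0 (le_trans (mono i (ltnW (ltn_ord i))) h1).
    by rewrite /F oscillating_weightE.
  apply/cvgrPdist_le => e e0; have [T0 hT0] := hl1 e e0.
  near=> T; rewrite sub0r normrN.
  have -> : norm_energy (energy_val (P T - P t) - energy_val (l - P t)) =
      energy_norm (P T - l).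
    have -> : P T - l = (P T - P t) - (l - P t) by module.
    by [].
  rewrite ger0_norm ?(seminorm_ge0 hN) //; apply: hT0.
  near: T; apply: nbhs_pinfty_ge; exact: num_real.
set A := 4 * ((1 + `|be| + 3) * M * C0) in hl2.
exists `|A|; near=> t.
have t1 : 1 <= t by near: t; apply: nbhs_pinfty_ge; exact: num_real.
have td : d0^-1 <= t by near: t; apply: nbhs_pinfty_ge; exact: num_real.
apply: le_trans (hl2 t t1 td) _.
have t0 : 0 < t by exact: lt_le_trans t1.
apply: (@le_trans _ _ (`|A| / Num.sqrt t)).
  by rewrite ler_wpM2r ?ler_norm // invr_ge0 sqrtr_ge0.
(* For t >= 1 the bound t^(-1/2) is at most t^(-1/3). *)
rewrite ler_wpM2l // powRN -powR12_sqrt ?(ltW t0) // lef_pV2 ?posrE ?powR_gt0 //.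
by apply: ler_powR => //; lra.
Unshelve. all: by end_near.
Qed.
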